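(* Suppose Assumptions (A) and (C) below hold. If $p=m^{-\beta}$ with $\beta\in(0,1]$, $n\propto\log m$, and $\delta$ converges to zero such that $\log\delta=o(\log m)$, then the step-up (BH) and the step-down (SD) procedures at a fixed FDR level $\alpha\in(0,1)$ are ABOS.
   Context: Setting. All quantities are indexed by $m$ and all limits are for $m\to\infty$; the index $m$ is suppressed. $n=n_m\in\mathbb N$, $p=p_m\in(0,1)$, $\delta_0,\delta_A>0$ may depend on $m$; $\sigma>0$ and $\nu$ are fixed, where $\nu$ is a probability measure on $\mathbb R$ with $\nu(\{0\})=0$, $\nu(-\infty,0)>0$, $\nu(0,\infty)>0$. The effects $\mu_1,\dots,\mu_m$ are i.i.d. with law $(1-p)d_0+p\nu$ ($d_0$ = Dirac measure at $0$); given them, $X_{ji}$ ($1\le j\le n$, $1\le i\le m$) are independent with $X_{ji}\sim N(\mu_i,\sigma^2)$, and $\bar X_i=\frac1n\sum_{j=1}^nX_{ji}$. One tests $H_{0i}:\mu_i=0$ against $\mu_i\ne0$, $i=1,\dots,m$. Put $\delta=\delta_0/\delta_A$, $f=(1-p)/p$. The risk $R$ of a multiple testing rule is $\delta_0$ times the expected number of false rejections plus $\delta_A$ times the expected number of false non-rejections. Bayes oracle: for large $n$ it accepts $H_{0i}$ iff $\bar X_i\in(a_n,b_n)$, where $a_n<0<b_n$ are the unique solutions $a$ of $(1-p)\delta_0=p\,\delta_A\int_{\mathbb R}\exp\left(n\left(a\frac{\mu}{\sigma^2}-\frac{\mu^2}{2\sigma^2}\right)\right)d\nu(\mu)$; it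 minimizes the risk, and its risk is $R^B$. A rule with risk $R$ is ABOS (asymptotically Bayes optimal under sparsity) if $R/R^B\to1$. Assumption (A): $n\to\infty$, $\delta f\to c\in(0,\infty]$, and $\frac{2\log(\delta f)}{n}\to C$ with $0\le C<\infty$. Assumption (C): with $T:=\sigma\sqrt C$, there is $\epsilon>0$ such that $\nu$ has a positive bounded density $\rho$ w.r.t. Lebesgue measure on $[-T-\epsilon,-T+\epsilon]$ and $[T-\epsilon,T+\epsilon]$; if $C=0$, moreover $\rho(0^-)=\lim_{\mu\uparrow0}\rho(\mu)$ and $\rho(0^+)=\lim_{\mu\downarrow0}\rho(\mu)$ exist and are finite and positive. Procedures: with $Z_i=\sqrt n\,\bar X_i/\sigma$ let $p_i=2(1-\Phi(|Z_i|))$ ($\Phi$ = standard normal cdf) and let $p_{[1]}\le\dots\le p_{[m]}$ be the ordered p-values. BH at level $\alpha$: let $k_F=\max\{i:p_{[i]}\le i\alpha/m\}$ and reject the $k_F$ hypotheses with p-values $\le p_{[k_F]}$ (no rejection if the set is empty). SD at level $\alpha$: let $k_G=\min\{i:p_{[i]}>i\alpha/m\}$ and reject the $k_G-1$ hypotheses with p-values smaller than $p_{[k_G]}$ (all are rejected if the set is empty). $g\propto h$ means that $g/h$ converges to a constant in $(0,\infty)$. *)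

(* Defs.v *)
From mathcomp Require Import all_boot all_order all_algebra.
From mathcomp Require Import all_classical all_reals all_analysis.

Set Implicit Arguments.
Unset Strict Implicit.
Unset Printing Implicit Defensive.

Import Order.TTheory GRing.Theory Num.Theory.
Import numFieldNormedType.Exports.

Local Open Scope classical_set_scope.
Local Open Scope ring_scope.

Definition effect_law (R : realType) (p : R) (nu : probability R R)
    (A : set R) : \bar R :=
  ((1 - p)%:E * \d_(0%R : R) A + p%:E * nu A)%E.

(* The third clause says that, given mu, the X j i are independent with
   X j i ~ N(mu i, sigma^2): it determines the joint law of (mu, X) on
   measurable rectangles. *)
Definition two_groups_model (R : realType) (d : measure_display)
    (Omega : measurableType d) (P : probability Omega R) (m n : nat)
    (sigma p : R) (nu : probability R R)
    (mu : 'I_m -> {RV P >-> R}) (X : 'I_n -> 'I_m -> {RV P >-> R}) : Prop :=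
  [/\ forall (i : 'I_m) (A : set R), measurable A ->
        distribution P (mu i) A = effect_law p nu A,
      forall A : 'I_m -> set R, (forall i, measurable (A i)) ->
        P [set w | forall i, A i (mu i w)] =
        (\prod_(i < m) P (mu i @^-1` A i))%E
    & forall (A : 'I_m -> set R) (B : 'I_n -> 'I_m -> set R),
        (forall i, measurable (A i)) -> (forall j i, measurable (B j i)) ->
        P [set w | (forall i, A i (mu i w)) /\
                   (forall j i, B j i (X j i w))] =
        (\int[P]_(w in [set w | forall i, A i (mu i w)])
           \prod_(i < m) \prod_(j < n) normal_prob (mu i w) sigma (B j i))%E].

Definition sample_mean (R : realType) (d : measure_display)
    (Omega : measurableType d) (P : probability Omega R) (m n : nat)
    (X : 'I_n -> 'I_m -> {RV P >-> R}) (w : Omega) (i : 'I_m) : R :=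
  (\sum_(j < n) X j i w) / n%:R.

(* A multiple testing rule is represented by its random set D w of rejected
   hypotheses. Both counts are at most m, so taking fine loses nothing. *)
Definition risk (R : realType) (d : measure_display)
    (Omega : measurableType d) (P : probability Omega R) (m : nat)
    (delta0 deltaA : R) (mu : 'I_m -> {RV P >-> R})
    (D : Omega -> {set 'I_m}) : R :=
  delta0 * fine 'E_P[fun w =>
    #|[set i : 'I_m | (i \in D w) && (mu i w == 0)]%SET|%:R] +
  deltaA * fine 'E_P[fun w =>
    #|[set i : 'I_m | (i \notin D w) && (mu i w != 0)]%SET|%:R].

Definition oracle_equation (R : realType) (n : nat)
    (sigma p delta0 deltaA : R) (nu : probability R R) (a : R) : Prop :=
  (((1 - p) * delta0)%:E =
   (p * deltaA)%:E * \int[nu]_x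
     (expR (n%:R * (a * (x / sigma ^+ 2) - x ^+ 2 / (2 * sigma ^+ 2))))%:E)%E.

(* The interval (a_n, b_n), where a_n < 0 < b_n solve the oracle equation.
   Such solutions exist, and are then unique, for large n; if there are none,
   the set is empty. *)
Definition oracle_acceptance (R : realType) (n : nat)
    (sigma p delta0 deltaA : R) (nu : probability R R) : set R :=
  [set x | exists a b : R,
    [/\ a < 0, 0 < b,
        oracle_equation n sigma p delta0 deltaA nu a,
        oracle_equation n sigma p delta0 deltaA nu b
      & a < x < b]].

Definition oracle_rejections (R : realType) (m n : nat)
    (sigma p delta0 deltaA : R) (nu : probability R R)
    (xbar : 'I_m -> R) : {set 'I_m} :=
  [set i : 'I_m |
     ~~ `[< oracle_acceptance n sigma p delta0 deltaA nu (xbar i) >]]%SET.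

Definition normal_cdf (R : realType) (x : R) : R :=
  fine (normal_prob (0 : R) 1 `]-oo, x]).

Definition p_value (R : realType) (n : nat) (sigma xbar : R) : R :=
  2 * (1 - normal_cdf `|Num.sqrt n%:R * xbar / sigma|).

(* The k-th smallest of the values q i, for k = 1, ..., m. *)
Definition ordered (R : realType) (m : nat) (q : 'I_m -> R) (k : nat) : R :=
  nth 0 (sort <=%R [seq q i | i <- enum 'I_m]) k.-1.

(* k_F, or 0 if no index qualifies. *)
Definition bh_index (R : realType) (alpha : R) (m : nat) (q : 'I_m -> R) : nat :=
  \max_(1 <= k < m.+1 | ordered q k <= k%:R * alpha / m%:R) k.

Definition bh_rejections (R : realType) (alpha : R) (m : nat)
    (q : 'I_m -> R) : {set 'I_m} :=
  [set i : 'I_m |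
     (0 < bh_index alpha q)%N && (q i <= ordered q (bh_index alpha q))]%SET.

(* k_G, or m + 1 if no index qualifies. *)
Definition sd_index (R : realType) (alpha : R) (m : nat) (q : 'I_m -> R) : nat :=
  (find (fun k : nat => k%:R * alpha / m%:R < ordered q k) (iota 1 m)).+1.

Definition sd_rejections (R : realType) (alpha : R) (m : nat)
    (q : 'I_m -> R) : {set 'I_m} :=
  [set i : 'I_m |
     (m < sd_index alpha q)%N || (q i < ordered q (sd_index alpha q))]%SET.

Definition propto (R : realType) (g h : nat -> R) : Prop :=
  exists2 K : R, 0 < K & g m / h m @[m --> \oo] --> K.

Definition assumption_A (R : realType) (n : nat -> nat) (p delta : nat -> R)
    (C : R) : Prop :=
  let f m := (1 - p m) / p m in
  [/\ n m @[m --> \oo] --> \oo,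
      exists2 c : \bar R, (0 < c)%E & (delta m * f m)%:E @[m --> \oo] --> c,
      0 <= C
    & 2 * ln (delta m * f m) / (n m)%:R @[m --> \oo] --> C].

Definition assumption_C (R : realType) (sigma : R) (nu : probability R R)
    (C : R) : Prop :=
  let T := sigma * Num.sqrt C in
  exists (e : R) (rho : R -> R),
    let D := `[- T - e, - T + e] `|` `[T - e, T + e] in
    [/\ 0 < e,
        measurable_fun D rho,
        exists M : R, forall x, D x -> 0 < rho x <= M,
        forall A : set R, measurable A -> A `<=` D ->
          nu A = (\int[lebesgue_measure]_(x in A) (rho x)%:E)%E
      & C = 0 ->
        (exists2 l : R, 0 < l & rho x @[x --> (0 : R)^'-] --> l) /\
        (exists2 l : R, 0 < l & rho x @[x --> (0 : R)^'+] --> l)].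

Definition abos (R : realType) (risk_rule risk_oracle : nat -> R) : Prop :=
  risk_rule m / risk_oracle m @[m --> \oo] --> (1 : R).

(* Main.v *)
(* The assumptions force C > 0 and n T^2 / (2 sigma^2) ~ beta log m for
   T = sigma sqrt C: this is the scale at which a signal of size T just becomes
   detectable. Put v = nu (0 < |x| < T), which is positive by Assumption (C).
   Each of the three rules asymptotically rejects exactly when |Xbar_i| > T, and
   its false rejections cost o(m p deltaA), so its risk divided by m p deltaA
   tends to v, and the ratios of the risks tend to 1.

   For the oracle, solutions of the defining equation lie in
   (T - eta, T + eta), and the equation itself, after completing the square,
   bounds the cost of its false rejections by nu (| |x| - T | < 2 eta) + o(1).
   BH and SD only reject p-values that are at most |D| alpha / m, where D is the
   set of rejections. A Chernoff bound for the null p-values then gives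
   E |D| = O(m p): false rejections cost O(delta0 m p) = o(m p deltaA), and D is
   too small to contain a typical signal with |Xbar_i| < T - eta. Conversely both
   rules accept i only if for some k with k alpha / m < p_i fewer than k p-values
   are at most k alpha / m; when |Xbar_i| > T + eta, the signals with
   mu_j in [T, T + eta] alone make this unlikely. All probabilities are computed
   from the fact that the effects mu_i and the standardized noises
   sqrt n (Xbar_i - mu_i) / sigma are independent. *)

From HB Require Import structures.
From mathcomp Require Import all_boot all_order all_algebra.
From mathcomp Require Import all_classical all_reals all_analysis.
From mathcomp Require Import measurable_realfun ring lra.
Require Import Defs.

Set Implicit Arguments.
Unset Strict Implicit.
Unset Printing Implicit Defensive.

Import Order.TTheory GRing.Theory Num.Theory.
Import numFieldNormedType.Exports.

Local Open Scope classical_set_scope.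
Local Open Scope ring_scope.


(** * Normal distributions *)

(** BH and SD enter only through two deterministic facts: a bound on rejected p-values in terms of
    [#|D|], and a level with too few p-values whenever one is accepted. So one argument serves both.
    The bound by [#|D|] is circular, since [D] depends on all the data; the circle is broken by
    summing over the possible values k of [#|D|]. At most alpha k null p-values are expected below k
    alpha / m, so finding h k of them, with alpha < h < 1, is exponentially unlikely in k, and the
    total excess is bounded uniformly in m. As beta <= 1 gives m p >= 1, this constant is O(m p).
    The random sets [D] are not shown to be measurable: counts are compared with measurable
    functions of the effects and the noises, whose expectations factorize. The model gives the law
    of effects and observations on rectangles, whereas noises mix the two; independence is
    transported by uniqueness of measures, one coordinate at a time. At T itself all exponents
    balance, so every comparison is made at T - eta or T + eta, where they differ by a multiple of
    n; the price is the [nu]-mass near T, made small by the bounded density. *)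

Definition weighted_measure d (T : measurableType d) (R : realType)
    (mu : {measure set T -> \bar R}) (h : T -> R)
    (mh : measurable_fun setT h) (h0 : forall x, 0 <= h x) (A : set T) : \bar R :=
  (\int[mu]_(x in A) (h x)%:E)%E.

Section weighted_measure.
Local Open Scope ereal_scope.
Context d (T : measurableType d) (R : realType) (mu : {measure set T -> \bar R}).
Variables (h : T -> R) (mh : measurable_fun setT h).
Hypothesis h0 : forall x, (0 <= h x)%R.

Import HBNNSimple.

Let w := weighted_measure mu mh h0.

Let w0 : w set0 = 0. Proof. exact: integral_set0. Qed.

Let w_ge0 A : 0 <= w A.
Proof. by apply: integral_ge0 => x _; rewrite lee_fin. Qed.

Let w_sigma_additive : semi_sigma_additive w.
Proof.
apply: semi_sigma_additive_nng_induced => [|x]; last by rewrite lee_fin.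
exact/measurable_EFinP.
Qed.

HB.instance Definition _ :=
  isMeasure.Build _ _ _ w w0 w_ge0 w_sigma_additive.

(** By monotone convergence along simple functions increasing to [g], it suffices to treat a simple
    function, where the identity is the definition of [w] on each level set. *)
Lemma ge0_integral_weighted (g : T -> \bar R) :
  measurable_fun setT g -> (forall x, 0 <= g x) ->
  \int[w]_x g x = \int[mu]_x (g x * (h x)%:E).
Proof.
move=> mg g0.
pose g_ := nnsfun_approx measurableT mg.
have cvg_g x : (g_ n x)%:E @[n --> \oo] --> g x.
  by apply: cvg_nnsfun_approx.
have nd_g x : nondecreasing_seq (fun n => (g_ n x)%:E).
  by move=> m n mn; rewrite lee_fin; exact/lefP/nd_nnsfun_approx.
have mhE : measurable_fun setT (EFin \o h) by exact/measurable_EFinP.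
transitivity (limn (fun n => \int[w]_x (g_ n x)%:E)).
  rewrite -monotone_convergence//.
  - by apply: eq_integral => x _; apply/esym/cvg_lim.
  - by move=> n; exact/measurable_EFinP.
  - by move=> n x _; rewrite lee_fin.
transitivity (limn (fun n => \int[mu]_x ((g_ n x)%:E * (h x)%:E))); last first.
  rewrite -monotone_convergence//.
  - apply: eq_integral => x _; apply/cvg_lim => //.
    by apply: cvgeZr => //.
  - by move=> n; apply: emeasurable_funM => //; exact/measurable_EFinP.
  - by move=> n x _; rewrite -EFinM lee_fin mulr_ge0.
  - by move=> x _ m n mn; rewrite lee_wpmul2r ?lee_fin//; exact/lefP/nd_nnsfun_approx.
congr (limn _); apply/funext => n.
transitivity (\sum_(k \in range (g_ n)) k%:E * w (g_ n @^-1` [set k])).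
  by rewrite integralT_nnsfun sintegralE.
transitivity (\int[mu]_x (\sum_(k \in range (g_ n))
    ((k * \1_(g_ n @^-1` [set k]) x)%:E * (h x)%:E))); last first.
  apply: eq_integral => x _; rewrite -ge0_mule_fsuml ?fsumEFin -?fimfunE// => r.
  exact: nnfun_muleindic_ge0.
rewrite ge0_integral_fsum//; last 2 first.
- move=> r; apply: emeasurable_funM => //; apply/measurable_EFinP.
  exact: measurable_funM.
- move=> r x _; apply: mule_ge0; last by rewrite lee_fin.
  exact: nnfun_muleindic_ge0.
apply: eq_fsbigr => r _.
(* A negative [r] is not a value of the nonnegative approximation: its level set is empty and both
   sides vanish. *)
have [r0|r0] := leP 0%R r; last first.
  rewrite preimage_nnfun0// measure0 mule0.
  by under eq_integral do rewrite indic0 mulr0 mul0e; rewrite integral0.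
rewrite -ge0_integralZl//.
- rewrite integral_mkcond; apply: eq_integral => x _.
  rewrite /patch indicE; case: ifPn => _; first by rewrite mulr1.
  by rewrite mulr0 mul0e.
- exact: measurable_funTS.
- by move=> x _; rewrite lee_fin.
Qed.

End weighted_measure.

Lemma ge0_integral_normal (R : realType) (m s : R) (g : R -> \bar R) :
  measurable_fun setT g -> (forall x, 0 <= g x)%E ->
  (\int[normal_prob m s]_x g x =
   \int[lebesgue_measure]_x (g x * (normal_pdf m s x)%:E))%E.
Proof.
move=> mg g0.
exact: (@ge0_integral_weighted _ _ _ lebesgue_measure _
  (measurable_normal_pdf m s) (normal_pdf_ge0 m s)).
Qed.

(** * Lebesgue measure and normal laws under translation and dilation *)

Lemma lebesgue_measure_shift (R : realType) (b : R) (A : set R) : measurable A ->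
  pushforward lebesgue_measure ((fun x => x + b) : R -> measurableTypeR R) A = lebesgue_measure A.
Proof.
have mb : measurable_fun setT ((fun x => x + b) : measurableTypeR R -> measurableTypeR R).
  exact: measurable_funD.
pose f : {mfun measurableTypeR R >-> measurableTypeR R} :=
  HB.pack ((fun x => x + b) : measurableTypeR R -> measurableTypeR R) (isMeasurableFun.Build _ _ _ _ _ mb).
move=> mA; apply/esym.
apply: (lebesgue_measure_unique (mu := pushforward lebesgue_measure f)) => // _ [[x y]] _ <-.
have E : (fun z => z + b) @^-1` `]x, y]%classic = `]x - b, y - b]%classic.
  by apply/seteqP; split => z /=; rewrite !in_itv/= ltrBlDr lerBrDr.
rewrite [RHS](_ : _ = lebesgue_measure `]x - b, y - b]%classic); last by rewrite -E.
rewrite !lebesgue_measure_itv/= !lte_fin ltrD2r; case: ifPn => // _.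
by rewrite -!EFinB; congr EFin; ring.
Qed.

Lemma lebesgue_measure_dilate (R : realType) (c : R) (A : set R) : 0 < c ->
  measurable A ->
  (c%:E * pushforward lebesgue_measure ((fun x => (c * x)%R) : R -> measurableTypeR R) A =
   lebesgue_measure A)%E.
Proof.
move=> c0.
have mb : measurable_fun setT ((fun x => c * x) : measurableTypeR R -> measurableTypeR R).
  exact: measurable_funM.
pose f : {mfun measurableTypeR R >-> measurableTypeR R} :=
  HB.pack ((fun x => c * x) : measurableTypeR R -> measurableTypeR R) (isMeasurableFun.Build _ _ _ _ _ mb).
pose c' : {nonneg R} := NngNum (ltW c0).
move=> mA; apply/esym.
apply: (lebesgue_measure_unique (mu := mscale c' (pushforward lebesgue_measure f))) => // _ [[x y]] _ <-.
have E : (fun z => c * z) @^-1` `]x, y]%classic = `]x / c, y / c]%classic.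
  by apply/seteqP; split => z /=; rewrite !in_itv/= ltr_pdivrMr// ler_pdivlMr// mulrC.
rewrite [RHS](_ : _ = (c%:E * lebesgue_measure (`](x / c)%R, (y / c)%R] : set R))%E); last by rewrite -E.
rewrite !lebesgue_measure_itv/= !lte_fin ltr_pM2r ?invr_gt0//; case: ifPn => // _.
  by rewrite -!EFinB -EFinM; congr EFin; field; rewrite gt_eqF.
by rewrite mule0.
Qed.

Lemma ge0_integral_shift (R : realType) (b : R) (f : R -> \bar R) :
  measurable_fun setT f -> (forall x, 0 <= f x)%E ->
  (\int[lebesgue_measure]_x f (x + b)%R = \int[lebesgue_measure]_x f x)%E.
Proof.
move=> mf f0.
have mb : measurable_fun setT ((fun x => x + b) : measurableTypeR R -> measurableTypeR R).
  exact: measurable_funD.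
transitivity (\int[pushforward lebesgue_measure ((fun x => (x + b)%R) : R -> measurableTypeR R)]_x f x)%E.
  by rewrite ge0_integral_pushforward.
apply: eq_measure_integral => A mA _; exact: lebesgue_measure_shift.
Qed.

Lemma ge0_integral_dilate (R : realType) (c : R) (f : R -> \bar R) : 0 < c ->
  measurable_fun setT f -> (forall x, 0 <= f x)%E ->
  (c%:E * \int[lebesgue_measure]_x f (c * x)%R = \int[lebesgue_measure]_x f x)%E.
Proof.
move=> c0 mf f0.
have mb : measurable_fun setT ((fun x => c * x) : measurableTypeR R -> measurableTypeR R).
  exact: measurable_funM.
pose h : {mfun measurableTypeR R >-> measurableTypeR R} :=
  HB.pack ((fun x => c * x) : measurableTypeR R -> measurableTypeR R) (isMeasurableFun.Build _ _ _ _ _ mb).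
pose c' : {nonneg R} := NngNum (ltW c0).
transitivity (c'%:num%:E * \int[pushforward lebesgue_measure h]_x f x)%E.
  by rewrite ge0_integral_pushforward.
rewrite -ge0_integral_mscale//.
apply: eq_measure_integral => A mA _; exact: lebesgue_measure_dilate.
Qed.

Lemma normal_prob_fineK (R : realType) (m s : R) (B : set R) : measurable B ->
  (fine (normal_prob m s B))%:E = normal_prob m s B.
Proof. by move=> mB; rewrite fineK// fin_num_measure. Qed.

Lemma normal_probE (R : realType) (m s : R) (B : set R) :
  (normal_prob m s B = \int[lebesgue_measure]_x (\1_B x * normal_pdf m s x)%:E)%E.
Proof.
rewrite /normal_prob integral_mkcond; apply: eq_integral => x _.
by rewrite /patch indicE; case: ifPn => _; rewrite ?mul1r ?mul0r.
Qed.

Lemma normal_fun_shift (R : realType) (m b s x : R) :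
  normal_fun (m + b) s (x + b) = normal_fun m s x.
Proof. by rewrite /normal_fun opprD addrACA subrr addr0. Qed.

Lemma normal_prob_shift (R : realType) (m b s : R) (B : set R) :
  measurable B -> s != 0 ->
  normal_prob (m + b) s B = normal_prob m s ((fun x => x + b) @^-1` B).
Proof.
move=> mB s0; rewrite !normal_probE.
rewrite -(ge0_integral_shift b) => [||x]; first last.
- by rewrite lee_fin mulr_ge0// normal_pdf_ge0.
- by apply/measurable_EFinP/measurable_funM => //; exact: measurable_normal_pdf.
apply: eq_integral => x _; congr (_ * _)%:E.
by rewrite !normal_pdfE// normal_fun_shift.
Qed.

Lemma normal_fun_dilate (R : realType) (c s x : R) : c != 0 ->
  normal_fun 0 (c * s) (c * x) = normal_fun 0 s x.
Proof.
move=> c0; rewrite /normal_fun !subr0 !exprMn -mulrnAr -mulrN -mulf_div divff ?mul1r//.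
by rewrite expf_neq0.
Qed.

Lemma normal_peak_dilate (R : realType) (c s : R) : 0 < c ->
  c * normal_peak (c * s) = normal_peak s.
Proof.
move=> c0; rewrite /normal_peak exprMn -mulrA -mulrnAr sqrtrM ?sqr_ge0//.
by rewrite sqrtr_sqr gtr0_norm// invfM mulrA divff ?gt_eqF// mul1r.
Qed.

Lemma normal_prob_dilate (R : realType) (c s : R) (B : set R) :
  measurable B -> 0 < c -> 0 < s ->
  normal_prob 0 (c * s) B = normal_prob 0 s ((fun x => c * x) @^-1` B).
Proof.
move=> mB c0 s0; rewrite !normal_probE.
rewrite -(ge0_integral_dilate c0) => [||x]; first last.
- by rewrite lee_fin mulr_ge0// normal_pdf_ge0.
- by apply/measurable_EFinP/measurable_funM => //; exact: measurable_normal_pdf.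
have mF : measurable_fun setT (fun x : R => (\1_B x * normal_pdf 0 (c * s) x)%:E).
  by apply/measurable_EFinP/measurable_funM => //; exact: measurable_normal_pdf.
rewrite -ge0_integralZl ?lee_fin ?(ltW c0)//; last 2 first.
- exact: (measurableT_comp mF (mulrl_measurable c)).
- by move=> x _; rewrite lee_fin mulr_ge0// normal_pdf_ge0.
apply: eq_integral => x _; rewrite -EFinM; congr EFin.
rewrite mulrCA; congr (_ * _).
rewrite !normal_pdfE ?gt_eqF ?mulr_gt0//.
by rewrite normal_fun_dilate ?gt_eqF// mulrA normal_peak_dilate.
Qed.

(** * Convolution of centred normal laws *)

Lemma normal_fun_conv (R : realType) (s t u x : R) : 0 < s -> 0 < t ->
  let r := Num.sqrt (s ^+ 2 + t ^+ 2) in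
  normal_fun u t x * normal_fun 0 s u =
  normal_fun 0 r x * normal_fun (s ^+ 2 / r ^+ 2 * x) (s * t / r) u.
Proof.
move=> s0 t0 r; rewrite /normal_fun -!expRD; congr expR.
have st0 : 0 < s ^+ 2 + t ^+ 2 by rewrite addr_gt0// exprn_gt0.
have r2 : r ^+ 2 = s ^+ 2 + t ^+ 2 by rewrite sqr_sqrtr// ltW.
rewrite (_ : (s * t / r) ^+ 2 = s ^+ 2 * t ^+ 2 / r ^+ 2); last first.
  by rewrite exprMn exprVn exprMn.
rewrite r2; field; rewrite !gt_eqF//.
Qed.

Lemma normal_peak_conv (R : realType) (s t : R) : 0 < s -> 0 < t ->
  let r := Num.sqrt (s ^+ 2 + t ^+ 2) in
  normal_peak t * normal_peak s = normal_peak r * normal_peak (s * t / r).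
Proof.
move=> s0 t0 r.
have st0 : 0 < s ^+ 2 + t ^+ 2 by rewrite addr_gt0// exprn_gt0.
have r2 : r ^+ 2 = s ^+ 2 + t ^+ 2 by rewrite sqr_sqrtr// ltW.
rewrite /normal_peak -!invfM; congr (_^-1).
have h (x : R) : 0 <= x ^+ 2 * pi *+ 2.
  by rewrite mulrn_wge0// mulr_ge0 ?sqr_ge0 ?pi_ge0.
rewrite -!sqrtrM//; congr (Num.sqrt _).
rewrite (_ : (s * t / r) ^+ 2 = s ^+ 2 * t ^+ 2 / r ^+ 2); last first.
  by rewrite exprMn exprVn exprMn.
rewrite r2; field; rewrite gt_eqF//.
Qed.

(** Completing the square in [u]. For independent U and V with standard deviations [s] and [t], this
    factors the density of (U, U + V) into that of U + V and the conditional density of U given U +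
    V = x, which has mean [s^2 / r^2 x] and standard deviation [s t / r]. *)
Lemma normal_pdf_conv (R : realType) (s t u x : R) : 0 < s -> 0 < t ->
  let r := Num.sqrt (s ^+ 2 + t ^+ 2) in
  normal_pdf u t x * normal_pdf 0 s u =
  normal_pdf 0 r x * normal_pdf (s ^+ 2 / r ^+ 2 * x) (s * t / r) u.
Proof.
move=> s0 t0 r.
have r0 : 0 < r by rewrite sqrtr_gt0 addr_gt0// exprn_gt0.
rewrite !normal_pdfE ?gt_eqF ?divr_gt0 ?mulr_gt0//.
by rewrite mulrACA normal_peak_conv// normal_fun_conv// mulrACA.
Qed.

Lemma measurable_add_preimage (R : realType) (B : set R) : measurable B ->
  measurable [set z : R * R | B (z.1 + z.2)].
Proof.
move=> mB; rewrite (_ : [set _ | _] = (fun z : R * R => z.1 + z.2) @^-1` B)//.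
by rewrite -[X in measurable X]setTI; exact: measurable_funD.
Qed.

(** Moving the mean into the set makes measurability in [u] a case of the measurability of sections
    under a fixed measure. *)
Lemma normal_prob_xsection (R : realType) (u t : R) (B : set R) :
  t != 0 -> measurable B ->
  normal_prob u t B = normal_prob 0 t (xsection [set z : R * R | B (z.1 + z.2)] u).
Proof.
move=> t0 mB; rewrite -[X in normal_prob X t B]add0r normal_prob_shift//.
by congr (normal_prob 0 t _); apply/seteqP; split => v; rewrite /xsection/= inE/= addrC.
Qed.

Lemma measurable_normal_prob_mean (R : realType) (t : R) (B : set R) :
  t != 0 -> measurable B -> measurable_fun setT (fun u : R => normal_prob u t B).
Proof.
move=> t0 mB; under eq_fun do rewrite normal_prob_xsection//.
exact: (measurable_fun_xsection (normal_prob 0 t) (measurable_add_preimage mB)).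
Qed.

(** After exchanging the integrals, the conditional density of the first summand given the sum
    integrates to one and only the density of the sum remains. *)
Lemma normal_prob_conv (R : realType) (s t : R) (B : set R) :
  0 < s -> 0 < t -> measurable B ->
  (normal_prob 0 s \x normal_prob 0 t)%E [set z : R * R | B (z.1 + z.2)] =
  normal_prob 0 (Num.sqrt (s ^+ 2 + t ^+ 2)) B.
Proof.
move=> s0 t0 mB; set r := Num.sqrt _.
have r0 : 0 < r by rewrite sqrtr_gt0 addr_gt0// exprn_gt0.
pose f (z : R * R) : \bar R :=
  (\1_B z.2 * (normal_pdf 0 t (z.2 - z.1) * normal_pdf 0 s z.1))%:E.
have fE u x : f (u, x) = (\1_B x * (normal_pdf u t x * normal_pdf 0 s u))%:E.
  rewrite /f/= -(addNr u) addrC; congr (_ * (_ * _))%:E.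
  by rewrite !normal_pdfE ?gt_eqF// normal_fun_shift.
have mf : measurable_fun setT f.
  apply/measurable_EFinP; apply: measurable_funM.
    exact: measurableT_comp.
  apply: measurable_funM.
    apply: (measurableT_comp (measurable_normal_pdf 0 t)).
    exact: measurable_funB.
  exact: (measurableT_comp (measurable_normal_pdf 0 s)).
have f0 z : (0 <= f z)%E by rewrite lee_fin !mulr_ge0// normal_pdf_ge0.
transitivity (\int[normal_prob 0 s]_u normal_prob u t B)%E.
  rewrite /product_measure1; apply: eq_integral => u _ /=.
  by rewrite [RHS]normal_prob_xsection ?gt_eqF.
transitivity (\int[lebesgue_measure]_u \int[lebesgue_measure]_x f (u, x))%E.
  rewrite ge0_integral_normal; last 2 first.
  - by apply: measurable_normal_prob_mean; rewrite ?gt_eqF.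
  - by move=> u; exact: measure_ge0.
  apply: eq_integral => u _; rewrite normal_probE -ge0_integralZr ?lee_fin ?normal_pdf_ge0//.
  + by apply: eq_integral => x _; rewrite fE -EFinM mulrA.
  + by apply/measurable_EFinP/measurable_funM => //; exact: measurable_normal_pdf.
  + by move=> x _; rewrite lee_fin mulr_ge0// normal_pdf_ge0.
rewrite fubini_tonelli// normal_probE; apply: eq_integral => x _.
under eq_integral do rewrite fE normal_pdf_conv// mulrA EFinM.
rewrite ge0_integralZl ?lee_fin ?mulr_ge0 ?normal_pdf_ge0//.
- by rewrite integral_normal_pdf mule1.
- by apply/measurable_EFinP; exact: measurable_normal_pdf.
- by move=> u _; rewrite lee_fin normal_pdf_ge0.
Qed.

(** * The upper tail of the standard normal law *)

Definition normal_tail (R : realType) (y : R) : R :=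
  fine (normal_prob (0 : R) 1 `[y, +oo[).

Section normal_tail.
Context (R : realType).
Implicit Types y z t : R.
Local Notation N := (normal_prob (0 : R) 1).
Local Notation tail := (@normal_tail R).

Lemma normal_tailE y : N `[y, +oo[ = (tail y)%:E.
Proof. by rewrite fineK// fin_num_measure. Qed.

Lemma normal_tail_ge0 y : 0 <= tail y.
Proof. exact: fine_ge0. Qed.

Lemma normal_cdfE y : 1 - normal_cdf y = tail y.
Proof.
suff : (1 - normal_cdf y)%:E = (tail y)%:E by case.
rewrite EFinB -normal_tailE normal_prob_fineK//.
rewrite -(@probability_setC _ _ _ N)// setCitvl /normal_prob.
apply: integral_itv_obnd_cbnd.
by apply/measurable_EFinP/measurable_funTS; exact: measurable_normal_pdf.
Qed.

Lemma normal_prob_sym (B : set R) : measurable B -> N (-%R @^-1` B) = N B.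
Proof.
move=> mB; rewrite !normal_probE.
have mF : measurable_fun setT (fun x : R => (\1_B x * normal_pdf 0 1 x)%:E).
  by apply/measurable_EFinP/measurable_funM => //; exact: measurable_normal_pdf.
transitivity (\int[pushforward lebesgue_measure (-%R : R -> measurableTypeR R)]_x
   (\1_B x * normal_pdf 0 1 x)%:E)%E.
  rewrite ge0_integral_pushforward; last 4 first.
  - exact: oppr_measurable.
  - exact: measurableT.
  - exact: mF.
  - by move=> x _; rewrite lee_fin mulr_ge0// normal_pdf_ge0.
  apply: eq_integral => x _ /=; rewrite !normal_pdfE ?oner_eq0// /normal_fun.
  by rewrite !subr0 sqrrN.
by apply: eq_measure_integral => A mA _; exact: lebesgue_measureN.
Qed.

Lemma normal_prob_lty y : N `]-oo, y] = (tail (- y))%:E.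
Proof.
rewrite -normal_tailE -[RHS]normal_prob_sym//; congr N.
by apply/seteqP; split => x /=; rewrite !in_itv/= andbT lerN2.
Qed.

Lemma le_normal_tail y z : y <= z -> tail z <= tail y.
Proof.
move=> yz; rewrite -lee_fin -!normal_tailE; apply: le_measure; rewrite ?inE//.
by apply: subset_itvr; rewrite bnd_simp.
Qed.

Lemma normal_tailB y z : y <= z -> tail y - tail z = fine (N `[y, z[).
Proof.
move=> yz; apply/eqP; rewrite subr_eq; apply/eqP.
suff : (tail y)%:E = (fine (N `[y, z[) + tail z)%:E by case.
rewrite EFinD -(normal_tailE y) -(normal_tailE z) normal_prob_fineK//.
rewrite -measureU//; last first.
  by apply/seteqP; split => x //=; rewrite !in_itv/= andbT => -[/andP[_ /lt_geF ->]].
congr N; apply/seteqP; split => x /=; rewrite !in_itv/= !andbT.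
  by move=> yx; case: (ltP x z) => xz; [left; rewrite yx|right].
by move=> [/andP[]//|]; exact: le_trans.
Qed.

Lemma normal_tail_lipschitz y z : y <= z ->
  tail y - tail z <= normal_peak 1 * (z - y).
Proof.
move=> yz; rewrite normal_tailB// -lee_fin normal_prob_fineK//.
apply: (@le_trans _ _ (\int[lebesgue_measure]_(x in `[y, z[) (normal_peak 1 : R)%:E)%E).
  apply: ge0_le_integral => //=.
  - by move=> x _; rewrite lee_fin normal_pdf_ge0.
  - by apply/measurable_EFinP/measurable_funTS; exact: measurable_normal_pdf.
  - by move=> x _; rewrite lee_fin normal_pdf_ub ?oner_eq0.
rewrite integral_cst//= lebesgue_measure_itv/= lte_fin.
case: ltP => _; first by rewrite -EFinB -EFinM.
by rewrite mule0 lee_fin mulr_ge0 ?normal_peak_ge0 ?subr_ge0.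
Qed.

Lemma normal_tail_dist y z : `|tail y - tail z| <= normal_peak 1 * `|y - z|.
Proof.
wlog yz : y z / y <= z.
  move=> h; case: (leP y z) => [|/ltW]; first exact: h.
  by rewrite distrC (distrC y); exact: h.
rewrite ger0_norm ?subr_ge0 ?le_normal_tail// distrC ger0_norm ?subr_ge0//.
exact: normal_tail_lipschitz.
Qed.

Lemma normal_tailB_ge y z : 0 <= y -> y <= z ->
  normal_peak 1 * expR (- z ^+ 2 / 2) * (z - y) <= tail y - tail z.
Proof.
move=> y0 yz; rewrite normal_tailB// -lee_fin normal_prob_fineK//.
apply: (@le_trans _ _ (\int[lebesgue_measure]_(x in `[y, z[)
   (normal_peak 1 * expR (- z ^+ 2 / 2))%:E)%E).
  rewrite integral_cst//= lebesgue_measure_itv/= lte_fin; case: ltP => zy.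
    by rewrite -EFinM lee_fin.
  by rewrite (_ : z - y = 0) ?mulr0 ?mule0//; apply/eqP; rewrite subr_eq0 eq_le zy.
apply: ge0_le_integral => //=.
- by move=> x _; rewrite lee_fin mulr_ge0 ?normal_peak_ge0 ?expR_ge0.
- by apply/measurable_EFinP/measurable_funTS; exact: measurable_normal_pdf.
- move=> x; rewrite in_itv/= => /andP[yx xz].
  rewrite lee_fin normal_pdfE ?oner_eq0// ler_pM2l ?normal_peak_gt0 ?oner_eq0//.
  rewrite ler_expR subr0 expr1n ler_pM2r ?invr_gt0 ?ltr0n// lerN2.
  by rewrite ler_sqr ?nnegrE ?(le_trans y0)// ltW// (le_lt_trans yx).
Qed.

(** Only the mass of [[y, y + 1[] is kept, where the density is at least its value at [y + 1].
    Replacing y^2 by (y + 1)^2 is affordable because only leading exponents will be compared. *)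
Lemma normal_tail_lb y : 0 <= y ->
  normal_peak 1 * expR (- (y + 1) ^+ 2 / 2) <= tail y.
Proof.
move=> y0; have y1 : y <= y + 1 by rewrite lerDl.
have := normal_tailB_ge y0 y1; rewrite (addrC y) addrK mulr1 => h.
by rewrite (le_trans h)// lerBlDr lerDl normal_tail_ge0.
Qed.

Lemma normal_tail_gt y z : 0 <= y -> y < z -> tail z < tail y.
Proof.
move=> y0 yz; rewrite -subr_gt0; apply: lt_le_trans (normal_tailB_ge y0 (ltW yz)).
by rewrite !mulr_gt0 ?expR_gt0 ?subr_gt0 ?normal_peak_gt0 ?oner_eq0.
Qed.

(** Change of measure: moving the mean to [z] multiplies the density at x by expR (x z - z^2 / 2),
    which for x >= y is at least the factor stated. With z = y it yields the Gaussian tail bound;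
    later it compares the p-values of signals with those of nulls. *)
Lemma normal_tail_shift_ge y z : 0 <= z ->
  expR (y * z - z ^+ 2 / 2) * tail y <= tail (y - z).
Proof.
move=> z0; rewrite -lee_fin EFinM -!normal_tailE.
rewrite [leRHS](_ : _ = normal_prob (0 + z) 1 `[y, +oo[); last first.
  rewrite normal_prob_shift ?oner_eq0//; congr N.
  by apply/seteqP; split => x /=; rewrite !in_itv/= !andbT lerBlDr.
rewrite add0r /normal_prob -ge0_integralZl ?lee_fin ?expR_ge0//; last 2 first.
- by apply/measurable_EFinP/measurable_funTS; exact: measurable_normal_pdf.
- by move=> x _; rewrite lee_fin normal_pdf_ge0.
apply: ge0_le_integral => //=.
- by move=> x _; rewrite -EFinM lee_fin mulr_ge0 ?expR_ge0 ?normal_pdf_ge0.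
- apply/measurable_EFinP/measurable_funM => //.
  by apply/measurable_funTS; exact: measurable_normal_pdf.
- by apply/measurable_EFinP/measurable_funTS; exact: measurable_normal_pdf.
- move=> x; rewrite in_itv/= andbT => yx; rewrite -EFinM lee_fin !normal_pdfE ?oner_eq0//.
  rewrite mulrCA ler_pM2l ?normal_peak_gt0 ?oner_eq0// -expRD ler_expR.
  rewrite subr0 expr1n; have : 0 <= (x - y) * z by rewrite mulr_ge0 ?subr_ge0.
  nra.
Qed.

Lemma normal_tail_le y : 0 <= y -> tail y <= expR (- y ^+ 2 / 2).
Proof.
move=> y0; rewrite -(@ler_pM2l _ (expR (y * y - y ^+ 2 / 2))) ?expR_gt0//.
apply: le_trans (normal_tail_shift_ge y y0) _.
rewrite -expRD (_ : y * y - y ^+ 2 / 2 + _ = 0) ?expR0; last by field.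
rewrite -lee_fin -normal_tailE; exact: probability_le1.
Qed.

Lemma normal_tail0 : tail 0 = 2^-1.
Proof.
have := normal_cdfE 0; rewrite /normal_cdf normal_prob_lty oppr0/= => h.
by apply: (mulfI (_ : 2 != 0)); lra.
Qed.

Lemma continuous_normal_tail : continuous tail.
Proof.
move=> y; apply/cvgrPdist_le => e e0; near=> z.
rewrite (le_trans (normal_tail_dist _ _))// -ler_pdivlMl ?normal_peak_gt0 ?oner_eq0//.
near: z; apply: (@cvgr_dist_le _ R^o) => //.
by rewrite mulr_gt0// invr_gt0 normal_peak_gt0 ?oner_eq0.
Unshelve. all: by end_near. Qed.

Lemma normal_tail_inv t : 0 < t -> t <= 1 ->
  exists2 y, 0 <= y & 2 * tail y = t /\ forall z, 0 <= z -> (2 * tail z <= t) = (y <= z).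
Proof.
move=> t0 t1.
have [y y0 yt] : exists2 y, 0 <= y & tail y = t / 2.
  (* Chosen so that expR (- Y^2 / 2) = t / 2, which brackets the root between 0 and [Y]. *)
  pose Y := Num.sqrt (2 * ln (2 / t)).
  have Y0 : 0 <= Y by exact: sqrtr_ge0.
  have tY : tail Y <= t / 2.
    rewrite (le_trans (normal_tail_le Y0))// sqr_sqrtr; last first.
      by rewrite mulr_ge0// ln_ge0// ler_pdivlMr// mul1r (le_trans t1)// ler1n.
    rewrite mulNr mulrAC divff// mul1r -lnV ?posrE ?divr_gt0// lnK ?posrE ?invr_gt0 ?divr_gt0//.
    by rewrite invf_div.
  have [||y] := @IVT R tail 0 Y (t / 2) Y0.
  - by apply: continuous_subspaceT; exact: continuous_normal_tail.
  - rewrite ge_min tY orbT/= le_max normal_tail0 ler_pdivrMr// mulVf// t1//.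
  - by rewrite in_itv/= => /andP[y0 _] yt; exists y.
exists y => //; split; first by rewrite yt; field.
move=> z z0; rewrite -ler_pdivlMl// mulrC -yt.
have [yz|zy] := leP y z; first by rewrite le_normal_tail.
by apply/negbTE; rewrite -ltNge normal_tail_gt.
Qed.

End normal_tail.

(** * Independence of effects and noise *)

Lemma rectangle_measure_unique (R : realType)
    (m1 m2 : {measure set (R * R) -> \bar R}) :
  (m1 setT < +oo)%E ->
  (forall A B, measurable A -> measurable B -> m1 (A `*` B) = m2 (A `*` B)) ->
  forall E, measurable E -> m1 E = m2 E.
Proof.
move=> m1oo m12 E mE.
apply: (measure_unique [set A `*` B | A in measurable & B in measurable] (fun=> setT)) => //.
- exact: measurable_prod_measurableType.
- move=> _ _ [A1 mA1 [B1 mB1 <-]] [A2 mA2 [B2 mB2 <-]].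
  rewrite -setXI; exists (A1 `&` A2); first exact: measurableI.
  by exists (B1 `&` B2) => //; exact: measurableI.
- by move=> _; exists setT => //; exists setT => //; rewrite setXTT.
- by rewrite bigcup_const.
- by move=> _ [A mA [B mB <-]]; exact: m12.
Qed.

(** [F] gathers the constraints on the other variables, and [h] is the conditional probability of
    [F] given the effects. The law of (M, U) on [F] and the image of the product of h P with N(0,
    s^2) under (w, z) -> (M w, z + M w) agree on rectangles, hence on all measurable sets. The set
    where M lies in [A] and U - M in [B] is not a rectangle, which is why uniqueness is invoked. *)
Lemma normal_center (R : realType) d (Omega : measurableType d)
    (P : probability Omega R) (F : set Omega) (U M h : Omega -> R) (s : R) :
  s != 0 -> measurable F -> measurable_fun setT U -> measurable_fun setT M ->
  measurable_fun setT h -> (forall w, 0 <= h w <= 1) ->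
  (forall A B : set R, measurable A -> measurable B ->
    P (F `&` (M @^-1` A) `&` (U @^-1` B)) =
    (\int[P]_(w in M @^-1` A) (h w * fine (normal_prob (M w) s B))%:E)%E) ->
  forall A B : set R, measurable A -> measurable B ->
    P (F `&` (M @^-1` A) `&` ((fun w => U w - M w) @^-1` B)) =
    (\int[P]_(w in M @^-1` A) (h w * fine (normal_prob 0 s B))%:E)%E.
Proof.
move=> s0 mF mU mM mh h01 H A B mA mB.
have h0 w : 0 <= h w by have /andP[] := h01 w.
pose k := weighted_measure P mh h0.
have mpre (f : Omega -> R) (C : set R) : measurable_fun setT f -> measurable C ->
    measurable (f @^-1` C).
  by move=> mf mC; rewrite -[X in measurable X]setTI; exact: mf.
have mMU : measurable_fun setT (fun w => (M w, U w)) by exact: measurable_fun_pair.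
have mphi : measurable_fun setT (fun wz : Omega * R => (M wz.1, wz.2 + M wz.1)).
  apply: measurable_fun_pair; first exact: measurableT_comp.
  by apply: measurable_funD => //; exact: measurableT_comp.
pose MU : {mfun Omega >-> (R * R)%type} :=
  HB.pack (fun w => (M w, U w)) (isMeasurableFun.Build _ _ _ _ _ mMU).
pose phi : {mfun (Omega * R)%type >-> (R * R)%type} :=
  HB.pack (fun wz : Omega * R => (M wz.1, wz.2 + M wz.1))
    (isMeasurableFun.Build _ _ _ _ _ mphi).
pose m1 := pushforward (mrestr P mF) MU.
pose m2 := pushforward (k \x normal_prob 0 s)%E phi.
have m2E E : measurable E -> m2 E =
    (\int[P]_w ((h w)%:E * normal_prob 0 s [set z | E (M w, z + M w)%R]))%E.
  move=> mE.
  rewrite /m2 /pushforward /product_measure1 ge0_integral_weighted//.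
  - apply: eq_integral => w _; rewrite muleC; congr (_ * normal_prob 0 s _)%E.
    by apply/seteqP; split => z; rewrite /xsection/= inE.
  - apply: measurable_fun_xsection.
    by have := mphi measurableT _ mE; rewrite setTI.
have m1E E : m1 E = P (F `&` [set w | E (M w, U w)]).
  by rewrite /m1 /pushforward /mrestr setIC.
have key E : measurable E -> m1 E = m2 E.
  apply: rectangle_measure_unique.
    change (m1 setT < +oo)%E.
    rewrite m1E (_ : F `&` _ = F); last by apply/seteqP; split => w // -[].
    by rewrite (le_lt_trans (probability_le1 _ _)) ?ltry.
  move=> A' B' mA' mB'; change (m1 (A' `*` B') = m2 (A' `*` B')).
  rewrite [LHS]m1E [RHS]m2E; last exact: measurableX.
  rewrite (_ : _ `&` _ = F `&` (M @^-1` A') `&` (U @^-1` B')); last first.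
    by apply/seteqP; split => w /=; [move=> [? []]|move=> [[]]].
  rewrite H// integral_mkcond; apply: eq_integral => w _; rewrite /patch.
  case: ifPn => [|/negP]; rewrite inE/= => MA.
    rewrite EFinM (normal_prob_fineK _ _ mB') -[X in normal_prob X s B']add0r normal_prob_shift//.
    by congr (_ * normal_prob 0 s _)%E; apply/seteqP; split => z//= [].
  rewrite (_ : [set _ | _] = set0) ?measure0 ?mule0//.
  by apply/seteqP; split => z//= [].
have mE : measurable [set z : R * R | A z.1 /\ B (z.2 - z.1)].
  apply: (@measurableI _ _ [set z : R * R | A z.1] [set z : R * R | B (z.2 - z.1)]).
    by rewrite -[X in measurable X]setTI; exact: (measurable_fst measurableT).
  rewrite -[X in measurable X]setTI.
  have mB' : measurable_fun setT (fun z : R * R => z.2 - z.1) by exact: measurable_funB.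
  exact: mB'.
have := key _ mE; rewrite m1E m2E//.
rewrite (_ : _ `&` _ = F `&` (M @^-1` A) `&` ((fun w => U w - M w) @^-1` B)); last first.
  by apply/seteqP; split => w /=; [move=> [? []]|move=> [[]]].
move=> ->; rewrite [RHS]integral_mkcond; apply: eq_integral => w _; rewrite /patch.
case: ifPn => [|/negP]; rewrite inE/= => MA.
  rewrite EFinM (normal_prob_fineK _ _ mB); congr (_ * normal_prob 0 s _)%E.
  by apply/seteqP; split => z/=; rewrite addrK// => -[].
rewrite (_ : [set _ | _] = set0) ?measure0 ?mule0//.
by apply/seteqP; split => z//= [].
Qed.

Lemma measurable_preimage d (Omega : measurableType d)
    d' (T : measurableType d') (f : Omega -> T) (A : set T) :
  measurable_fun setT f -> measurable A -> measurable (f @^-1` A).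
Proof. by move=> mf mA; rewrite -[X in measurable X]setTI; exact: mf. Qed.

Lemma measurable_forall d (Omega : measurableType d)
    (I : finType) (Q : pred I) (E : I -> set Omega) :
  (forall i, Q i -> measurable (E i)) ->
  measurable [set w | forall i, Q i -> E i w].
Proof.
move=> mE.
rewrite (_ : [set _ | _] = \bigcap_(i in [set i | Q i]) E i)//.
by apply: fin_bigcap_measurable => // i; apply: mE.
Qed.

Lemma measurable_forallT d (Omega : measurableType d) (I : finType)
    (E : I -> set Omega) :
  (forall i, measurable (E i)) -> measurable [set w | forall i, E i w].
Proof.
move=> mE; rewrite (_ : [set _ | _] = [set w | forall i, xpredT i -> E i w]).
  exact: measurable_forall.
by apply/seteqP; split => w h i //; exact: h.
Qed.

Lemma normal_prob_setT (R : realType) (m s : R) : normal_prob m s setT = 1%E.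
Proof. exact: probability_setT. Qed.

Lemma normal_prob_fine01 (R : realType) (m s : R) (B : set R) : measurable B ->
  0 <= fine (normal_prob m s B) <= 1.
Proof.
move=> mB; rewrite fine_ge0 ?measure_ge0//=.
by rewrite -lee_fin normal_prob_fineK// probability_le1.
Qed.

(** [e j] is the effect behind the observation [X j]. Observations are centred one at a time: those
    in the list [S] already are, so that [Y S] is the current family and [C S] its conditional
    means, zero on [S]. Once all are centred, the conditional probability no longer depends on the
    effects and leaves the integral. *)
Lemma normal_center_family (R : realType) d (Omega : measurableType d)
    (P : probability Omega R) (I J : finType) (e : J -> I)
    (M : I -> Omega -> R) (X : J -> Omega -> R) (s : R) :
  s != 0 -> (forall i, measurable_fun setT (M i)) ->
  (forall j, measurable_fun setT (X j)) ->
  (forall (A : I -> set R) (B : J -> set R),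
    (forall i, measurable (A i)) -> (forall j, measurable (B j)) ->
    P [set w | (forall i, A i (M i w)) /\ (forall j, B j (X j w))] =
    (\int[P]_(w in [set w | forall i, A i (M i w)])
      (\prod_j fine (normal_prob (M (e j) w) s (B j)))%:E)%E) ->
  forall (A : I -> set R) (B : J -> set R),
    (forall i, measurable (A i)) -> (forall j, measurable (B j)) ->
    P [set w | (forall i, A i (M i w)) /\ (forall j, B j (X j w - M (e j) w))] =
    (P [set w | forall i, A i (M i w)] *
     (\prod_j fine (normal_prob 0 s (B j)))%:E)%E.
Proof.
move=> s0 mM mX H.
pose Y (S : seq J) j w := if j \in S then X j w - M (e j) w else X j w.
pose C (S : seq J) j w := if j \in S then 0 else M (e j) w.
have mY S j : measurable_fun setT (Y S j).
  have [jS|jS] := boolP (j \in S).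
    rewrite (_ : Y S j = fun w => X j w - M (e j) w); first exact: measurable_funB.
    by apply/funext => w; rewrite /Y jS.
  by rewrite (_ : Y S j = X j)//; apply/funext => w; rewrite /Y (negbTE jS).
have mC S j : measurable_fun setT (C S j).
  have [jS|jS] := boolP (j \in S).
    by rewrite (_ : C S j = cst 0)//; apply/funext => w; rewrite /C jS.
  by rewrite (_ : C S j = M (e j))//; apply/funext => w; rewrite /C (negbTE jS).
have mN S j B : measurable B -> measurable_fun setT (fun w => fine (normal_prob (C S j w) s B)).
  move=> mB; apply: measurableT_comp => //.
  exact: (measurableT_comp (measurable_normal_prob_mean s0 mB)).
have mMA (Q : pred I) (A : I -> set R) : (forall i, measurable (A i)) ->
    measurable [set w | forall i, Q i -> A i (M i w)].
  move=> mA; apply: (@measurable_forall _ _ _ Q (fun i w => A i (M i w))) => i _.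
  exact: measurable_preimage.
have step (S : seq J) (A : I -> set R) (B : J -> set R) :
    (forall i, measurable (A i)) -> (forall j, measurable (B j)) ->
    P [set w | (forall i, A i (M i w)) /\ (forall j, B j (Y S j w))] =
    (\int[P]_(w in [set w | forall i, A i (M i w)])
      (\prod_j fine (normal_prob (C S j w) s (B j)))%:E)%E.
  elim: S A B => [|j0 S IH] A B mA mB; first exact: H.
  have [j0S|j0S] := boolP (j0 \in S).
    rewrite [Y _](_ : _ = Y S); last first.
      by apply/funext => j; apply/funext => w; rewrite /Y inE; case: eqVneq => // ->; rewrite j0S.
    rewrite [C _](_ : _ = C S); last first.
      by apply/funext => j; apply/funext => w; rewrite /C inE; case: eqVneq => // ->; rewrite j0S.
    exact: IH.
  pose i0 := e j0.
  (* Everything except the effect [i0] and the observation [j0] goes into the event [F] below; [h]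
     is its conditional probability given the effects. *)
  pose h w := (\1_[set w | forall i, i != i0 -> A i (M i w)] w : R) *
     \prod_(j | j != j0) fine (normal_prob (C S j w) s (B j)).
  pose F := [set w | (forall i, i != i0 -> A i (M i w)) /\
                     (forall j, j != j0 -> B j (Y S j w))].
  have mF : measurable F.
    apply: (@measurableI _ _ [set w | forall i, i != i0 -> A i (M i w)]
      [set w | forall j, j != j0 -> B j (Y S j w)]); first exact: mMA.
    apply: (@measurable_forall _ _ _ (fun j => j != j0) (fun j w => B j (Y S j w))) => j _.
    exact: measurable_preimage.
  have mh : measurable_fun setT h.
    apply: measurable_funM; first exact/measurable_indic/mMA.
    under eq_fun do rewrite -big_filter.
    by apply: measurable_prod => j _; exact: (mN S j _ (mB j)).
  have h01 w : 0 <= h w <= 1.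
    have p0 : 0 <= \prod_(j | j != j0) fine (normal_prob (C S j w) s (B j)).
      by apply: prodr_ge0 => j _; case/andP: (normal_prob_fine01 (C S j w) s (mB j)).
    rewrite /h mulr_ge0//= mulr_ile1//.
    by apply: prodr_ile1 => j _; exact: normal_prob_fine01.
  have setE (A1 : I -> set R) (B1 : J -> set R) (Y1 : J -> Omega -> R) :
      (forall i, i != i0 -> A1 i = A i) -> (forall j, j != j0 -> B1 j = B j) ->
      (forall j, j != j0 -> Y1 j = Y S j) ->
      [set w | (forall i, A1 i (M i w)) /\ (forall j, B1 j (Y1 j w))] =
      F `&` (M i0 @^-1` A1 i0) `&` (Y1 j0 @^-1` B1 j0).
    move=> EA EB EY; apply/seteqP; split => w /=.
      move=> [h1 h2]; split; first split; first split => //.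
      - by move=> i i0'; rewrite -EA.
      - by move=> j j0'; rewrite -EB// -EY.
      - exact: h1.
      - exact: h2.
    move=> [[[h1 h2] h3] h4]; split.
      by move=> i; have [->//|i0'] := eqVneq i i0; rewrite EA//; exact: h1.
    by move=> j; have [->//|j0'] := eqVneq j j0; rewrite EB// EY//; exact: h2.
  have intE (A1 : I -> set R) (B1 : J -> set R) (C1 : J -> Omega -> R) :
      (forall i, i != i0 -> A1 i = A i) -> (forall j, j != j0 -> B1 j = B j) ->
      (forall j, j != j0 -> C1 j = C S j) ->
      (\int[P]_(w in [set w | forall i, A1 i (M i w)])
        (\prod_j fine (normal_prob (C1 j w) s (B1 j)))%:E =
      \int[P]_(w in M i0 @^-1` A1 i0)
        (h w * fine (normal_prob (C1 j0 w) s (B1 j0)))%:E)%E.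
    move=> EA EB EC; rewrite integral_mkcond [RHS]integral_mkcond.
    apply: eq_integral => w _; rewrite /patch (bigD1 j0)//=.
    rewrite [X in _ * X](_ : _ =
      \prod_(j | j != j0) fine (normal_prob (C S j w) s (B j))); last first.
      by apply: eq_bigr => j jj0; rewrite (EB _ jj0) (EC _ jj0).
    rewrite /h indicE; case: ifPn => [|/negP]; rewrite inE/= => Aw.
      by rewrite !mem_set// ?mul1r ?(mulrC (fine _))// => i ii0; rewrite -EA.
    case: ifPn => //; rewrite inE/= => Aw0; rewrite memNset ?mul0r//= => Aw1.
    apply: Aw => i; have [->//|i0'] := eqVneq i i0; rewrite EA//; exact: Aw1.
  have HN A0 B0 : measurable A0 -> measurable B0 ->
      P (F `&` (M i0 @^-1` A0) `&` (X j0 @^-1` B0)) =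
      (\int[P]_(w in M i0 @^-1` A0) (h w * fine (normal_prob (M i0 w) s B0))%:E)%E.
    move=> mA0 mB0.
    pose A1 i := if i == i0 then A0 else A i.
    pose B1 j := if j == j0 then B0 else B j.
    have EA i : i != i0 -> A1 i = A i by rewrite /A1 => /negbTE ->.
    have EB j : j != j0 -> B1 j = B j by rewrite /B1 => /negbTE ->.
    have := IH A1 B1; rewrite (setE _ _ _ EA EB)// intE//.
    rewrite (_ : Y S j0 = X j0); last by apply/funext => w; rewrite /Y (negbTE j0S).
    rewrite (_ : C S j0 = M i0); last by apply/funext => w; rewrite /C (negbTE j0S).
    rewrite /A1 /B1 !eqxx; apply; first by move=> i; case: ifP.
    by move=> j; case: ifP.
  rewrite (setE A B) => [|//|//|j jj0]; last first.
    by apply/funext => w; rewrite /Y inE (negbTE jj0).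
  rewrite (intE A B) => [|//|//|j jj0]; last first.
    by apply/funext => w; rewrite /C inE (negbTE jj0).
  rewrite (_ : Y _ j0 = fun w => X j0 w - M i0 w); last first.
    by apply/funext => w; rewrite /Y inE eqxx.
  rewrite (_ : C _ j0 = fun=> 0); last by apply/funext => w; rewrite /C inE eqxx.
  exact: (normal_center s0 mF (mX j0) (mM i0) mh h01 HN).
move=> A B mA mB.
transitivity (P [set w | (forall i, A i (M i w)) /\ (forall j, B j (Y (enum J) j w))]).
  by congr (P _); apply/seteqP; split => w /= [? h]; split => // j; have := h j; rewrite /Y mem_enum.
rewrite step//.
under eq_integral => w _.
  rewrite (_ : \prod_j _ = \prod_j fine (normal_prob 0 s (B j))); last first.
    by apply: eq_bigr => j _; rewrite /C mem_enum.
  over.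
have mA0 : measurable [set w | forall i, A i (M i w)].
  rewrite (_ : [set _ | _] = [set w | forall i, xpredT i -> A i (M i w)]); last first.
    by apply/seteqP; split => w h i //; exact: h.
  exact: mMA.
by rewrite integral_cst// muleC.
Qed.

(** The product formula is extended from rectangles to arbitrary measurable plane sets, one
    coordinate at a time, and then applied to the sets z.1 + z.2 in B, whose product measure is a
    convolution. The event [F], of probability weight [c], carries along the effects and the noises
    not yet summed. *)
Lemma normal_merge (R : realType) d (Omega : measurableType d)
    (P : probability Omega R) (I : finType) (F : set Omega)
    (U V : I -> Omega -> R) (c s t : R) :
  0 < s -> 0 < t -> 0 <= c -> measurable F ->
  (forall i, measurable_fun setT (U i)) -> (forall i, measurable_fun setT (V i)) ->
  (forall A B : I -> set R, (forall i, measurable (A i)) -> (forall i, measurable (B i)) ->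
    P (F `&` [set w | forall i, A i (U i w) /\ B i (V i w)]) =
    (c * \prod_i (fine (normal_prob 0 s (A i)) * fine (normal_prob 0 t (B i))))%:E) ->
  forall B : I -> set R, (forall i, measurable (B i)) ->
    P (F `&` [set w | forall i, B i (U i w + V i w)]) =
    (c * \prod_i fine (normal_prob 0 (Num.sqrt (s ^+ 2 + t ^+ 2)) (B i)))%:E.
Proof.
move=> s0 t0 c0 mF mU mV H.
pose N2 : set (R * R) -> \bar R := (normal_prob (0 : R) s \x normal_prob (0 : R) t)%E.
have N2le1 (E : set (R * R)) : measurable E -> (N2 E <= 1)%E.
  move=> mE; apply: (@le_trans _ _ (N2 setT)); first by apply: le_measure; rewrite ?inE.
  rewrite (_ : N2 setT = (normal_prob (0%R : R) s setT * normal_prob (0%R : R) t setT)%E).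
    by rewrite (normal_prob_setT 0 s) (normal_prob_setT 0 t) mule1.
  by rewrite /N2 -setXTT product_measure1E.
have N2fin (E : set (R * R)) : measurable E -> (fine (N2 E))%:E = N2 E.
  by move=> mE; rewrite fineK// ge0_fin_numE// (le_lt_trans (N2le1 _ mE))// ltry.
have N2ge0 E : 0 <= fine (N2 E) by rewrite fine_ge0// measure_ge0.
have mUV i : measurable_fun setT (fun w => (U i w, V i w)) by exact: measurable_fun_pair.
have step (S : seq I) (E : I -> set (R * R)) : (forall i, measurable (E i)) ->
    (forall i, i \notin S -> exists A B, [/\ measurable A, measurable B & E i = A `*` B]) ->
    P (F `&` [set w | forall i, E i (U i w, V i w)]) = (c * \prod_i fine (N2 (E i)))%:E.
  elim: S E => [|i0 S IH] E mE Erect.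
    have /choice [AB hAB] i : exists AB : set R * set R,
        [/\ measurable AB.1, measurable AB.2 & E i = AB.1 `*` AB.2].
      by have [//|A [B [mA mB EAB]]] := Erect i; exists (A, B).
    have := H (fun i => (AB i).1) (fun i => (AB i).2) (fun i => let: And3 a _ _ := hAB i in a)
      (fun i => let: And3 _ b _ := hAB i in b).
    rewrite (_ : [set w | forall i, _] = [set w | forall i, E i (U i w, V i w)]); last first.
      by apply/seteqP; split => w /= h i; have := h i; have [_ _ ->] := hAB i.
    move=> ->; congr (c * _)%:E; apply: eq_bigr => i _; have [mA mB ->] := hAB i.
    rewrite /N2 product_measure1E// fineM//; exact: fin_num_measure.
  pose F' := F `&` [set w | forall i, i != i0 -> E i (U i w, V i w)].
  have mF' : measurable F'.
    apply: measurableI => //.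
    apply: (@measurable_forall _ _ _ (fun i => i != i0) (fun i w => E i (U i w, V i w))) => i _.
    exact: (measurable_preimage (mUV i) (mE i)).
  have c'0 : 0 <= c * \prod_(i | i != i0) fine (N2 (E i)).
    by rewrite mulr_ge0// prodr_ge0.
  pose c' := NngNum c'0.
  pose UV : {mfun Omega >-> (R * R)%type} :=
    HB.pack (fun w => (U i0 w, V i0 w)) (isMeasurableFun.Build _ _ _ _ _ (mUV i0)).
  pose m1 := pushforward (mrestr P mF') UV.
  have mid : measurable_fun setT
      ((fun z => z) : measurableTypeR R * measurableTypeR R -> R * R).
    exact: measurable_id.
  (* The identity map, along which the product measure is viewed as a measure on the same type as
     [m1]. *)
  pose id2 : {mfun (measurableTypeR R * measurableTypeR R)%type >-> (R * R)%type} :=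
    HB.pack ((fun z => z) : measurableTypeR R * measurableTypeR R -> R * R)
      (isMeasurableFun.Build _ _ _ _ _ mid).
  pose m2 := pushforward (mscale c' (normal_prob (0 : R) s \x normal_prob (0 : R) t)%E) id2.
  have m1E G : m1 G = P (F' `&` [set w | G (U i0 w, V i0 w)]).
    by rewrite /m1 /pushforward /mrestr setIC.
  have m2E G : measurable G -> m2 G = (c * (fine (N2 G) * \prod_(i | i != i0) fine (N2 (E i))))%:E.
    move=> mG; transitivity ((c * \prod_(i | i != i0) fine (N2 (E i)))%:E * N2 G)%E => //.
    by rewrite -[X in (_ * X)%E](N2fin _ mG) -EFinM -mulrA (mulrC (\prod_(_ | _) _)).
  have setE E' : (forall i, i != i0 -> E' i = E i) ->
      F `&` [set w | forall i, E' i (U i w, V i w)] =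
      F' `&` [set w | E' i0 (U i0 w, V i0 w)].
    move=> EE; apply/seteqP; split => w /=.
      by move=> [? h]; split => //; split => // i ii0; rewrite -EE.
    move=> [[? h] h0]; split => // i; have [->//|ii0] := eqVneq i i0.
    by rewrite EE//; exact: h.
  transitivity (m1 (E i0)); first by rewrite m1E (setE E).
  transitivity (m2 (E i0)); last by rewrite (m2E _ (mE i0)) [in RHS](bigD1 i0)//=.
  apply: rectangle_measure_unique => //.
    change (m1 setT < +oo)%E; rewrite m1E (le_lt_trans (probability_le1 _ _)) ?ltry//.
    apply: measurableI => //.
    exact: (measurable_preimage (mUV i0) measurableT).
  move=> A B mA mB; change (m1 (A `*` B) = m2 (A `*` B)).
  have mAB : measurable (A `*` B) by exact: measurableX.
  rewrite m1E m2E//.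
  pose E' i := if i == i0 then A `*` B else E i.
  have := IH E'; rewrite (setE E'); last by move=> i /negbTE h; rewrite /E' h.
  have E0 : E' i0 = A `*` B by rewrite /E' eqxx.
  have Ei i : i != i0 -> E' i = E i by rewrite /E' => /negbTE ->.
  rewrite (bigD1 i0) // E0 => ->.
  - congr (c * (_ * _))%:E; apply: eq_bigr => i ii0; exact: (congr1 (fun G => fine (N2 G)) (Ei i ii0)).
  - by move=> i; rewrite /E'; case: ifP.
  - move=> i iS; rewrite /E'; case: eqVneq => [_|ii0]; first by exists A, B.
    by apply: Erect; rewrite inE negb_or ii0.
move=> B mB.
have := step (enum I) (fun i => [set z : R * R | B i (z.1 + z.2)])
  (fun i => measurable_add_preimage (mB i)).
move=> ->; last by move=> i; rewrite mem_enum.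
congr (c * _)%:E; apply: eq_bigr => i _; rewrite /N2 normal_prob_conv//.
Qed.

Lemma prod_normal_fine (R : realType) (I : Type) (r : seq I) (m : I -> R) (s : R)
    (B : I -> set R) : (forall i, measurable (B i)) ->
  (\prod_(i <- r) normal_prob (m i) s (B i) =
   (\prod_(i <- r) fine (normal_prob (m i) s (B i)))%:E)%E.
Proof.
move=> mB; elim: r => [|i r IH]; first by rewrite !big_nil.
by rewrite !big_cons IH EFinM normal_prob_fineK.
Qed.

Definition noise (R : realType) (d : measure_display) (Omega : measurableType d)
    (P : probability Omega R) (m n : nat) (sigma : R)
    (mu : 'I_m -> {RV P >-> R}) (X : 'I_n -> 'I_m -> {RV P >-> R})
    (i : 'I_m) (w : Omega) : R :=
  Num.sqrt n%:R * (sample_mean X w i - mu i w) / sigma.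

Section two_groups.
Context (R : realType) (d : measure_display) (Omega : measurableType d)
  (P : probability Omega R) (m n : nat) (sigma p : R) (nu : probability R R)
  (mu : 'I_m -> {RV P >-> R}) (X : 'I_n -> 'I_m -> {RV P >-> R}).
Hypotheses (sigma0 : 0 < sigma) (n0 : (0 < n)%N)
  (model : two_groups_model sigma p nu mu X).

Let eps (j : 'I_n) (i : 'I_m) w := X j i w - mu i w.

Let centered (A : 'I_m -> set R) (D : 'I_n -> 'I_m -> set R) :
  (forall i, measurable (A i)) -> (forall j i, measurable (D j i)) ->
  P [set w | (forall i, A i (mu i w)) /\ (forall j i, D j i (eps j i w))] =
  (P [set w | forall i, A i (mu i w)] *
   (\prod_(j < n) \prod_(i < m) fine (normal_prob 0 sigma (D j i)))%:E)%E.
Proof.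
move=> mA mD; have [_ _ Hmodel] := model.
pose J : finType := ('I_n * 'I_m)%type.
have s0 : sigma != 0 by rewrite gt_eqF.
have H (A' : 'I_m -> set R) (B : J -> set R) :
    (forall i, measurable (A' i)) -> (forall j, measurable (B j)) ->
    P [set w | (forall i, A' i (mu i w)) /\ (forall j : J, B j (X j.1 j.2 w))] =
    (\int[P]_(w in [set w | forall i, A' i (mu i w)])
      (\prod_(j : J) fine (normal_prob (mu j.2 w) sigma (B j)))%:E)%E.
  move=> mA' mB; have := Hmodel A' (fun j i => B (j, i)) mA' (fun j i => mB (j, i)).
  rewrite (_ : [set w | _] = [set w | (forall i, A' i (mu i w)) /\ (forall j : J, B j (X j.1 j.2 w))]).
    move=> ->; apply: eq_integral => w _.
    rewrite exchange_big/= (pair_bigA _ (fun j i => normal_prob (mu i w) sigma (B (j, i))))/=.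
    by rewrite prod_normal_fine//; congr EFin; apply: eq_bigr => -[].
  apply/seteqP; split => w /= [h1 h2]; split; try exact: h1.
    by move=> [j i]; exact: h2.
  by move=> j i; exact: (h2 (j, i)).
have := @normal_center_family _ _ _ P 'I_m J snd (fun i => mu i) (fun j => X j.1 j.2) sigma
  s0 (fun i => measurable_funPT (mu i)) (fun j => measurable_funPT (X j.1 j.2)) H A
  (fun j => D j.1 j.2) mA (fun j => mD j.1 j.2).
rewrite (pair_bigA _ (fun j i => fine (normal_prob 0 sigma (D j i))))/= => <-.
congr (P _); apply/seteqP; split => w /= [h1 h2]; split; try exact: h1.
  by move=> [j i]; exact: h2.
by move=> j i; exact: (h2 (j, i)).
Qed.

Let S (k : nat) (i : 'I_m) w := \sum_(j < n | (j < k)%N) eps j i w.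

Let meps j i : measurable_fun setT (eps j i).
Proof. exact: measurable_funB. Qed.

(** The first [k] noises of each hypothesis are already added up, the others are still separate. The
    induction starts at k = 1, because [normal_merge] wants positive standard deviations and the
    empty sum is degenerate. *)
Let partial_sums (k : nat) : (0 < k <= n)%N ->
  forall (A : 'I_m -> set R) (D : 'I_n -> 'I_m -> set R) (B : 'I_m -> set R),
  (forall i, measurable (A i)) -> (forall j i, measurable (D j i)) ->
  (forall i, measurable (B i)) ->
  P ([set w | (forall i, A i (mu i w)) /\
              (forall (j : 'I_n) i, (k <= j)%N -> D j i (eps j i w))] `&`
     [set w | forall i, B i (S k i w)]) =
  (fine (P [set w | forall i, A i (mu i w)]) *
   (\prod_(j < n | (k <= j)%N) \prod_(i < m) fine (normal_prob 0 sigma (D j i))) *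
   \prod_(i < m) fine (normal_prob 0 (sigma * Num.sqrt k%:R) (B i)))%:E.
Proof.
elim: k => // k IH /andP[_ kn] A D B mA mD mB.
pose ko : 'I_n := Ordinal kn.
have mA0 : measurable [set w | forall i, A i (mu i w)].
  apply: (@measurable_forallT _ _ _ (fun i w => A i (mu i w))) => i.
  exact: (measurable_preimage (measurable_funPT (mu i)) (mA i)).
have prodE (G : 'I_n -> 'I_m -> R) :
    \prod_(j < n | (k <= j)%N) \prod_(i < m) G j i =
    \prod_(i < m) G ko i * \prod_(j < n | (k < j)%N) \prod_(i < m) G j i.
  rewrite (bigD1 ko)//=; congr (_ * _); apply: eq_bigl => j.
  by rewrite ltn_neqAle eq_sym andbC.
have SE i w : S k.+1 i w = S k i w + eps ko i w.
  rewrite /S (bigD1 ko)/= ?ltnSn// addrC; congr (_ + _); apply: eq_bigl => j.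
  by rewrite ltnS ltn_neqAle andbC.
(* The constraint on the noise of index [k], the next summand, is set to [B1]; the later ones are
   kept. *)
pose D' (B1 : 'I_m -> set R) j := if j == ko then B1 else D j.
have mD' B1 : (forall i, measurable (B1 i)) -> forall j i, measurable (D' B1 j i).
  by move=> mB1 j i; rewrite /D'; case: ifP.
have D'E B1 (j : 'I_n) : (k < j)%N -> D' B1 j = D j.
  by rewrite /D'; case: eqVneq => // ->; rewrite ltnn.
have D'ko B1 : D' B1 ko = B1 by rewrite /D' eqxx.
have prodD' B1 : \prod_(j < n | (k < j)%N) \prod_(i < m) fine (normal_prob 0 sigma (D' B1 j i)) =
   \prod_(j < n | (k < j)%N) \prod_(i < m) fine (normal_prob 0 sigma (D j i)).
  by apply: eq_bigr => j kj; rewrite D'E.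
have [k0|k0] := posnP k.
  have S0 i w : S k i w = 0 by rewrite /S k0 big_pred0.
  have := centered mA (mD' _ mB).
  rewrite (_ : \prod_(j < n) \prod_(i < m) _ =
     \prod_(j < n | (k <= j)%N) \prod_(i < m) fine (normal_prob 0 sigma (D' B j i))); last first.
    by apply: eq_bigl => j; rewrite k0.
  rewrite prodE prodD' D'ko k0 sqrtr1 mulr1.
  rewrite -[X in (X * _)%E]fineK ?fin_num_measure//.
  rewrite -EFinM -mulrA (mulrC (\prod_(j < n | _) _)) => <-.
  congr (P _); apply/seteqP; split => w /=.
    move=> [[h1 h2] h3]; split => // j i; have [->|jko] := eqVneq j ko.
      by rewrite D'ko; have := h3 i; rewrite -k0 SE S0 add0r.
    rewrite D'E ?k0; first by apply: h2; rewrite lt0n; apply: contra jko => /eqP j0; apply/eqP/val_inj; rewrite /= k0.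
    by rewrite lt0n; apply: contra jko => /eqP j0; apply/eqP/val_inj; rewrite /= k0.
  move=> [h1 h2]; split; first split => // j i j0.
    by have := h2 j i; rewrite D'E ?k0.
  by move=> i; rewrite -k0 SE S0 add0r; have := h2 ko i; rewrite D'ko.
pose F := [set w | (forall i, A i (mu i w)) /\
   (forall (j : 'I_n) i, (k < j)%N -> D j i (eps j i w))].
have mF : measurable F.
  apply: (@measurableI _ _ [set w | forall i, A i (mu i w)]
    [set w | forall (j : 'I_n) i, (k < j)%N -> D j i (eps j i w)]) => //.
  apply: (@measurable_forallT _ _ _
    (fun (j : 'I_n) w => forall i, (k < j)%N -> D j i (eps j i w))) => j.
  apply: (@measurable_forall _ _ _ (fun=> k < j)%N (fun i w => D j i (eps j i w))) => i _.
  exact: (measurable_preimage (meps j i) (mD j i)).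
have sk0 : 0 < sigma * Num.sqrt k%:R by rewrite mulr_gt0 ?sqrtr_gt0 ?ltr0n.
pose c := fine (P [set w | forall i, A i (mu i w)]) *
  \prod_(j < n | (k < j)%N) \prod_(i < m) fine (normal_prob 0 sigma (D j i)).
have c0 : 0 <= c.
  rewrite mulr_ge0 ?fine_ge0//; apply: prodr_ge0 => j _; apply: prodr_ge0 => i _.
  by rewrite fine_ge0.
have mS i : measurable_fun setT (S k i).
  rewrite /S; under eq_fun do rewrite -big_filter.
  by apply: measurable_sum => j; exact: meps.
have := @normal_merge R d Omega P 'I_m F (S k) (eps ko) c _ _ sk0 sigma0 c0 mF mS (meps ko).
rewrite (_ : Num.sqrt (_ + _) = sigma * Num.sqrt k.+1%:R); last first.
  rewrite exprMn sqr_sqrtr ?ler0n// -[X in _ + X]mulr1 -mulrDr natr1.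
  by rewrite sqrtrM ?sqr_ge0// sqrtr_sqr gtr0_norm.
move=> /(_ _ B mB) <-.
  congr (P _); apply/seteqP; split => w /= [h1 h2]; split => // i.
    by rewrite -SE.
  by rewrite SE.
move=> B1 B2 mB1 mB2.
have := IH _ A (D' B2) B1 mA (mD' _ mB2) mB1.
rewrite k0 (ltnW kn) => /(_ isT); rewrite prodE prodD' D'ko.
rewrite (_ : _ `&` _ = F `&` [set w | forall i, B1 i (S k i w) /\ B2 i (eps ko i w)]); last first.
  apply/seteqP; split => w /=.
    move=> [[h1 h2] h3]; split.
      by split => // j i kj; have := h2 j i (ltnW kj); rewrite D'E.
    by move=> i; split; [exact: h3|have := h2 ko i (leqnn k); rewrite D'ko].
  move=> [[h1 h2] h3]; split; last by move=> i; have [] := h3 i.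
  split => // j i; rewrite leq_eqVlt => /orP[/eqP kj|kj].
    have -> : j = ko by apply/val_inj.
    by rewrite D'ko; have [] := h3 i.
  by rewrite D'E//; exact: h2.
move=> ->; rewrite /c big_split/=; congr EFin.
have mulE (x y z t : R) : x * (y * z) * t = x * z * (t * y) by ring.
exact: mulE.
Qed.

(** Joint independence of all effects and noises, in the form of a product over rectangles on which
    the later probabilities rest. The dilation by [c] normalizes the sum of [n] noises, whose
    standard deviation is sigma sqrt n. *)
Lemma noise_rectangles (A B : 'I_m -> set R) :
  (forall i, measurable (A i)) -> (forall i, measurable (B i)) ->
  P [set w | forall i, A i (mu i w) /\ B i (noise sigma mu X i w)] =
  (\prod_(i < m) (fine (effect_law p nu (A i)) * fine (normal_prob 0 1 (B i))))%:E.
Proof.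
move=> mA mB.
have n0' : (0 : R) < n%:R by rewrite ltr0n.
have sn0 : 0 < sigma * Num.sqrt n%:R by rewrite mulr_gt0 ?sqrtr_gt0.
pose c := (sigma * Num.sqrt n%:R)^-1.
have c0 : 0 < c by rewrite invr_gt0.
pose B' i : set R := (fun x => c * x) @^-1` B i.
have mB' i : measurable (B' i).
  exact: (measurable_preimage (mulrl_measurable c)).
have := @partial_sums n _ A (fun _ _ => setT) B' mA (fun _ _ => measurableT) mB'.
rewrite n0 leqnn => /(_ isT).
rewrite (_ : _ `&` _ = [set w | forall i, A i (mu i w) /\ B i (noise sigma mu X i w)]); last first.
  have E i w : c * S n i w = noise sigma mu X i w.
    rewrite /S /eps /noise /sample_mean.
    under eq_bigl do rewrite ltn_ord.
    rewrite sumrB sumr_const card_ord -(mulr_natl (mu i w)) /c.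
    have sn2 : Num.sqrt n%:R ^+ 2 = n%:R :> R by rewrite sqr_sqrtr ?ler0n.
    have q0 : Num.sqrt n%:R != 0 :> R by rewrite gt_eqF// sqrtr_gt0.
    move: (Num.sqrt n%:R) sn2 q0 => q <- q0; field.
    by rewrite q0 gt_eqF.
  apply/seteqP; split => w /=; rewrite /B'/=.
    by move=> [[h1 _] h2] i; split => //; rewrite -E.
  by move=> h; split; [split => // i; have [] := h i|move=> i; rewrite E; have [] := h i].
move=> ->; rewrite big_pred0; last by move=> j; rewrite leqNgt ltn_ord.
rewrite mulr1 big_split/=; congr (_ * _)%:E.
  have [Hlaw Hind _] := model.
  rewrite Hind// (_ : (\prod_(i < m) _)%E = (\prod_(i < m) fine (effect_law p nu (A i)))%:E)//.
  elim/big_rec2: _ => //= i y1 y2 _ ->; rewrite EFinM; congr (_ * _)%E.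
  have := Hlaw i (A i) (mA i); rewrite /distribution /pushforward => <-.
  by rewrite fineK// fin_num_measure//; exact: (measurable_preimage (measurable_funPT (mu i)) (mA i)).
apply: eq_bigr => i _.
by rewrite -[in RHS](mulVf (lt0r_neq0 sn0)) -/c (normal_prob_dilate (mB i) c0 sn0).
Qed.

End two_groups.

(** * Step-up and step-down rules *)

Lemma sorted_nth_le (R : realType) (s : seq R) (t : R) (j : nat) :
  sorted <=%R s -> (j < size s)%N ->
  (nth 0 s j <= t) = (j < count (fun x : R => (x <= t)%R) s)%N.
Proof.
elim: s j => // x s IH j /= xs js.
have ss : sorted <=%R s by exact: path_sorted xs.
have [xt|tx] := leP x t.
  case: j js => [|j] js //=.
  by rewrite IH.
have xall : all (>= x) s by apply: order_path_min => //; exact: le_trans.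
have -> : count (fun y : R => (y <= t)%R) s = 0%N.
  apply/eqP; rewrite -leqn0 leqNgt -has_count -all_predC.
  by apply: sub_all xall => y /= xy; rewrite -ltNge (lt_le_trans tx).
case: j js => [|j] js /=; first by rewrite leNgt tx.
apply/negbTE; rewrite -ltNge (lt_le_trans tx)//.
by apply: (allP xall); apply: mem_nth.
Qed.

Section multiple_testing.
Context (R : realType) (alpha : R) (m : nat) (q : 'I_m -> R).
Hypothesis alpha0 : 0 < alpha.

Definition card_below (t : R) : nat := #|[set i : 'I_m | q i <= t]%SET|.

(** Translates order statistics into counts, the form in which the rules are analysed. *)
Lemma ordered_le k t : (0 < k <= m)%N ->
  (ordered q k <= t) = (k <= card_below t)%N.
Proof.
move=> /andP[k0 km]; rewrite /ordered sorted_nth_le.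
- rewrite prednK// (_ : count _ _ = card_below t)//.
  rewrite (permP (permEl (perm_sort _ _))) count_map /card_below cardsE.
  by rewrite cardE -size_filter enumT /enum_mem.
- by apply: sort_sorted; exact: le_total.
- by rewrite size_sort size_map size_enum_ord prednK.
Qed.

Lemma card_below_le t1 t2 : t1 <= t2 -> (card_below t1 <= card_below t2)%N.
Proof.
move=> t12; apply/subset_leq_card/fintype.subsetP => i; rewrite !inE => /le_trans; exact.
Qed.

Lemma card_below_lt i t : t < q i -> (card_below t < card_below (q i))%N.
Proof.
move=> tqi; apply/proper_card/properP; split.
  by apply/fintype.subsetP => j; rewrite !inE => /le_trans; apply; exact: ltW.
by exists i; rewrite !inE ?lexx// -ltNge.
Qed.

Lemma card_below_max t : (card_below t <= m)%N.
Proof. by rewrite -[X in (_ <= X)%N]card_ord max_card. Qed.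

Lemma card_below_all t i : (m <= card_below t)%N -> q i <= t.
Proof.
move=> mt; rewrite leNgt; apply/negP => /card_below_lt.
by rewrite ltnNge (leq_trans (card_below_max _)).
Qed.

Let level (k : nat) : R := k%:R * alpha / m%:R.

Let level_le k l : (k <= l)%N -> level k <= level l.
Proof.
move=> kl; rewrite /level ler_wpM2r ?invr_ge0 ?ler0n//.
by rewrite ler_wpM2r ?ler_nat// ltW.
Qed.

Lemma bh_indexP : bh_index alpha q = 0%N \/
  (0 < bh_index alpha q <= m)%N /\ ordered q (bh_index alpha q) <= level (bh_index alpha q).
Proof.
rewrite /bh_index big_nat_cond.
elim/big_ind: _ => [|x y|k]; first by left.
- move=> hx hy; rewrite /maxn; case: ifP => //.
- by move=> /andP[/andP[k1 km] h]; right; rewrite k1 -ltnS.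
Qed.

Lemma bh_index_ge k : (0 < k <= m)%N -> ordered q k <= level k -> (k <= bh_index alpha q)%N.
Proof.
move=> /andP[k0 km] h; rewrite /bh_index.
by apply: (@leq_bigmax_seq _ (index_iota 1 m.+1) _ id) => //; rewrite mem_index_iota k0.
Qed.

(** The k_F-th p-value is at most level k_F, and at least k_F hypotheses are rejected; ties can only
    add more. *)
Lemma bh_self_consistent i : i \in bh_rejections alpha q ->
  q i <= #|bh_rejections alpha q|%:R * alpha / m%:R.
Proof.
rewrite inE => /andP[k0 qi].
have [h|[km h]] := bh_indexP; first by rewrite h in k0.
rewrite (le_trans qi)// (le_trans h)//; apply: level_le.
have := lexx (ordered q (bh_index alpha q)); rewrite ordered_le// => /leq_trans; apply.
by apply/subset_leq_card/fintype.subsetP => j; rewrite !inE k0.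
Qed.

Lemma bh_accepted i : i \notin bh_rejections alpha q ->
  exists k, [/\ (0 < k <= m)%N, k%:R * alpha / m%:R < q i
    & (card_below (k%:R * alpha / m%:R) < k)%N].
Proof.
rewrite inE negb_and -ltNge -leqNgt leqn0 => hi.
have m0 : (0 < m)%N by exact: leq_ltn_trans (ltn_ord i).
set k := bh_index alpha q in hi *.
have km : (k < m)%N.
  have [k0|[/andP[k0 km] _]] := bh_indexP; first by rewrite /k k0.
  rewrite ltn_neqAle km andbT; apply/negP => /eqP kE.
  move: hi; rewrite gtn_eqF//= ltNge card_below_all//.
  by have := lexx (ordered q k); rewrite ordered_le ?k0// kE.
have hk : (card_below (level k.+1) < k.+1)%N.
  rewrite ltnNge -ordered_le//; apply/negP => /bh_index_ge => /(_ km).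
  by rewrite ltnn.
(* The witness is k_F + 1. Maximality of k_F leaves fewer than k_F + 1 p-values below its level;
   were [q i] below that level too, [q i] together with the k_F p-values smaller than it would make
   k_F + 1. *)
exists k.+1; split => //.
rewrite ltNge; apply/negP => qi.
move: hk; rewrite ltnNge => /negP; apply.
apply: leq_trans (card_below_le qi).
case/orP: hi => [/eqP ->|].
  by rewrite card_gt0; apply/set0Pn; exists i; rewrite inE.
have [-> _|k0] := posnP k.
  by rewrite card_gt0; apply/set0Pn; exists i; rewrite inE.
move=> /card_below_lt; apply: leq_ltn_trans.
by have := lexx (ordered q k); rewrite ordered_le// k0 ltnW.
Qed.

Lemma sd_indexP : (forall k, (0 < k < sd_index alpha q)%N -> (k <= m)%N -> ordered q k <= level k) /\
  ((sd_index alpha q <= m)%N -> level (sd_index alpha q) < ordered q (sd_index alpha q)).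
Proof.
rewrite /sd_index; set a := (fun k : nat => _); split.
  move=> k /andP[k0]; rewrite ltnS => kg km; rewrite leNgt.
  have := @before_find _ 0%N a (iota 1 m) k.-1.
  rewrite prednK// => /(_ kg); rewrite nth_iota ?prednK// add1n prednK// /a /level.
  by move=> ->.
move=> h; have := @nth_find _ 0%N a (iota 1 m).
by rewrite has_find size_iota => /(_ h); rewrite nth_iota.
Qed.

(** With g = k_G, the g - 1 smallest p-values are at most level (g - 1), hence below the g-th, so at
    least g - 1 hypotheses are rejected. A rejected [q i] above level (g - 1) would exceed g - 1
    others and could not be smaller than the g-th p-value. *)
Lemma sd_self_consistent i : i \in sd_rejections alpha q ->
  q i <= #|sd_rejections alpha q|%:R * alpha / m%:R.
Proof.
have [lt_g ge_g] := sd_indexP; set g := sd_index alpha q in lt_g ge_g *.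
have m0 : (0 < m)%N by exact: leq_ltn_trans (ltn_ord i).
have [mg|gm] := ltnP m g.
  have -> : sd_rejections alpha q = [set: 'I_m]%SET by apply/setP => j; rewrite !inE mg.
  move=> _; rewrite cardsT card_ord; apply: card_below_all.
  by rewrite -ordered_le ?m0 ?leqnn// lt_g// m0.
have iE j : (j \in sd_rejections alpha q) = (q j < ordered q g).
  by rewrite inE -/g ltnNge gm.
have g0 : (0 < g)%N by [].
have cnt_g : (g.-1 <= card_below (level g.-1))%N.
  have [//|g1] := posnP g.-1; first by move=> ->.
  rewrite -ordered_le; last by rewrite g1 (leq_trans (leq_pred _)).
  apply: lt_g; first by rewrite g1 ltn_predL.
  exact: leq_trans (leq_pred _) gm.
rewrite iE => qi.
apply: (@le_trans _ _ (level g.-1)); last first.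
  apply: level_le; apply: leq_trans cnt_g _.
  apply/subset_leq_card/fintype.subsetP => j; rewrite iE inE => /le_lt_trans; apply.
  by apply: le_lt_trans (ge_g gm); apply: level_le; exact: leq_pred.
rewrite leNgt; apply/negP => /card_below_lt h.
move: qi; rewrite ltNge ordered_le ?g0// => /negP; apply.
by rewrite -(prednK g0) (leq_ltn_trans cnt_g).
Qed.

(** The witness is k_G itself, the first index at which the step-down condition fails. *)
Lemma sd_accepted i : i \notin sd_rejections alpha q ->
  exists k, [/\ (0 < k <= m)%N, k%:R * alpha / m%:R < q i
    & (card_below (k%:R * alpha / m%:R) < k)%N].
Proof.
have [_ ge_g] := sd_indexP; set g := sd_index alpha q in ge_g *.
rewrite inE -/g negb_or -leqNgt -leNgt => /andP[gm qi].
exists g; split => //; first exact: lt_le_trans (ge_g gm) qi.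
by rewrite ltnNge -ordered_le// -ltNge; exact: ge_g.
Qed.

End multiple_testing.

(** * Integrals of counts *)

(* The integral of a nonnegative function is a supremum over the simple
   functions below it, so monotonicity needs no measurability. *)
Lemma ge0_le_integral_sup d (T : measurableType d) (R : realType)
    (P : {measure set T -> \bar R}) (f g : T -> \bar R) :
  (forall x, 0 <= f x)%E -> (forall x, f x <= g x)%E ->
  (\int[P]_x f x <= \int[P]_x g x)%E.
Proof.
move=> f0 fg; have g0 x : (0 <= g x)%E by exact: le_trans (fg x).
rewrite !ge0_integralTE//; apply: ereal_sup_le => _ [h hf <-].
by exists h => // x; exact: le_trans (hf x) (fg x).
Qed.

(** [M] may fail to be measurable, so the integral of M + g cannot be split. The measurable function
    max (0, h - g) lies below [M] and takes its place. *)
Lemma ge0_le_integralD d (T : measurableType d) (R : realType)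
    (P : {measure set T -> \bar R}) (M h g : T -> R) :
  (forall x, 0 <= M x) -> (forall x, 0 <= g x) -> (forall x, 0 <= h x) ->
  measurable_fun setT h -> measurable_fun setT g ->
  (forall x, h x <= M x + g x) ->
  (\int[P]_x (h x)%:E <= \int[P]_x (M x)%:E + \int[P]_x (g x)%:E)%E.
Proof.
move=> M0 g0 h0 mh mg hMg.
pose f x := Num.max 0 (h x - g x).
have mf : measurable_fun setT f by apply: measurable_maxr => //; exact: measurable_funB.
have f0 x : 0 <= f x by rewrite /f le_max lexx.
apply: (@le_trans _ _ (\int[P]_x (f x)%:E + \int[P]_x (g x)%:E)%E); last first.
  apply: leeD => //; apply: ge0_le_integral_sup => x; rewrite lee_fin//.
  by rewrite /f ge_max M0 lerBlDr hMg.
rewrite -ge0_integralD//.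
- apply: ge0_le_integral_sup => x; rewrite -?EFinD lee_fin// -lerBlDr /f le_max lexx orbT//.
- by move=> x _; rewrite lee_fin.
- exact/measurable_EFinP.
- by move=> x _; rewrite lee_fin.
- exact/measurable_EFinP.
Qed.

Lemma integral_sum_indic d (T : measurableType d) (R : realType)
    (P : probability T R) (I : finType) (c : I -> R) (F : I -> set T) :
  (forall i, measurable (F i)) ->
  (\int[P]_x (\sum_i c i * \1_(F i) x)%:E = (\sum_i c i * fine (P (F i)))%:E)%E.
Proof.
move=> mF.
under eq_integral do rewrite -sumEFin.
rewrite integral_sum//=.
  rewrite -sumEFin; apply: eq_bigr => i _.
  under eq_integral do rewrite EFinM.
  rewrite integralZl//; last exact: integrable_indic.
  by rewrite integral_indic// setIT EFinM fineK// fin_num_measure.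
move=> i; under eq_fun do rewrite EFinM.
by apply: integrableZl => //; exact: integrable_indic.
Qed.

(** Expanding the product over all subsets of [I] leaves indicators of intersections, whose
    probabilities are the hypothesis; the expansion is then folded back with [e i] in place of the
    indicators. *)
Lemma integral_prod_indep d (T : measurableType d) (R : realType)
    (P : probability T R) (I : finType) (a b e : I -> R) (E : I -> set T) :
  (forall i, measurable (E i)) ->
  (forall Q : pred I, P [set w | forall i, Q i -> E i w] = (\prod_(i | Q i) e i)%:E) ->
  (\int[P]_w (\prod_i (a i + b i * \1_(E i) w))%:E = (\prod_i (a i + b i * e i))%:E)%E.
Proof.
move=> mE indep.
pose c (f : {ffun I -> bool}) := \prod_i (if f i then b i else a i).
have expand (u : I -> R) : \prod_i (a i + b i * u i) =
    \sum_(f : {ffun I -> bool}) c f * \prod_(i | f i) u i.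
  transitivity (\prod_i \sum_(k : bool) (if k then b i * u i else a i)).
    by apply: eq_bigr => i _; rewrite big_bool/= addrC.
  rewrite bigA_distr_bigA; apply: eq_bigr => f _.
  rewrite /c [X in _ * X]big_mkcond -big_split/=; apply: eq_bigr => i _.
  by case: (f i); rewrite ?mulr1.
pose F (f : {ffun I -> bool}) := [set w | forall i, f i -> E i w].
have mF f : measurable (F f) by apply: measurable_forall => i _.
transitivity (\int[P]_w (\sum_(f : {ffun I -> bool}) c f * \1_(F f) w)%:E)%E.
  apply: eq_integral => w _; congr EFin; rewrite expand; apply: eq_bigr => f _.
  congr (_ * _); rewrite [RHS]indicE.
  have [wF|/negP] := boolP (w \in F f).
    rewrite big1// => i fi; rewrite indicE mem_set//.
    by move: wF; rewrite inE; exact.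
  rewrite inE => /existsNP[i /not_implyP[fi nE]].
  by rewrite (bigD1 i)//= indicE memNset// mul0r.
rewrite integral_sum_indic// expand; congr EFin; apply: eq_bigr => f _.
by rewrite indep.
Qed.

Section integral_bounds.
Context d (T : measurableType d) (R : realType) (P : {measure set T -> \bar R}).

Lemma le_integral_sum (I : finType) (f : I -> T -> R) (c : I -> R) :
  (forall i, measurable_fun setT (f i)) -> (forall i x, 0 <= f i x) ->
  (forall i, \int[P]_x (f i x)%:E <= (c i)%:E)%E ->
  (\int[P]_x (\sum_i f i x)%:E <= (\sum_i c i)%:E)%E.
Proof.
move=> mf f0 fc.
under eq_integral do rewrite -sumEFin.
rewrite ge0_integral_sum//.
- by rewrite -sumEFin; apply: lee_sum => i _.
- by move=> i; exact/measurable_EFinP.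
- by move=> i x _; rewrite lee_fin.
Qed.

Lemma le_integral_scale (f : T -> R) (a c : R) :
  measurable_fun setT f -> (forall x, 0 <= f x) -> 0 <= a ->
  (\int[P]_x (f x)%:E <= c%:E)%E -> (\int[P]_x (a * f x)%:E <= (a * c)%:E)%E.
Proof.
move=> mf f0 a0 fc.
under eq_integral do rewrite EFinM.
rewrite ge0_integralZl//; first by rewrite EFinM lee_wpmul2l.
- exact/measurable_EFinP.
- by move=> x _; rewrite lee_fin.
Qed.

Lemma le_integral_add (f g : T -> R) (a b : R) :
  measurable_fun setT f -> (forall x, 0 <= f x) ->
  measurable_fun setT g -> (forall x, 0 <= g x) ->
  (\int[P]_x (f x)%:E <= a%:E)%E -> (\int[P]_x (g x)%:E <= b%:E)%E ->
  (\int[P]_x (f x + g x)%:E <= (a + b)%:E)%E.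
Proof.
move=> mf f0 mg g0 fa gb.
under eq_integral do rewrite EFinD.
rewrite ge0_integralD//; first by rewrite EFinD leeD.
- by move=> x _; rewrite lee_fin.
- exact/measurable_EFinP.
- by move=> x _; rewrite lee_fin.
- exact/measurable_EFinP.
Qed.

End integral_bounds.

Lemma normal_tail_abs (R : realType) (y : R) : 0 <= y ->
  fine (normal_prob 0 1 [set g : R | y <= `|g|]) <= 2 * normal_tail y.
Proof.
move=> y0.
rewrite (_ : [set g | _] = `]-oo, (- y)] `|` `[y, +oo[)%classic; last first.
  by apply/seteqP; split => g /=; rewrite !in_itv/= andbT ler_normr lerNr orbC => /orP.
rewrite -lee_fin normal_prob_fineK; last exact: measurableU.
apply: le_trans (measureU2 _ _ _) _ => //.
change (normal_prob 0 1 `]-oo, (- y)%R]%classic + normal_prob 0 1 `[y, +oo[%classic <=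
  (2 * normal_tail y)%:E)%E.
by rewrite normal_prob_lty normal_tailE opprK -EFinD -mulr2n mulr_natl.
Qed.

(** * Joint events of the effect and the noise of one hypothesis *)

Section rectangles.
Context (R : realType) (d : measure_display) (Omega : measurableType d)
  (P : probability Omega R) (m n : nat) (sigma p : R) (nu : probability R R)
  (mu : 'I_m -> {RV P >-> R}) (X : 'I_n -> 'I_m -> {RV P >-> R}).
Hypotheses (sigma0 : 0 < sigma) (n0 : (0 < n)%N) (p01 : 0 < p < 1)
  (nu0 : nu [set 0] = 0%E)
  (model : two_groups_model sigma p nu mu X).

Local Notation G := (noise sigma mu X).

Definition rect (A B : set R) (i : 'I_m) : set Omega :=
  [set w | A (mu i w) /\ B (G i w)].

Definition rect_prob (A B : set R) : R :=
  fine (effect_law p nu A) * fine (normal_prob 0 1 B).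

Lemma measurable_noise i : measurable_fun setT (G i).
Proof.
rewrite /noise; apply: measurable_funM => //; apply: measurable_funM => //.
apply: measurable_funB => //; apply: measurable_funM => //.
exact: measurable_sum.
Qed.

Lemma measurable_rect A B i : measurable A -> measurable B -> measurable (rect A B i).
Proof.
move=> mA mB; apply: measurableI.
  exact: (measurable_preimage (measurable_funPT (mu i)) mA).
exact: (measurable_preimage (measurable_noise i) mB).
Qed.

Lemma effect_lawT : fine (effect_law p nu setT) = 1.
Proof.
by rewrite /effect_law diracT probability_setT !mule1 -EFinD subrK.
Qed.

Lemma effect_law_null : fine (effect_law p nu [set 0]) = 1 - p.
Proof.
by rewrite /effect_law nu0 mule0 adde0 diracE mem_set// mule1.
Qed.

Lemma effect_law_signal (A : set R) : measurable A -> ~ A 0 ->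
  fine (effect_law p nu A) = p * fine (nu A).
Proof.
move=> mA A0; rewrite /effect_law diracE memNset// mule0 add0e.
by rewrite -[X in (_ * X)%E]fineK ?fin_num_measure.
Qed.

Lemma rect_indep (A B : 'I_m -> set R) (Q : pred 'I_m) :
  (forall i, measurable (A i)) -> (forall i, measurable (B i)) ->
  P [set w | forall i, Q i -> rect (A i) (B i) i w] =
  (\prod_(i | Q i) rect_prob (A i) (B i))%:E.
Proof.
move=> mA mB.
pose A' i := if Q i then A i else setT.
pose B' i := if Q i then B i else setT.
transitivity (P [set w | forall i, A' i (mu i w) /\ B' i (G i w)]).
  congr (P _); apply/seteqP; split => w /= h i.
    by rewrite /A' /B'; case: ifP => // Qi; exact: h.
  by move=> Qi; have := h i; rewrite /A' /B' Qi.
rewrite (noise_rectangles sigma0 n0 model); last 2 first.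
- by move=> i; rewrite /A'; case: ifP.
- by move=> i; rewrite /B'; case: ifP.
rewrite [in RHS]big_mkcond/=; congr EFin; apply: eq_bigr => i _.
rewrite /A' /B'; case: ifP => // _.
by rewrite effect_lawT (normal_prob_setT 0 1) mulr1.
Qed.

Lemma rect_probE A B i : measurable A -> measurable B ->
  P (rect A B i) = (rect_prob A B)%:E.
Proof.
move=> mA mB; have := @rect_indep (fun=> A) (fun=> B) (pred1 i) (fun=> mA) (fun=> mB).
rewrite big_pred1_eq => <-; congr (P _); apply/seteqP; split => w /= h.
  by move=> j /eqP ->.
by apply: h.
Qed.

Lemma integral_rect A B i : measurable A -> measurable B ->
  (\int[P]_w (\1_(rect A B i) w)%:E = (rect_prob A B)%:E)%E.
Proof.
move=> mA mB; rewrite integral_indic//; last exact: measurable_rect.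
by apply: etrans (rect_probE i mA mB); rewrite setIT.
Qed.

Lemma integral_prod_rect (a b : 'I_m -> R) (A B : 'I_m -> set R) :
  (forall i, measurable (A i)) -> (forall i, measurable (B i)) ->
  (\int[P]_w (\prod_i (a i + b i * \1_(rect (A i) (B i) i) w))%:E =
   (\prod_i (a i + b i * rect_prob (A i) (B i)))%:E)%E.
Proof.
move=> mA mB; apply: integral_prod_indep; first by move=> i; exact: measurable_rect.
by move=> Q; exact: rect_indep.
Qed.

Lemma measurable_prod_rect (a b : 'I_m -> R) (A B : 'I_m -> set R) :
  (forall i, measurable (A i)) -> (forall i, measurable (B i)) ->
  measurable_fun setT (fun w => \prod_i (a i + b i * \1_(rect (A i) (B i) i) w)).
Proof.
move=> mA mB; apply: measurable_prod => i _; apply: measurable_funD => //.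
by apply: measurable_funM => //; apply: measurable_indic; exact: measurable_rect.
Qed.

Definition signal : set R := [set x | x <> 0].

Lemma measurable_signal : measurable signal.
Proof. by rewrite (_ : signal = ~` [set 0])//; exact: measurableC. Qed.

Lemma fine_nu_signal : fine (nu signal) = 1.
Proof.
by rewrite (_ : signal = ~` [set 0])// probability_setC//= nu0 sube0.
Qed.

Lemma rect_prob_signal (A B : set R) : measurable A -> ~ A 0 ->
  rect_prob A B = p * fine (nu A) * fine (normal_prob 0 1 B).
Proof. by move=> mA A0; rewrite /rect_prob effect_law_signal. Qed.

Lemma rect_prob_ge0 A B : 0 <= rect_prob A B.
Proof.
rewrite /rect_prob mulr_ge0 ?fine_ge0// /effect_law.
by rewrite adde_ge0// mule_ge0// lee_fin ?subr_ge0; case/andP: p01 => ? ?; exact: ltW.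
Qed.

Lemma z_scoreE i w :
  Num.sqrt n%:R * sample_mean X w i / sigma = Num.sqrt n%:R * mu i w / sigma + G i w.
Proof. by rewrite /noise -mulrDl -mulrDr addrCA subrr addr0. Qed.

End rectangles.

(** * Self-consistent rules *)

Lemma p_valueE (R : realType) (n : nat) (sigma x : R) :
  p_value n sigma x = 2 * normal_tail `|Num.sqrt n%:R * x / sigma|.
Proof. by rewrite /p_value normal_cdfE. Qed.

Lemma indic_mem (T : Type) (R : realType) (A : set T) x : A x -> (\1_A x : R) = 1.
Proof. by move=> Ax; rewrite indicE mem_set. Qed.

Section self_consistent_rules.
Context (R : realType) (d : measure_display) (Omega : measurableType d)
  (P : probability Omega R) (m n : nat) (sigma p : R) (nu : probability R R)
  (mu : 'I_m -> {RV P >-> R}) (X : 'I_n -> 'I_m -> {RV P >-> R}).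
Hypotheses (sigma0 : 0 < sigma) (n0 : (0 < n)%N) (p01 : 0 < p < 1)
  (nu0 : nu [set 0] = 0%E)
  (model : two_groups_model sigma p nu mu X).
Variables (alpha lam h : R).
Hypotheses (alpha01 : 0 < alpha < 1) (lam0 : 0 < lam) (h01 : 0 < h < 1).

Local Notation G := (noise sigma mu X).
Local Notation rect := (rect sigma mu X).
Local Notation rect_prob := (rect_prob p nu).
Local Notation signal := (@signal R).
Local Notation level k := (k.+1%:R * alpha / m%:R).

(** When the effect is zero the z-score is the noise itself, so these are the noise values whose
    null p-value is at most [t]. *)
Definition null_reject (t : R) : set R := [set g : R | 2 * normal_tail `|g| <= t].

Lemma measurable_null_reject t : measurable (null_reject t).
Proof.
have mf : measurable_fun setT (fun g : R => 2 * normal_tail `|g|).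
  apply: measurable_funM => //; apply: measurableT_comp => //.
  by apply: continuous_measurable_fun; exact: continuous_normal_tail.
rewrite (_ : null_reject t = (fun g : R => 2 * normal_tail `|g|) @^-1` `]-oo, t]%classic).
  exact: measurable_preimage.
by apply/seteqP; split => g /=; rewrite in_itv.
Qed.

Lemma rect_prob_null_reject t : 0 < t -> t <= 1 ->
  rect_prob [set 0] (null_reject t) <= t.
Proof.
move=> t0 t1; rewrite /rect_prob effect_law_null//.
have [y y0 [yt yP]] := normal_tail_inv t0 t1.
have -> : null_reject t = [set g : R | y <= `|g|].
  by apply/seteqP; split => g /=; rewrite /null_reject/= yP.
rewrite -[leRHS]mul1r ler_pM ?fine_ge0//.
- by rewrite subr_ge0; case/andP: p01 => _ /ltW.
- by rewrite gerBl; case/andP: p01 => /ltW.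
- by rewrite -yt normal_tail_abs.
Qed.

(* If fewer than [(1 - h) k] of the [k = #|D|] rejected hypotheses are signals,
   then the number N of null p-values below [k alpha / m] is at least [h k]; the
   Chernoff bound [1 <= expR (lam (N - h k))], summed over all possible k,
   has an expectation that factorizes over the hypotheses. *)
Definition rejection_majorant (w : Omega) : R :=
  (\sum_(i < m) \1_(rect signal setT i) w) / (1 - h) +
  \sum_(k < m) (k.+1%:R * expR (- (lam * h) * k.+1%:R)) *
    \prod_(i < m) (1 + (expR lam - 1) * \1_(rect [set 0] (null_reject (level k)) i) w).

Lemma card_le_rejection_majorant (D : {set 'I_m}) w :
  (forall i, i \in D ->
    p_value n sigma (sample_mean X w i) <= #|D|%:R * alpha / m%:R) ->
  #|D|%:R <= rejection_majorant w.
Proof.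
have lam1 : 0 <= expR lam - 1 by rewrite subr_ge0 -expR0 ler_expR ltW.
have prod_ge1 k : 1 <= \prod_(i < m) (1 + (expR lam - 1) *
    (\1_(rect [set 0] (null_reject (level k)) i) w : R)).
  elim/big_ind : _ => // [x y x1 y1|i _]; first by rewrite -[1]mulr1 ler_pM.
  by rewrite lerDl mulr_ge0.
have term_ge0 k : 0 <= (k.+1%:R * expR (- (lam * h) * k.+1%:R)) *
    \prod_(i < m) (1 + (expR lam - 1) * (\1_(rect [set 0] (null_reject (level k)) i) w : R)).
  by rewrite mulr_ge0 ?mulr_ge0 ?expR_ge0// (le_trans _ (prod_ge1 k)).
have s_ge0 : 0 <= \sum_(i < m) (\1_(rect signal setT i) w : R) by rewrite sumr_ge0.
have h1 : 0 < 1 - h by rewrite subr_gt0; case/andP: h01.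
move=> HD; rewrite /rejection_majorant.
set s := \sum_(i < m) _ in s_ge0 *.
have [ks|sk] := leP #|D|%:R (s / (1 - h)).
  by rewrite (le_trans ks)// lerDl sumr_ge0.
have D0 : (0 < #|D|)%N.
  by rewrite lt0n; apply/eqP => D0; move: sk; rewrite D0 ltNge divr_ge0// ltW.
have Dm : (#|D|.-1 < m)%N.
  by rewrite prednK// -[X in (_ <= X)%N]card_ord max_card.
(* Ordinals start at 0, so the summand for [#|D|] rejections has index [#|D|.-1]. *)
pose k0 : 'I_m := Ordinal Dm.
have k0E : k0.+1 = #|D| by rewrite /= prednK.
pose N := \sum_(i < m) (\1_(rect [set 0] (null_reject (level k0)) i) w : R).
have DsN : #|D|%:R <= s + N.
  rewrite -sum1_card natr_sum big_mkcond/= /s /N -big_split/=; apply: ler_sum => i _.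
  case: ifPn => iD; last by rewrite addr_ge0.
  have : 2 * normal_tail `|Num.sqrt n%:R * mu i w / sigma + G i w| <= level k0.
    by rewrite k0E; have := HD _ iD; rewrite p_valueE (z_scoreE sigma mu).
  have [mu0|mu0] := eqVneq (mu i w) 0.
    rewrite mu0 mulr0 mul0r add0r => pi.
    have e : 1 <= (\1_(rect [set 0] (null_reject (level k0)) i) w : R) by rewrite indic_mem.
    by rewrite -[leLHS]add0r; apply: lerD.
  move=> _; have e : 1 <= (\1_(rect signal setT i) w : R).
    by rewrite indic_mem//; split => //=; apply/eqP.
  by rewrite -[leLHS]addr0; apply: lerD.
have hN : h * #|D|%:R <= N.
  move: sk; rewrite ltr_pdivrMr// => sk.
  have : s <= #|D|%:R * (1 - h) by exact: ltW.
  by rewrite mulrBr mulr1 (mulrC h) => sk'; lra.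
apply: (@le_trans _ _ (\sum_(k < m) (k.+1%:R * expR (- (lam * h) * k.+1%:R)) *
    \prod_(i < m) (1 + (expR lam - 1) * (\1_(rect [set 0] (null_reject (level k)) i) w : R)))).
  rewrite (bigD1 k0)//= -[leLHS]addr0 lerD ?sumr_ge0//.
  rewrite (_ : \prod_(i < m) _ = expR (lam * N)); last first.
    rewrite /N mulr_sumr expR_sum; apply: eq_bigr => i _.
    rewrite indicE; case: (_ \in _); first by rewrite !mulr1 addrC subrK.
    by rewrite !mulr0 addr0 expR0.
  have e1 : 1 <= expR (- (lam * h) * #|D|%:R + lam * N).
    rewrite -[X in X <= _]expR0 ler_expR mulNr addrC subr_ge0 -mulrA.
    by rewrite ler_pM2l.
  by rewrite k0E -mulrA -expRD ler_peMr.
by rewrite lerDr divr_ge0// ltW.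
Qed.

(** The Chernoff exponent per rejection: [lam * h] from the required deviation, minus the log moment
    generating function at [lam] of a Poisson law of mean [alpha]. *)
Let rate := lam * h - alpha * (expR lam - 1).

Definition null_excess : R := \sum_(k < m) k.+1%:R * expR (- rate * k.+1%:R).

(** By 1 + x <= expR x, each factor costs at most (expR lam - 1) times the level, and [m] levels add
    up to alpha (k + 1). The predicate [Q] allows one hypothesis to be left out. *)
Lemma prod_null_le (k : 'I_m) (Q : pred 'I_m) :
  \prod_(i < m | Q i) (1 + (expR lam - 1) * rect_prob [set 0] (null_reject (level k))) <=
  expR (alpha * (expR lam - 1) * k.+1%:R).
Proof.
have lam1 : 0 <= expR lam - 1 by rewrite subr_ge0 -expR0 ler_expR ltW.
have m0 : (0 < m)%N by exact: leq_ltn_trans (ltn_ord k).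
have [a0 a1] := andP alpha01.
have level0 : 0 < level k by rewrite divr_gt0 ?mulr_gt0 ?ltr0n.
have level1 : level k <= 1.
  rewrite ler_pdivrMr ?ltr0n// mul1r; apply: le_trans (_ : k.+1%:R <= _).
    by rewrite ler_piMr// ltW.
  by rewrite ler_nat.
have q0 : 0 <= rect_prob [set 0] (null_reject (level k)) by exact: rect_prob_ge0.
apply: (@le_trans _ _ (\prod_(i < m | Q i) expR ((expR lam - 1) * level k))).
  apply: ler_prod => i _; rewrite addr_ge0 ?(mulr_ge0 lam1 q0)//=.
  rewrite (le_trans (expR_ge1Dx _))// ler_expR ler_wpM2l//.
  exact: rect_prob_null_reject.
have x0 : 0 <= (expR lam - 1) * level k by rewrite mulr_ge0// ltW.
rewrite -expR_sum ler_expR.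
apply: (@le_trans _ _ (\sum_(i < m) (expR lam - 1) * level k)).
  by rewrite big_mkcond/=; apply: ler_sum => i _; case: ifP.
rewrite sumr_const card_ord -mulr_natl.
rewrite le_eqVlt; apply/orP; left; apply/eqP; field.
by rewrite pnatr_eq0 -lt0n.
Qed.

Let measurable_rect' A B i : measurable A -> measurable B -> measurable (rect A B i).
Proof. exact: measurable_rect. Qed.

Let msig (i : 'I_m) : measurable_fun setT (\1_(rect signal setT i) : Omega -> R).
Proof.
by apply: measurable_indic; apply: measurable_rect' => //; exact: measurable_signal.
Qed.

Let mnull (k : 'I_m) : measurable_fun setT (fun w : Omega => \prod_(i < m)
  (1 + (expR lam - 1) * \1_(rect [set 0] (null_reject (level k)) i) w)).
Proof.
apply: (@measurable_prod_rect _ _ _ P m n sigma mu X (fun=> 1) (fun=> expR lam - 1)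
  (fun=> [set 0]) (fun=> null_reject (level k))) => // i.
exact: measurable_null_reject.
Qed.

Lemma measurable_rejection_majorant : measurable_fun setT rejection_majorant.
Proof.
apply: measurable_funD.
  by apply: measurable_funM => //; apply: measurable_sum => i; exact: msig.
by apply: measurable_sum => k; apply: measurable_funM => //; exact: mnull.
Qed.

Let lam1 : 0 <= expR lam - 1.
Proof. by rewrite subr_ge0 -expR0 ler_expR ltW. Qed.

Let null_prod_ge0 (k : 'I_m) w : 0 <= \prod_(i < m)
  (1 + (expR lam - 1) * (\1_(rect [set 0] (null_reject (level k)) i) w : R)).
Proof. by apply: prodr_ge0 => i _; rewrite addr_ge0 ?mulr_ge0. Qed.

Lemma rejection_majorant_ge0 w : 0 <= rejection_majorant w.
Proof.
have h1 : 0 < 1 - h by rewrite subr_gt0; case/andP: h01.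
by rewrite addr_ge0// ?divr_ge0 ?sumr_ge0 ?ltW// => k _; rewrite !mulr_ge0 ?expR_ge0.
Qed.

Let rect_prob_signalT : rect_prob signal setT = p.
Proof.
rewrite rect_prob_signal//; last exact: measurable_signal.
by rewrite fine_nu_signal// (normal_prob_setT 0 1) !mulr1.
Qed.

Lemma integral_rejection_majorant :
  (\int[P]_w (rejection_majorant w)%:E <= (m%:R * p / (1 - h) + null_excess)%:E)%E.
Proof.
have h1 : 0 < 1 - h by rewrite subr_gt0; case/andP: h01.
apply: le_integral_add.
- by apply: measurable_funM => //; apply: measurable_sum => i; exact: msig.
- by move=> w; rewrite divr_ge0 ?sumr_ge0 ?ltW.
- by apply: measurable_sum => k; apply: measurable_funM => //; exact: mnull.
- by move=> w; apply: sumr_ge0 => k _; rewrite !mulr_ge0 ?expR_ge0.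
- under eq_integral do rewrite mulrC.
  rewrite mulrC; apply: le_integral_scale.
  + by apply: measurable_sum => i; exact: msig.
  + by move=> w; rewrite sumr_ge0.
  + by rewrite invr_ge0 ltW.
  rewrite mulr_natl -[m in _ *+ m]card_ord -sumr_const.
  apply: le_integral_sum => //.
  move=> i; rewrite (integral_rect sigma0 n0 model)//; last exact: measurable_signal.
  by rewrite rect_prob_signalT.
- apply: le_integral_sum => [k|k w|k].
  + by apply: measurable_funM => //; exact: mnull.
  + by rewrite !mulr_ge0 ?expR_ge0.
  rewrite [X in (_ <= X%:E)%E](_ : _ = k.+1%:R * expR (- (lam * h) * k.+1%:R) *
      expR (alpha * (expR lam - 1) * k.+1%:R)); last first.
    by rewrite -mulrA -expRD -mulrDl /rate opprB addrC.
  apply: le_integral_scale.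
  + exact: mnull.
  + exact: null_prod_ge0.
  + by rewrite mulr_ge0 ?expR_ge0.
  rewrite (integral_prod_rect sigma0 n0 model (fun=> 1) (fun=> expR lam - 1)
    (A := fun=> [set 0]) (B := fun=> null_reject (level k)))//; last first.
    by move=> i; exact: measurable_null_reject.
  by rewrite lee_fin; exact: (@prod_null_le k xpredT).
Qed.

(** That [i] is a signal costs a factor [p]. Given this, the expected number of signals is at most 1
    + m p, and the null factor of [i] disappears from each product. *)
Lemma integral_signal_rejection_majorant (i : 'I_m) :
  (\int[P]_w (\1_(rect signal setT i) w * rejection_majorant w)%:E <=
   (p * ((1 + m%:R * p) / (1 - h) + null_excess))%:E)%E.
Proof.
have h1 : 0 < 1 - h by rewrite subr_gt0; case/andP: h01.
have [p0 p1] := andP p01.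
under eq_integral do rewrite /rejection_majorant mulrDr.
rewrite mulrDr; apply: le_integral_add.
- by apply: measurable_funM => //; apply: measurable_funM => //; apply: measurable_sum => j; exact: msig.
- by move=> w; rewrite mulr_ge0// divr_ge0 ?sumr_ge0 ?ltW.
- apply: measurable_funM => //; apply: measurable_sum => k.
  by apply: measurable_funM => //; exact: mnull.
- by move=> w; rewrite mulr_ge0//; apply: sumr_ge0 => k _; rewrite !mulr_ge0 ?expR_ge0.
- under eq_integral do rewrite mulrA mulrC mulr_sumr.
  rewrite [X in (_ <= X%:E)%E](_ : _ = (1 - h)^-1 * (p * (1 + m%:R * p))); last by ring.
  apply: le_integral_scale.
  + by apply: measurable_sum => j; apply: measurable_funM.
  + by move=> w; apply: sumr_ge0 => j _; rewrite mulr_ge0.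
  + by rewrite invr_ge0 ltW.
  apply: (@le_trans _ _ (\sum_(j < m) (if j == i then p else p * p))%:E).
    apply: le_integral_sum => [j|j w|j].
    * exact: measurable_funM.
    * by rewrite mulr_ge0.
    case: eqVneq => [->|ji].
      under eq_integral do rewrite -expr2 indicE -natrX -[X in X%:R]mulnn mulnb andbb -indicE.
      rewrite (integral_rect sigma0 n0 model)//; last exact: measurable_signal.
      by rewrite rect_prob_signalT.
    pose Q : pred 'I_m := [pred l | (l == i) || (l == j)].
    have QE : [set w | forall l, Q l -> rect signal setT l w] =
        rect signal setT i `&` rect signal setT j.
      apply/seteqP; split => w /=.
        by move=> hw; split; apply: hw; rewrite /Q/= eqxx ?orbT.
      by move=> [hi hj] l /orP[] /eqP ->.
    under eq_integral do rewrite -[_ * _]/((\1_(rect signal setT i) \* \1_(rect signal setT j)) _) -indicI -QE.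
    rewrite integral_indic//; last first.
      by rewrite QE; apply: measurableI; apply: measurable_rect' => //; exact: measurable_signal.
    rewrite setIT.
    have PQ : P [set w | forall l, Q l -> rect signal setT l w] =
        (\prod_(l | Q l) rect_prob signal setT)%:E.
      apply: (rect_indep sigma0 n0 model Q (A := fun=> signal) (B := fun=> setT)) => // l.
      exact: measurable_signal.
    apply: (@le_trans _ _ (\prod_(l | Q l) rect_prob signal setT)%:E).
      by rewrite -PQ; exact: lexx.
    rewrite rect_prob_signalT (bigD1 i) /Q/= ?eqxx// (bigD1 j)/=; last by rewrite eqxx orbT ji.
    rewrite big_pred0 ?mulr1// => l.
    by case: (l == i); case: (l == j).
  rewrite lee_fin (bigD1 i)//= eqxx mulrDr mulr1 lerD2l.
  rewrite (eq_bigr (fun=> p * p)); last by move=> j /negbTE ->.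
  rewrite sumr_const -[leLHS]mulr_natl [leRHS]mulrCA ler_wpM2r ?mulr_ge0 ?(ltW p0)// ler_nat.
  by rewrite -[X in (_ <= X)%N]card_ord max_card.
- under eq_integral do rewrite mulr_sumr.
  rewrite mulr_sumr; apply: le_integral_sum => [k|k w|k].
  + by apply: measurable_funM => //; apply: measurable_funM => //; exact: mnull.
  + by rewrite !mulr_ge0 ?expR_ge0.
  rewrite [X in (_ <= X%:E)%E](_ : _ = k.+1%:R * expR (- (lam * h) * k.+1%:R) *
      (p * expR (alpha * (expR lam - 1) * k.+1%:R))); last first.
    have -> : expR (- rate * k.+1%:R) = expR (- (lam * h) * k.+1%:R) *
        expR (alpha * (expR lam - 1) * k.+1%:R).
      by rewrite -expRD -mulrDl /rate opprB addrC.
    have mulE (a b x y : R) : a * (b * (x * y)) = b * x * (a * y) by ring.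
    exact: mulE.
  under eq_integral do rewrite mulrCA.
  apply: le_integral_scale.
  + by apply: measurable_funM => //; exact: mnull.
  + by move=> w; rewrite mulr_ge0.
  + by rewrite mulr_ge0 ?expR_ge0.
  (* The indicator that [i] is a signal is absorbed into the product as its i-th factor, replacing
     the null factor, which equals 1 on that event. The integrand is again a product over
     independent coordinates. *)
  pose a (j : 'I_m) : R := if j == i then 0 else 1.
  pose b (j : 'I_m) : R := if j == i then 1 else expR lam - 1.
  pose A (j : 'I_m) : set R := if j == i then signal else [set 0].
  pose B (j : 'I_m) : set R := if j == i then setT else null_reject (level k).
  have prodE w : (\1_(rect signal setT i) w : R) * \prod_(j < m)
        (1 + (expR lam - 1) * \1_(rect [set 0] (null_reject (level k)) j) w) =
      \prod_(j < m) (a j + b j * \1_(rect (A j) (B j) j) w).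
    rewrite [in LHS](bigD1 i)//= [in RHS](bigD1 i)//= /a /b /A /B !eqxx add0r mul1r.
    have [ws|ws] := boolP (w \in rect signal setT i); last first.
      by rewrite [in LHS]indicE [in RHS]indicE (negbTE ws) !mul0r.
    rewrite [X in 1 + _ * X]indicE memNset; last first.
      by move: ws; rewrite inE => -[/= ws _] [/= ws' _].
    rewrite mulr0 addr0 mul1r.
    by congr (_ * _); apply: eq_bigr => j /negbTE ->.
  under eq_integral do rewrite prodE.
  rewrite (integral_prod_rect sigma0 n0 model)//; last 2 first.
  + by move=> j; rewrite /A; case: ifP => // _; exact: measurable_signal.
  + by move=> j; rewrite /B; case: ifP => // _; exact: measurable_null_reject.
  rewrite (bigD1 i)//= /a /b /A /B eqxx add0r mul1r rect_prob_signalT lee_fin ler_pM2l//.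
  apply: le_trans (@prod_null_le k (predC1 i)).
  by rewrite le_eqVlt (eq_bigr (fun=> 1 + (expR lam - 1) * rect_prob [set 0] (null_reject (level k)))) ?eqxx//; move=> j /negbTE ->.
Qed.

End self_consistent_rules.

(** * False rejections and missed signals *)

Section count_bounds.
Context (R : realType) (d : measure_display) (Omega : measurableType d)
  (P : probability Omega R) (m n : nat) (sigma p : R) (nu : probability R R)
  (mu : 'I_m -> {RV P >-> R}) (X : 'I_n -> 'I_m -> {RV P >-> R}).
Hypotheses (sigma0 : 0 < sigma) (n0 : (0 < n)%N) (p01 : 0 < p < 1)
  (nu0 : nu [set 0] = 0%E)
  (model : two_groups_model sigma p nu mu X).

Local Notation G := (noise sigma mu X).
Local Notation rect := (rect sigma mu X).
Local Notation rect_prob := (rect_prob p nu).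
Local Notation signal := (@signal R).
Local Notation xbar w i := (sample_mean X w i).
Local Notation rootn := (Num.sqrt n%:R : R).

Definition false_rejections (D : Omega -> {set 'I_m}) (w : Omega) : R :=
  #|[set i : 'I_m | (i \in D w) && (mu i w == 0)]%SET|%:R.

Definition missed_signals (D : Omega -> {set 'I_m}) (w : Omega) : R :=
  #|[set i : 'I_m | (i \notin D w) && (mu i w != 0)]%SET|%:R.

Lemma le_fine_integral (f : Omega -> R) (c : R) :
  (forall w, 0 <= f w) -> (\int[P]_w (f w)%:E <= c%:E)%E ->
  fine (\int[P]_w (f w)%:E) <= c.
Proof.
move=> f0 fc; have i0 : (0 <= \int[P]_w (f w)%:E)%E.
  by apply: integral_ge0 => w _; rewrite lee_fin.
by rewrite -lee_fin fineK// ge0_fin_numE// (le_lt_trans fc)// ltry.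
Qed.

Lemma card_boundedE (f : Omega -> R) : (forall w, 0 <= f w <= m%:R) ->
  (fine (\int[P]_w (f w)%:E))%:E = (\int[P]_w (f w)%:E)%E.
Proof.
move=> f01; rewrite fineK// ge0_fin_numE; last first.
  by apply: integral_ge0 => w _; rewrite lee_fin; case/andP: (f01 w).
apply: le_lt_trans (ge0_le_integral_sup (g := fun=> m%:R%:E) _ _ _) _.
- by move=> w; rewrite lee_fin; case/andP: (f01 w).
- by move=> w; rewrite lee_fin; case/andP: (f01 w).
- by rewrite integral_cst//= (_ : P setT = 1%E) ?mule1 ?ltry//; exact: probability_setT.
Qed.

Lemma missed_signals_bounded D w : 0 <= missed_signals D w <= m%:R.
Proof.
by rewrite ler0n/= ler_nat -[X in (_ <= X)%N]card_ord max_card.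
Qed.

Lemma missed_signalsE D w : missed_signals D w =
  \sum_(i < m) (((i \notin D w) && (mu i w != 0))%:R : R).
Proof.
rewrite /missed_signals -sum1_card natr_sum big_mkcond/=; apply: eq_bigr => i _.
by rewrite inE; case: ifP.
Qed.

Lemma false_rejectionsE D w : false_rejections D w =
  \sum_(i < m) (((i \in D w) && (mu i w == 0))%:R : R).
Proof.
rewrite /false_rejections -sum1_card natr_sum big_mkcond/=; apply: eq_bigr => i _.
by rewrite inE; case: ifP.
Qed.

Let rootn0 : 0 < rootn. Proof. by rewrite sqrtr_gt0 ltr0n. Qed.

Let xbarE i w : xbar w i = mu i w + sigma * G i w / rootn.
Proof.
rewrite /noise mulrCA divff ?mulr1; last by rewrite gt_eqF.
by rewrite mulrAC divff ?gt_eqF// mul1r addrC subrK.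
Qed.

Let noise_small i w eta : `|G i w| < rootn * eta / sigma ->
  `|sigma * G i w / rootn| < eta.
Proof.
move: (G i w) => g.
rewrite !normrM (gtr0_norm sigma0) (gtr0_norm (_ : 0 < rootn^-1)) ?invr_gt0//.
by rewrite ltr_pdivrMr// ltr_pdivlMr// (mulrC sigma) (mulrC eta).
Qed.

Definition window (t : R) : set R := [set x | x <> 0 /\ `|x| < t].

Lemma measurable_window t : measurable (window t).
Proof.
have mf : measurable_fun setT (fun x : R => `|x|) by exact: normr_measurable.
rewrite (_ : window t = signal `&` (fun x : R => `|x|) @^-1` `]-oo, t[%classic).
  apply: measurableI; first exact: measurable_signal.
  exact: measurable_preimage.
by apply/seteqP; split => x [xs xt]; split => //; move: xt; rewrite /= in_itv.
Qed.

Let window_not0 t : ~ window t 0. Proof. by case. Qed.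

Let measurable_abs_ge (y : R) : measurable [set g : R | y <= `|g|].
Proof.
have mf : measurable_fun setT (fun x : R => `|x|) by exact: normr_measurable.
rewrite (_ : [set x : R | y <= `|x|] = (fun x : R => `|x|) @^-1` `[y, +oo[%classic).
  exact: measurable_preimage.
by apply/seteqP; split => x /=; rewrite in_itv/= andbT.
Qed.

Let mindic A B i : measurable A -> measurable B ->
  measurable_fun setT (\1_(rect A B i) : Omega -> R).
Proof. by move=> mA mB; apply/measurable_indic/measurable_rect. Qed.

(** A missed signal has an effect below T + 2 eta, or a noise that moves the mean by eta or more, or
    a mean beyond T + eta in spite of which it was accepted. [bad i] is a measurable majorant of the
    last event. *)
Lemma missed_signals_le (D : Omega -> {set 'I_m}) (bad : 'I_m -> Omega -> R)
    (T eta b : R) : 0 <= eta ->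
  (forall i, measurable_fun setT (bad i)) -> (forall i w, 0 <= bad i w) ->
  (forall i, \int[P]_w (bad i w)%:E <= (p * b)%:E)%E ->
  (forall w i, i \notin D w -> mu i w <> 0 -> T + eta <= `|xbar w i| -> 1 <= bad i w) ->
  fine (\int[P]_w (missed_signals D w)%:E) <=
  m%:R * p * (fine (nu (window (T + eta *+ 2))) +
              2 * normal_tail (rootn * eta / sigma) + b).
Proof.
move=> eta0 mbad bad0 ibad badP.
have [p0 p1] := andP p01.
set y := rootn * eta / sigma.
have y0 : 0 <= y by rewrite divr_ge0 ?(ltW sigma0)// mulr_ge0// ltW.
pose f i w := (\1_(rect (window (T + eta *+ 2)) setT i) w : R) +
  (\1_(rect signal [set g | y <= `|g|] i) w : R) + bad i w.
apply: le_fine_integral; first by move=> w; case/andP: (missed_signals_bounded D w).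
apply: (@le_trans _ _ (\int[P]_w (\sum_(i < m) f i w)%:E)%E).
  apply: ge0_le_integral_sup => w; rewrite lee_fin.
    by case/andP: (missed_signals_bounded D w).
  rewrite missed_signalsE; apply: ler_sum => i _.
  have f0 : 0 <= f i w by rewrite !addr_ge0.
  case: (boolP (_ && _)) => //= /andP[iD /eqP mui].
  rewrite /f.
  have [xT|xT] := leP (T + eta) `|xbar w i|.
    by rewrite -[leLHS]add0r lerD ?addr_ge0 ?badP.
  have [Gy|Gy] := leP y `|G i w|.
    rewrite -[leLHS]addr0 lerD// -[leLHS]add0r lerD//.
    by rewrite indic_mem.
  rewrite -[leLHS]addr0 lerD// -[leLHS]addr0 lerD//.
  rewrite indic_mem//; split => //; split => //.
  have -> : mu i w = xbar w i - sigma * G i w / rootn by rewrite xbarE addrK.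
  rewrite (le_lt_trans (ler_normB _ _))// mulr2n addrA ltrD//.
  exact: noise_small.
have -> : m%:R * p * (fine (nu (window (T + eta *+ 2))) + 2 * normal_tail y + b) =
    \sum_(i < m) (p * fine (nu (window (T + eta *+ 2))) + p * (2 * normal_tail y) + p * b).
  by rewrite sumr_const card_ord -mulr_natl; ring.
have mw := measurable_window (T + eta *+ 2).
have ms := @measurable_signal R.
apply: le_integral_sum => [i|i w|i].
- apply: measurable_funD => //; apply: measurable_funD; exact: mindic.
- by rewrite !addr_ge0.
apply: le_integral_add => //.
  by apply: measurable_funD; exact: mindic.
apply: le_integral_add => //; [exact: mindic|exact: mindic| |].
  rewrite (integral_rect sigma0 n0 model)// rect_prob_signal//.
  by rewrite (normal_prob_setT 0 1) mulr1.
rewrite (integral_rect sigma0 n0 model)// rect_prob_signal//.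
by rewrite fine_nu_signal// mulr1 lee_fin ler_pM2l// normal_tail_abs.
Qed.

(** Signals below T - 2 eta with a noise that moves the mean by less than eta have a mean below T -
    eta, and are missed unless [bad i] occurs. [ge0_le_integralD] then subtracts the measurable sum
    of the [bad i]. *)
Lemma missed_signals_ge (D : Omega -> {set 'I_m}) (bad : 'I_m -> Omega -> R)
    (T eta b : R) : 0 <= eta ->
  (forall i, measurable_fun setT (bad i)) -> (forall i w, 0 <= bad i w) ->
  (forall i, \int[P]_w (bad i w)%:E <= (p * b)%:E)%E ->
  (forall w i, i \in D w -> mu i w <> 0 -> `|xbar w i| < T - eta -> 1 <= bad i w) ->
  m%:R * p * (fine (nu (window (T - eta *+ 2))) *
              (1 - 2 * normal_tail (rootn * eta / sigma)) - b) <=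
  fine (\int[P]_w (missed_signals D w)%:E).
Proof.
move=> eta0 mbad bad0 ibad badP.
have [p0 p1] := andP p01.
set y := rootn * eta / sigma.
have y0 : 0 <= y by rewrite divr_ge0 ?(ltW sigma0)// mulr_ge0// ltW.
have mw := measurable_window (T - eta *+ 2).
pose B : set R := ~` [set g : R | y <= `|g|].
have mB : measurable B by exact: measurableC.
pose f i w := (\1_(rect (window (T - eta *+ 2)) B i) w : R).
have key : (\int[P]_w (\sum_(i < m) f i w)%:E <=
    \int[P]_w (missed_signals D w)%:E + \int[P]_w (\sum_(i < m) bad i w)%:E)%E.
  apply: ge0_le_integralD.
  - by move=> w; case/andP: (missed_signals_bounded D w).
  - by move=> w; apply: sumr_ge0.
  - by move=> w; apply: sumr_ge0.
  - by apply: measurable_sum => i; exact: mindic.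
  - exact: measurable_sum.
  - move=> w; rewrite missed_signalsE -big_split/=; apply: ler_sum => i _.
    rewrite /f indicE; case: (boolP (w \in _)) => [|_]; last by rewrite addr_ge0.
    rewrite inE => -[/= [mui muT] /negP]; rewrite -ltNge => Gy.
    have [iD|iD] := boolP (i \in D w); last first.
      by rewrite /= (introN eqP mui)//= lerDl.
    rewrite /= add0r badP// xbarE (le_lt_trans (ler_normD _ _))//.
    rewrite (lt_le_trans (ltrD muT (noise_small Gy)))//.
    by rewrite mulr2n opprD addrA subrK.
move: key.
have -> : (\int[P]_w (\sum_(i < m) f i w)%:E =
    (m%:R * p * (fine (nu (window (T - eta *+ 2))) * fine (normal_prob 0 1 B)))%:E)%E.
  under eq_integral do rewrite -sumEFin.
  rewrite ge0_integral_sum//; last 2 first.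
  - by move=> i; apply/measurable_EFinP; exact: mindic.
  - by move=> i w _; rewrite lee_fin.
  under eq_bigr do rewrite (integral_rect sigma0 n0 model)// rect_prob_signal//.
  by rewrite sumEFin sumr_const card_ord -mulr_natl; congr EFin; ring.
have ib : (\int[P]_w (\sum_(i < m) bad i w)%:E <= (m%:R * p * b)%:E)%E.
  rewrite (_ : m%:R * p * b = \sum_(i < m) p * b); last first.
    by rewrite sumr_const card_ord -[RHS]mulr_natl mulrA.
  exact: le_integral_sum.
move=> /le_trans/(_ (leeD (lexx _) ib)).
rewrite -[X in (_ <= X + _)%E](card_boundedE (missed_signals_bounded D)) -EFinD lee_fin => hle.
rewrite mulrBr lerBlDr (le_trans _ hle)// ler_wpM2l ?mulr_ge0 ?(ltW p0)//.
rewrite ler_wpM2l ?fine_ge0//.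
rewrite -lee_fin normal_prob_fineK// /B probability_setC; last exact: measurable_abs_ge.
rewrite -[X in (_ <= _ - X)%E](normal_prob_fineK 0 1 (measurable_abs_ge y)) -EFinB lee_fin.
by rewrite lerD2l lerN2 normal_tail_abs.
Qed.


Lemma false_rejections_le_interval (D : Omega -> {set 'I_m}) (a b : R) :
  a <= 0 -> 0 <= b ->
  (forall w i, i \in D w -> xbar w i <= a \/ b <= xbar w i) ->
  fine (\int[P]_w (false_rejections D w)%:E) <=
  m%:R * (1 - p) * (normal_tail (rootn * b / sigma) + normal_tail (rootn * - a / sigma)).
Proof.
move=> a0 b0 HD; have [p0 p1] := andP p01.
pose B : set R := `]-oo, rootn * a / sigma] `|` `[rootn * b / sigma, +oo[.
have mB : measurable B by exact: measurableU.
apply: le_fine_integral => //.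
apply: (@le_trans _ _ (\int[P]_w (\sum_(i < m) \1_(rect [set 0] B i) w)%:E)%E).
  apply: ge0_le_integral_sup => w; rewrite lee_fin//.
  rewrite false_rejectionsE; apply: ler_sum => i _.
  case: (boolP (_ && _)) => //= /andP[iD /eqP mui].
  rewrite indic_mem//; split => //; rewrite /B/= !in_itv/= andbT.
  have -> : G i w = rootn * xbar w i / sigma by rewrite (z_scoreE sigma mu) mui mulr0 mul0r add0r.
  by rewrite !ler_pM2r ?invr_gt0// !ler_pM2l//; exact: HD.
have -> : m%:R * (1 - p) * (normal_tail (rootn * b / sigma) + normal_tail (rootn * - a / sigma)) =
    \sum_(i < m) (1 - p) * (normal_tail (rootn * b / sigma) + normal_tail (rootn * - a / sigma)).
  by rewrite sumr_const card_ord -[RHS]mulr_natl mulrA.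
apply: le_integral_sum => // i; first exact: mindic.
rewrite (integral_rect sigma0 n0 model)// lee_fin /rect_prob effect_law_null//.
rewrite ler_pM2l ?subr_gt0// -lee_fin normal_prob_fineK//.
apply: le_trans (measureU2 _ _ _) _ => //.
change (normal_prob 0 1 `]-oo, (rootn * a / sigma)%R]%classic +
  normal_prob 0 1 `[(rootn * b / sigma)%R, +oo[%classic <=
  (normal_tail (rootn * b / sigma) + normal_tail (rootn * - a / sigma))%:E)%E.
by rewrite normal_prob_lty normal_tailE -EFinD addrC mulrN mulNr.
Qed.

Variables (alpha : R).
Hypothesis alpha01 : 0 < alpha < 1.

Let alpha0 : 0 < alpha. Proof. by case/andP: alpha01. Qed.

Local Notation pval w := (fun i => p_value n sigma (xbar w i)).
Local Notation level k := (k.+1%:R * alpha / m%:R).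

Let pvalE w i : p_value n sigma (xbar w i) = 2 * normal_tail (rootn * `|xbar w i| / sigma).
Proof.
by rewrite p_valueE normrM normrM (gtr0_norm rootn0) (gtr0_norm (_ : 0 < sigma^-1)) ?invr_gt0.
Qed.

Section self_consistent.
Variables (lam h : R) (D : Omega -> {set 'I_m}).
Hypotheses (lam0 : 0 < lam) (h01 : 0 < h < 1).
Hypothesis HD : forall w i, i \in D w -> p_value n sigma (xbar w i) <= #|D w|%:R * alpha / m%:R.

Lemma false_rejections_self_consistent :
  fine (\int[P]_w (false_rejections D w)%:E) <= m%:R * p / (1 - h) + null_excess m alpha lam h.
Proof.
apply: le_fine_integral => //.
apply: le_trans (integral_rejection_majorant sigma0 n0 p01 nu0 model alpha01 lam0 h01).
apply: ge0_le_integral_sup => w; rewrite lee_fin//.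
apply: le_trans (card_le_rejection_majorant mu lam0 h01 (@HD w)).
by rewrite ler_nat; apply/subset_leq_card/fintype.subsetP => i; rewrite inE => /andP[].
Qed.

(* A rejection with [|xbar| < T - eta] forces at least K rejections in total,
   which Markov's inequality makes unlikely. *)
Lemma missed_signals_self_consistent (T eta : R) : 0 <= eta -> eta <= T ->
  let K := m%:R * (2 * normal_tail (rootn * (T - eta) / sigma)) / alpha in
  0 < K ->
  m%:R * p * (fine (nu (window (T - eta *+ 2))) *
              (1 - 2 * normal_tail (rootn * eta / sigma)) -
              ((1 + m%:R * p) / (1 - h) + null_excess m alpha lam h) / K) <=
  fine (\int[P]_w (missed_signals D w)%:E).
Proof.
move=> eta0 etaT K K0.
have mmaj := measurable_rejection_majorant sigma mu X alpha lam h.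
have maj0 w := rejection_majorant_ge0 sigma mu X alpha lam0 h01 w.
have msig (i : 'I_m) : measurable_fun setT (\1_(rect signal setT i) : Omega -> R).
  by apply: mindic => //; exact: measurable_signal.
apply: (@missed_signals_ge D (fun i w => K^-1 * (\1_(rect signal setT i) w *
  rejection_majorant sigma mu X alpha lam h w)) T eta) => //.
- move=> i; apply: measurable_funM => //; apply: measurable_funM => //; exact: msig.
- by move=> i w; rewrite !mulr_ge0// invr_ge0 ltW.
- move=> i; rewrite mulrA mulrC; apply: le_integral_scale.
  + by apply: measurable_funM => //; exact: msig.
  + by move=> w; rewrite mulr_ge0.
  + by rewrite invr_ge0 ltW.
  exact: (integral_signal_rejection_majorant sigma0 n0 p01 nu0 model alpha01 lam0 h01 i).
move=> w i iD mui xT.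
rewrite indic_mem// mul1r ler_pdivlMl// mulr1.
apply: le_trans (card_le_rejection_majorant mu lam0 h01 (@HD w)).
have m0 : 0 < (m%:R : R) by rewrite ltr0n (leq_ltn_trans _ (ltn_ord i)).
have := HD iD; rewrite pvalE ler_pdivlMr// mulrC => hq.
rewrite /K ler_pdivrMr//; apply: le_trans hq.
rewrite ler_pM2l// ler_pM2l// le_normal_tail// ler_pM2r ?invr_gt0// ler_pM2l//.
exact: ltW.
Qed.

End self_consistent.

Lemma sum_pow_le (x : R) (k : nat) : 0 <= x <= 2^-1 -> \sum_(j < k) x ^+ j.+1 <= 2 * x.
Proof.
move=> /andP[x0 x1].
(* A bound on the remaining geometric tail is carried along so that the induction closes. *)
suff : \sum_(j < k) x ^+ j.+1 + 2 * x ^+ k.+1 <= 2 * x.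
  by apply: le_trans; rewrite lerDl mulr_ge0 ?exprn_ge0.
elim: k => [|k IH]; first by rewrite big_ord0 add0r expr1.
rewrite big_ord_recr/= (le_trans _ IH)// -addrA lerD2l (exprS _ k.+1).
have : 0 <= x ^+ k.+1 by rewrite exprn_ge0.
move: (x ^+ k.+1) => z z0; nra.
Qed.

(* If i is accepted although [|xbar| >= T + eta], then for some k fewer than k
   of the signals in [T, T + eta] have a p-value below [k alpha / m]. Their
   number N satisfies [1_{N < k} <= 2^k 2^-N], whose expectation factorizes. *)
Lemma missed_signals_step (D : Omega -> {set 'I_m}) (T eta : R) :
  (2 <= m)%N -> 0 < T -> 0 <= eta ->
  (forall w i, i \notin D w -> exists k : nat, [/\ (0 < k <= m)%N,
    k%:R * alpha / m%:R < p_value n sigma (xbar w i) &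
    (card_below (pval w) (k%:R * alpha / m%:R) < k)%N]) ->
  let L := p * fine (nu `[T, (T + eta)%R]%classic) *
    expR (n%:R * (T ^+ 2 / 2 + eta * T) / sigma ^+ 2) * (alpha / 8) in
  let x := 2 * expR (- L) in
  x <= 2^-1 ->
  fine (\int[P]_w (missed_signals D w)%:E) <=
  m%:R * p * (fine (nu (window (T + eta *+ 2))) +
              2 * normal_tail (rootn * eta / sigma) + 2 * x).
Proof.
move=> m2 T0 eta0 HD L x x12.
have [p0 p1] := andP p01.
have m0 : 0 < (m%:R : R) by rewrite ltr0n (leq_trans _ m2).
(* On the z-score scale: [theta] is the shift caused by an effect T, and [z] the score of a mean T +
   eta. Below, [y k] is the critical score of level k. *)
pose theta := rootn * T / sigma; pose z := rootn * (T + eta) / sigma.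
have theta0 : 0 <= theta by rewrite divr_ge0 ?(ltW sigma0)// mulr_ge0// ltW.
have z0 : 0 <= z by rewrite divr_ge0 ?(ltW sigma0)// mulr_ge0 ?(ltW rootn0)// addr_ge0// ltW.
have /choice[y yP] (k : 'I_m) : exists y, [/\ 0 <= y, 2 * normal_tail y = level k &
    forall g, 0 <= g -> (2 * normal_tail g <= level k) = (y <= g)].
  have [||y y0 [yk yg]] := @normal_tail_inv R (level k).
  - by rewrite divr_gt0// mulr_gt0.
  - rewrite ler_pdivrMr// mul1r; apply: le_trans (_ : k.+1%:R <= _).
      by rewrite ler_piMr//; case/andP: alpha01 => _ /ltW.
    by rewrite ler_nat.
  by exists y.
(* The i-th factor is the indicator that [i] is a signal. The j-th is 1/2 if the effect of [j] lies
   in [T, T + eta] and its noise exceeds [y k - theta], which forces a p-value below level k;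
   otherwise it is 1. *)
pose a (i j : 'I_m) : R := if j == i then 0 else 1.
pose b (i j : 'I_m) : R := if j == i then 1 else - 2^-1.
pose A (i j : 'I_m) : set R := if j == i then signal else `[T, T + eta]%classic.
pose B (i k j : 'I_m) : set R := if j == i then setT else `[y k - theta, +oo[%classic.
have mA i j : measurable (A i j) by rewrite /A; case: ifP => // _; exact: measurable_signal.
have mB i k j : measurable (B i k j) by rewrite /B; case: ifP.
pose term i k w := \prod_(j < m) (a i j + b i j * \1_(rect (A i j) (B i k j) j) w).
have mterm i k : measurable_fun setT (term i k).
  exact: (@measurable_prod_rect _ _ _ P m n sigma mu X (a i) (b i) (A i) (B i k)).
have term0 i k w : 0 <= term i k w.
  apply: prodr_ge0 => j _; rewrite /a /b; case: ifP => _; first by rewrite add0r mul1r.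
  by rewrite indicE; case: (_ \in _); rewrite ?mulr1 ?mulr0 ?addr0//; lra.
(* Only levels with [z <= y k] matter: a mean beyond T + eta has a p-value of at most that of [z],
   and this p-value lies above the level in question. *)
pose bad i w := \sum_(k < m) (if z <= y k then 2 ^+ k.+1 else 0) * term i k w.
have c0 k : 0 <= (if z <= y k then 2 ^+ k.+1 else 0 : R) by case: ifP.
apply: (@missed_signals_le D bad T eta (2 * x)) => //.
- by move=> i; apply: measurable_sum => k; apply: measurable_funM.
- by move=> i w; apply: sumr_ge0 => k _; rewrite mulr_ge0.
- move=> i; apply: (@le_trans _ _ (\sum_(k < m) p * x ^+ k.+1)%:E); last first.
    rewrite lee_fin -mulr_sumr ler_pM2l// sum_pow_le// x12 andbT.
    by rewrite mulr_ge0 ?expR_ge0.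
  apply: le_integral_sum => [k|k w|k].
  + exact: measurable_funM.
  + by rewrite mulr_ge0.
  case: ifPn => [zy|_]; last first.
    under eq_integral do rewrite mul0r.
    by rewrite integral0 lee_fin mulr_ge0 ?exprn_ge0 ?mulr_ge0 ?expR_ge0// ltW.
  have -> : p * x ^+ k.+1 = 2 ^+ k.+1 * (p * expR (- L) ^+ k.+1).
    by rewrite /x exprMn mulrCA.
  apply: le_integral_scale => //.
  rewrite (integral_prod_rect sigma0 n0 model)// lee_fin.
  rewrite (bigD1 i)//= {1}/a {1}/b {1}/A {1}/B eqxx add0r mul1r.
  rewrite rect_prob_signal//; last exact: measurable_signal.
  rewrite fine_nu_signal// (normal_prob_setT 0 1) !mulr1 ler_pM2l//.
  have [yk0 yk _] := yP k.
  pose e := p * fine (nu `[T, (T + eta)%R]%classic) * normal_tail (y k - theta).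
  (* [e] is the probability that a given other hypothesis contributes a factor 1/2. A change of
     measure at [theta] and z <= y k give the exponent in [L]. Of the 8 in [alpha / 8], one factor 2
     comes from the two-sided p-value, one from 1 - e / 2 <= expR (- e / 2), and one from m - 1 >= m
     / 2. *)
  have eL : k.+1%:R * (4 * L / m%:R) <= e.
    have h1 := normal_tail_shift_ge (y k) theta0.
    have h2 : n%:R * (T ^+ 2 / 2 + eta * T) / sigma ^+ 2 <= y k * theta - theta ^+ 2 / 2.
      apply: (@le_trans _ _ (z * theta - theta ^+ 2 / 2)); last by rewrite lerD2r ler_wpM2r.
      have rn2 : rootn ^+ 2 = n%:R by rewrite sqr_sqrtr.
      rewrite -rn2 le_eqVlt; apply/orP; left; apply/eqP; rewrite /z /theta; field.
      by rewrite gt_eqF.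
    have -> : k.+1%:R * (4 * L / m%:R) = p * fine (nu `[T, (T + eta)%R]%classic) *
        (expR (n%:R * (T ^+ 2 / 2 + eta * T) / sigma ^+ 2) * (level k / 2)).
      rewrite /L; field; by rewrite gt_eqF.
    rewrite /e ler_wpM2l ?mulr_ge0 ?fine_ge0 ?(ltW p0)//.
    apply: le_trans h1; rewrite -yk (mulrC 2) mulfK//.
    by rewrite ler_wpM2r ?normal_tail_ge0// ler_expR.
  have L0 : 0 <= L by rewrite !mulr_ge0 ?fine_ge0 ?expR_ge0 ?divr_ge0 ?(ltW p0) ?(ltW alpha0).
  apply: (@le_trans _ _ (\prod_(j < m | j != i) expR (- (2^-1 * e)))).
    apply: ler_prod => j /negbTE ji; rewrite /a /b /A /B ji.
    rewrite rect_prob_signal//; last first.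
      by rewrite /= in_itv/= => /andP[/(lt_le_trans T0)]; rewrite ltxx.
    rewrite [X in _ * X](_ : _ = e); last by [].
    have e1 : 0 <= e <= 1.
      rewrite /e !mulr_ge0 ?fine_ge0 ?normal_tail_ge0 ?(ltW p0)//=.
      rewrite !mulr_ile1 ?mulr_ge0 ?fine_ge0 ?normal_tail_ge0 ?(ltW p0) ?(ltW p1)//.
        by rewrite -lee_fin fineK ?fin_num_measure// probability_le1.
      have mI : measurable `[y k - theta, +oo[%classic by [].
      by have /andP[] := normal_prob_fine01 0 1 mI.
    have [e0 e1'] := andP e1.
    rewrite mulNr (le_trans _ (expR_ge1Dx _)) ?andbT//.
    lra.
  rewrite -expR_sum -expRM_natl ler_expR.
  have -> : \sum_(j < m | j != i) - (2^-1 * e) = - ((m.-1)%:R * (2^-1 * e)).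
    rewrite sumr_const -[LHS]mulr_natl mulrN; congr (- (_%:R * _)).
    by have := cardC1 i; rewrite card_ord => <-.
  rewrite mulrN lerN2.
  have m1 : (m%:R / 2 : R) <= m.-1%:R.
    have mS : (m%:R : R) = m.-1%:R + 1 by rewrite natr1 (ltn_predK m2).
    have : (1 : R) <= m.-1%:R by rewrite ler1n -ltnS (ltn_predK m2).
    rewrite mS ler_pdivrMr//; lra.
  apply: (@le_trans _ _ (m%:R / 2 * (2^-1 * (k.+1%:R * (4 * L / m%:R))))).
    rewrite le_eqVlt; apply/orP; left; apply/eqP; field; by rewrite gt_eqF.
  apply: ler_pM => //; last by rewrite ler_pM2l.
  by apply: mulr_ge0; rewrite ?invr_ge0// mulr_ge0// divr_ge0// mulr_ge0.
- move=> w i iD mui xT.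
  have [k [/andP[k0 km] qk ck]] := HD w i iD.
  have k1m : (k.-1 < m)%N by rewrite prednK.
  pose k' : 'I_m := Ordinal k1m.
  have kE : k'.+1 = k by rewrite /= prednK.
  have [yk0 yk yg] := yP k'.
  have zy : z <= y k'.
    rewrite leNgt; apply/negP => /ltW; rewrite -yg// kE leNgt => /negP; apply.
    rewrite (lt_le_trans qk)// pvalE ler_pM2l// le_normal_tail//.
    by rewrite /z ler_pM2r ?invr_gt0// ler_pM2l.
  rewrite /bad (bigD1 k')//= zy -[leLHS]addr0; apply: lerD; last first.
    by apply: sumr_ge0 => l _; rewrite mulr_ge0.
  pose S := [set j : 'I_m | p_value n sigma (xbar w j) <= k%:R * alpha / m%:R]%SET.
  have Sk : (#|S| <= k)%N by exact: ltnW.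
  (* A factor 1/2 arises only for [j] in [S], and [S] has fewer than k elements, so that 2^k
     outweighs the product. *)
  have : (2^-1) ^+ #|S| <= term i k' w.
    rewrite -prodr_const [leLHS]big_mkcond/=; apply: ler_prod => j _.
    rewrite /a /b; case: eqVneq => [->|ji].
      rewrite add0r mul1r indic_mem; first by case: ifP => _; lra.
      by rewrite /A /B eqxx.
    apply/andP; split; first by case: ifP.
    rewrite [X in _ * X]indicE; case: (boolP (w \in _)) => [|_]; last first.
      by rewrite mulr0 addr0; case: ifP => _; lra.
    rewrite mulr1 /A /B (negbTE ji) inE => -[/=]; rewrite !in_itv/= andbT => /andP[muT _] Gy.
    suff -> : j \in S by lra.
    rewrite inE p_valueE (z_scoreE sigma mu).
    have -> : k%:R * alpha / m%:R = level k' by rewrite kE.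
    have Zy : y k' <= rootn * mu j w / sigma + G j w.
      have : theta <= rootn * mu j w / sigma by rewrite ler_pM2r ?invr_gt0// ler_pM2l.
      by move: Gy; lra.
    by rewrite yg ?normr_ge0// ger0_norm// (le_trans yk0).
  move=> h; rewrite kE.
  apply: (@le_trans _ _ (2 ^+ k * (2^-1) ^+ #|S|)); last by rewrite ler_pM2l// exprn_gt0.
  rewrite exprVn ler_pdivlMr ?exprn_gt0// mul1r.
  by rewrite ler_weXn2l// ler1n.
Qed.

End count_bounds.

(** * Growth rates *)

Section growth.
Context (R : realType).

Lemma ln_nat_cvgy : (ln m%:R : R) @[m --> \oo] --> +oo.
Proof.
apply/cvgryPge => A.
have /cvgryPge/(_ (expR A)) := @cvgr_idn R.
apply: filterS => m mA; rewrite -ler_expR lnK// posrE.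
exact: lt_le_trans (expR_gt0 _) mA.
Qed.

Lemma cvgy_ratio (f g : nat -> R) (c : R) : 0 < c ->
  g m @[m --> \oo] --> +oo -> f m / g m @[m --> \oo] --> c ->
  f m @[m --> \oo] --> +oo.
Proof.
move=> c0 gy fg; apply/cvgryPge => A.
have c20 : 0 < c / 2 by rewrite divr_gt0.
near=> m.
have g0 : 0 < g m by near: m; move/cvgryPgt : gy; exact.
have gA : A / (c / 2) <= g m by near: m; move/cvgryPge : gy; exact.
have cf : c / 2 <= f m / g m.
  near: m; apply: (cvgr_ge _ fg).
  by rewrite ltr_pdivrMr// ltr_pMr// ltr1n.
move: gA cf; rewrite ler_pdivrMr// ler_pdivlMr// mulrC => h1 h2.
exact: le_trans h1 h2.
Unshelve. all: by end_near. Qed.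

Lemma cvg_near_eq (f g : nat -> R) (l : R) : (\forall m \near \oo, f m = g m) ->
  f m @[m --> \oo] --> l -> g m @[m --> \oo] --> l.
Proof. by move=> fg; apply: cvg_trans; exact: near_eq_cvg. Qed.

(** A squeeze up to an error: the bounds on a risk depend on eta, and their limits differ from the
    common value by the [nu]-mass near T, which only the choice of eta controls. *)
Lemma cvg_approx (r : nat -> R) (x : R) :
  (forall e, 0 < e -> exists l u : nat -> R, exists L U : R,
    [/\ l m @[m --> \oo] --> L, u m @[m --> \oo] --> U,
     \forall m \near \oo, l m <= r m <= u m, x - e <= L & U <= x + e]) ->
  r m @[m --> \oo] --> x.
Proof.
move=> H; apply/cvgrPdist_le => e e0.
have e20 : 0 < e / 2 by rewrite divr_gt0.
have [l [u [L [U [lL uU lru Lx Ux]]]]] := H _ e20.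
near=> m.
have /andP[h1 h2] : l m <= r m <= u m by near: m.
have h3 : L - e / 2 <= l m by near: m; apply: (cvgr_ge _ lL); rewrite ltrBlDr ltrDl.
have h4 : u m <= U + e / 2 by near: m; apply: (cvgr_le _ uU); rewrite ltrDl.
by rewrite ler_norml; lra.
Unshelve. all: by end_near. Qed.

Lemma expR_cvg0 (f : nat -> R) : f m @[m --> \oo] --> +oo ->
  expR (- f m) @[m --> \oo] --> (0 : R).
Proof. by move=> fy; exact: (cvg_comp _ _ fy (@cvgr_expR R)). Qed.

Context (n : nat -> nat) (p delta : nat -> R) (C beta : R).
Hypotheses (p01 : forall m, (2 <= m)%N -> 0 < p m < 1)
  (delta_gt0 : forall m, (2 <= m)%N -> 0 < delta m)
  (beta01 : 0 < beta <= 1)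
  (pE : forall m, (2 <= m)%N -> p m = m%:R `^ (- beta))
  (ln_delta : (fun m => ln (delta m) : R^o) =o_\oo (fun m => ln m%:R : R^o)).

Local Notation odds m := (delta m * ((1 - p m) / p m)).

Lemma ln_sparsity m : (2 <= m)%N -> ln (p m) = - beta * ln m%:R.
Proof. by move=> m2; rewrite pE// ln_powR. Qed.

Lemma sparsity_cvg0 : p m @[m --> \oo] --> (0 : R).
Proof.
have [b0 _] := andP beta01.
have : expR (- (beta * ln m%:R)) @[m --> \oo] --> (0 : R).
  apply: expR_cvg0; apply: (@cvgy_ratio _ (fun m => ln m%:R) beta) => //.
    exact: ln_nat_cvgy.
  apply: (@cvg_near_eq (fun=> beta)); last exact: cvg_cst.
  near=> m; rewrite mulfK// gt_eqF//.
  by near: m; have /cvgryPgt := ln_nat_cvgy; exact.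
apply: cvg_near_eq.
near=> m; have m2 : (2 <= m)%N by near: m; exact: nbhs_infty_ge.
rewrite -mulNr -ln_sparsity// lnK// posrE.
by case/andP: (p01 m2).
Unshelve. all: by end_near. Qed.

(** The sparsity contributes beta ln m; ln delta and ln (1 - p) are o(ln m). *)
Lemma ln_odds_cvg : ln (odds m) / ln m%:R @[m --> \oo] --> beta.
Proof.
have lV : ((ln m%:R)^-1 : R) @[m --> \oo] --> (0 : R).
  apply/gtr0_cvgV0; last exact: ln_nat_cvgy.
  by have /cvgryPgt := ln_nat_cvgy; exact.
have h1 : ln (delta m) / ln m%:R @[m --> \oo] --> (0 : R).
  apply/cvgr0Pnorm_le => e e0; move/eqoP: ln_delta => /(_ _ e0).
  apply: filter_app; near=> m => hm.
  have l0 : 0 < ln m%:R :> R by near: m; have /cvgryPgt := ln_nat_cvgy; exact.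
  rewrite normrM normfV ler_pdivrMr//.
  by rewrite normr_gt0 gt_eqF.
have h2 : ln (1 - p m) / ln m%:R @[m --> \oo] --> (0 : R).
  rewrite -[X in _ --> X](mulr0 (ln (1 - 0))).
  apply: cvgM => //; apply: (cvg_comp (fun m => 1 - p m) (@ln R)); last first.
    by apply: continuous_ln; rewrite subr0.
  by apply: cvgB; [exact: cvg_cst|exact: sparsity_cvg0].
have : ln (delta m) / ln m%:R + ln (1 - p m) / ln m%:R + beta @[m --> \oo] -->
    0 + 0 + beta.
  by apply: cvgD; [exact: cvgD|exact: cvg_cst].
rewrite !add0r; apply: cvg_near_eq.
near=> m; have m2 : (2 <= m)%N by near: m; exact: nbhs_infty_ge.
have l0 : 0 < ln m%:R :> R by near: m; have /cvgryPgt := ln_nat_cvgy; exact.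
have [p0 p1] := andP (p01 m2); have d0 := delta_gt0 m2.
have q0 : 0 < 1 - p m by rewrite subr_gt0.
have lE : ln (odds m) = ln (delta m) + ln (1 - p m) + beta * ln m%:R.
  rewrite lnM ?posrE// ?divr_gt0// ln_div ?posrE// ln_sparsity//; ring.
rewrite /= lE !mulrDl mulfK ?gt_eqF//.
Unshelve. all: by end_near. Qed.

Hypotheses (nlog : propto (fun m => (n m)%:R) (fun m => ln m%:R : R))
  (HA : assumption_A n p delta C).

(** The ratio of 2 ln odds to ln m has the limit 2 beta directly and C kappa through [n]. Hence C >
    0, and T is a genuine positive threshold. *)
Lemma growth_constant : exists kappa : R, [/\ 0 < kappa,
  (n m)%:R / ln m%:R @[m --> \oo] --> kappa & C * kappa = 2 * beta].
Proof.
case: nlog => kappa k0 nk; exists kappa; split => //.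
have [ny _ _ Ccvg] := HA.
have ny' : ((n m)%:R : R) @[m --> \oo] --> +oo by apply/cvgrnyP.
have h1 : (2 * ln (odds m) / (n m)%:R) * ((n m)%:R / ln m%:R) @[m --> \oo] --> C * kappa.
  exact: cvgM.
have h2 : 2 * (ln (odds m) / ln m%:R) @[m --> \oo] --> 2 * beta.
  by apply: cvgM; [exact: cvg_cst|exact: ln_odds_cvg].
have h3 : 2 * (ln (odds m) / ln m%:R) @[m --> \oo] --> C * kappa.
  apply: cvg_near_eq h1; near=> m.
  have N0 : 0 < (n m)%:R :> R by near: m; move/cvgryPgt : ny'; exact.
  by rewrite /= mulrA mulrA divfK ?gt_eqF// mulrA.
exact: (cvg_unique _ h3 h2).
Unshelve. all: by end_near. Qed.

(** ln m, n and ln odds are all of order ln m, so the sign of one number decides whether such an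
    exponent diverges. *)
Lemma exponent_cvgy (kappa x y z : R) :
  (n m)%:R / ln m%:R @[m --> \oo] --> kappa ->
  0 < x + y * kappa + z * beta ->
  x * ln m%:R + y * (n m)%:R + z * ln (odds m) @[m --> \oo] --> +oo.
Proof.
move=> nk c0; apply: (cvgy_ratio c0 ln_nat_cvgy).
have h1 : y * ((n m)%:R / ln m%:R) @[m --> \oo] --> y * kappa.
  by apply: cvgM => //; exact: cvg_cst.
have h2 : z * (ln (odds m) / ln m%:R) @[m --> \oo] --> z * beta.
  by apply: cvgM; [exact: cvg_cst|exact: ln_odds_cvg].
have : x + y * ((n m)%:R / ln m%:R) + z * (ln (odds m) / ln m%:R) @[m --> \oo] -->
    x + y * kappa + z * beta.
  by apply: cvgD => //; apply: cvgD => //; exact: cvg_cst.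
apply: cvg_near_eq; near=> m.
have l0 : 0 < ln m%:R :> R by near: m; have /cvgryPgt := ln_nat_cvgy; exact.
by rewrite /= !mulrDl mulfK ?gt_eqF// !mulrA.
Unshelve. all: by end_near. Qed.

End growth.

(** * The effect law near the threshold *)

Section probability_line.
Context (R : realType) (nu : probability R R).

Lemma nu_fineK (A : set R) : measurable A -> (fine (nu A))%:E = nu A.
Proof. by move=> mA; rewrite fineK// fin_num_measure. Qed.

Lemma le_fine_nu (A B : set R) : measurable A -> measurable B -> A `<=` B ->
  fine (nu A) <= fine (nu B).
Proof.
move=> mA mB AB; rewrite -lee_fin !nu_fineK//.
by apply: le_measure => //; rewrite inE.
Qed.

Definition band (T t : R) : set R := [set x | T - t <= `|x| <= T + t].

Lemma measurable_band T t : measurable (band T t).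
Proof.
have mf : measurable_fun setT (fun x : R => `|x|) by exact: normr_measurable.
rewrite (_ : band T t = (fun x : R => `|x|) @^-1` `[T - t, T + t]%classic).
  exact: measurable_preimage.
by apply/seteqP; split => x /=; rewrite in_itv.
Qed.

Lemma nu_window_upper (T t : R) :
  fine (nu (window (T + t))) <= fine (nu (window T)) + fine (nu (band T t)).
Proof.
have mw s := measurable_window (s : R); have mb := measurable_band T t.
rewrite -lee_fin EFinD !nu_fineK//; apply: le_trans (measureU2 _ (mw T) mb).
apply: le_measure; rewrite ?inE//; first exact: measurableU.
move=> x [x0 xt]; have [xT|xT] := ltP `|x| T; first by left; split.
by right; rewrite /band /= (ltW xt) andbT; lra.
Qed.

Lemma nu_window_lower (T t : R) :
  fine (nu (window T)) - fine (nu (band T t)) <= fine (nu (window (T - t))).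
Proof.
have mw s := measurable_window (s : R); have mb := measurable_band T t.
rewrite lerBlDr -lee_fin EFinD !nu_fineK//; apply: le_trans (measureU2 _ (mw (T - t)) mb).
apply: le_measure; rewrite ?inE//; first exact: measurableU.
move=> x [x0 xt]; have [xT|xT] := ltP `|x| (T - t); first by left; split.
by right; rewrite /band /= xT/=; lra.
Qed.

End probability_line.

Section density_near_threshold.
Context (R : realType) (sigma : R) (nu : probability R R) (C : R).
Hypotheses (sigma0 : 0 < sigma) (C0 : 0 < C) (HC : assumption_C sigma nu C).

Let T : R := sigma * Num.sqrt C.

Lemma threshold_gt0 : 0 < T.
Proof. by rewrite mulr_gt0// sqrtr_gt0. Qed.
Let T0 := threshold_gt0.

Lemma nu_near_threshold : exists e M : R, [/\ 0 < e, 0 < M,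
  (forall a b : R, a < b -> `[a, b]%classic `<=` `[- T - e, - T + e] `|` `[T - e, T + e] ->
    0 < fine (nu `[a, b]%classic)) &
  (forall a b : R, a < b -> `[a, b]%classic `<=` `[- T - e, - T + e] `|` `[T - e, T + e] ->
    fine (nu `[a, b]%classic) <= M * (b - a))].
Proof.
have [e [rho [e0 mrho [M rhoM] nuE _]]] := HC.
have TD : (`[- T - e, - T + e] `|` `[T - e, T + e])%classic T.
  by right; rewrite /= in_itv/= lerBlDr lerDl (ltW e0)/=.
have M0 : 0 < M by have /andP[r0] := rhoM _ TD; exact: lt_le_trans.
have lebE a b : a < b -> lebesgue_measure (`[a, b]%classic : set R) = (b - a)%:E.
  by move=> ab; rewrite lebesgue_measure_itv/= lte_fin ab -EFinB.
exists e, M; split => // a b ab abD; have mab : measurable `[a, b]%classic by [].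
  have mr : measurable_fun `[a, b] (EFin \o rho).
    by apply/measurable_EFinP; apply: measurable_funS abD mrho; exact: measurableU.
  rewrite lt_neqAle fine_ge0// andbT eq_sym; apply/eqP => nu0.
  have : nu `[a, b]%classic = 0%E by rewrite -(nu_fineK nu mab) nu0.
  rewrite (nuE _ mab abD) => int0.
  have ae0 : ae_eq lebesgue_measure `[a, b]%classic (EFin \o rho) (cst 0%E).
    apply: (@ae_eq_integral_abs _ (measurableTypeR R) R lebesgue_measure _ mab _ mr).1.
    rewrite -[RHS]int0.
    apply: eq_integral => x; rewrite inE => /abD/rhoM/andP[r0 _].
    by rewrite /= gtr0_norm.
  have : lebesgue_measure `[a, b]%classic = 0%E.
    apply: measure_negligible => //; move: ae0.
    case => N [mN N0 sub]; exists N; split => // x xab; apply: sub => /= /(_ xab)/eqP.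
    by rewrite eqe gt_eqF//; case/andP: (rhoM _ (abD _ xab)).
  move=> leb0; have := lebE _ _ ab.
  by move=> /(etrans (esym leb0))[] /esym/eqP; rewrite subr_eq0 gt_eqF.
rewrite -lee_fin nu_fineK// nuE//.
have -> : ((M * (b - a))%:E = \int[lebesgue_measure]_(x in `[a, b]) (cst M%:E x))%E.
  by rewrite integral_cst// EFinM; congr (_ * _)%E; exact/esym/lebE.
apply: ge0_le_integral => //.
- by move=> x /abD/rhoM/andP[/ltW + _]; rewrite lee_fin.
- by apply/measurable_EFinP; apply: measurable_funS abD mrho; exact: measurableU.
- by move=> x /abD/rhoM/andP[_]; rewrite lee_fin.
Qed.

Lemma nu_right_threshold_gt0 (s eta : R) : s = 1 \/ s = -1 -> 0 < eta ->
  0 < fine (nu [set x | T <= s * x <= T + eta]).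
Proof.
move=> s1 eta0; have [e [M [e0 _ nu0 _]]] := nu_near_threshold.
pose t := Num.min e eta.
have t0 : 0 < t by rewrite lt_min e0.
have te : t <= e by rewrite ge_min lexx.
have teta : t <= eta by rewrite ge_min lexx orbT.
case: s1 => ->.
- rewrite (_ : mkset _ = `[T, T + eta]%classic); last first.
    by apply/seteqP; split => x /=; rewrite in_itv/= mul1r.
  apply: (@lt_le_trans _ _ (fine (nu `[T, T + t]%classic))).
    apply: nu0; first by rewrite ltrDl.
    by move=> x /=; rewrite !in_itv/= => /andP[? ?]; right; lra.
  apply: le_fine_nu => // x /=; rewrite !in_itv/=; lra.
- rewrite (_ : mkset _ = `[- T - eta, - T]%classic); last first.
    by apply/seteqP; split => x /=; rewrite in_itv/= mulN1r => /andP[? ?]; apply/andP; lra.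
  apply: (@lt_le_trans _ _ (fine (nu `[- T - t, - T]%classic))).
    apply: nu0; first by rewrite ltrBlDr ltrDl.
    by move=> x /=; rewrite !in_itv/= => /andP[? ?]; left; lra.
  apply: le_fine_nu => // x /=; rewrite !in_itv/=; lra.
Qed.

Lemma nu_window_gt0 : 0 < fine (nu (window T)).
Proof.
have [e [M [e0 _ nu0 _]]] := nu_near_threshold.
pose t := Num.min e (T / 2).
have t0 : 0 < t by rewrite lt_min e0 divr_gt0.
have te : t <= e by rewrite ge_min lexx.
have tT : t <= T / 2 by rewrite ge_min lexx orbT.
apply: (@lt_le_trans _ _ (fine (nu `[T - t, T - t / 2]%classic))).
  apply: nu0; first by lra.
  by move=> x /=; rewrite !in_itv/= => /andP[? ?]; right; lra.
apply: le_fine_nu => //; first exact: measurable_window.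
move=> x /=; rewrite in_itv/= => /andP[x1 x2].
have x0 : 0 < x by lra.
by split; [apply/eqP; rewrite gt_eqF|rewrite gtr0_norm//; lra].
Qed.

Lemma nu_band_small (eps : R) : 0 < eps ->
  exists2 eta : R, 0 < eta < T / 2 & fine (nu (band T (eta *+ 2))) <= eps.
Proof.
move=> eps0; have [e [M [e0 M0 _ nuM]]] := nu_near_threshold.
(* [e / 2] keeps the band of half-width 2 eta where the density exists, [T / 4] gives eta < T / 2,
   and the band consists of two intervals of length 4 eta, of total mass at most 8 M eta. *)
pose eta := Num.min (e / 2) (Num.min (T / 4) (eps / (M * 8))).
have M8 : 0 < M * 8 by rewrite mulr_gt0.
have eta0 : 0 < eta by rewrite !lt_min !divr_gt0.
have etae : eta <= e / 2 by rewrite ge_min lexx.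
have etaT : eta <= T / 4 by rewrite !ge_min lexx !orbT.
have etaM : eta * (M * 8) <= eps by rewrite -ler_pdivlMr// !ge_min lexx !orbT.
exists eta; first by have := T0; lra.
have mI1 : measurable `[T - eta *+ 2, T + eta *+ 2]%classic by [].
have mI2 : measurable `[- T - eta *+ 2, - T + eta *+ 2]%classic by [].
apply: le_trans etaM.
apply: (@le_trans _ _ (fine (nu `[T - eta *+ 2, T + eta *+ 2]%classic) +
                       fine (nu `[- T - eta *+ 2, - T + eta *+ 2]%classic))).
  rewrite -lee_fin EFinD !nu_fineK//; last exact: measurable_band.
  apply: le_trans (measureU2 _ mI1 mI2).
  apply: le_measure; rewrite ?inE//; [exact: measurable_band|exact: measurableU|].
  move=> x /= /andP[]; rewrite !in_itv/=.
  have [x0|x0] := ger0P x => h1 h2.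
    by left; rewrite h1.
  by right; apply/andP; lra.
have -> : eta * (M * 8) = M * ((T + eta *+ 2) - (T - eta *+ 2)) +
    M * ((- T + eta *+ 2) - (- T - eta *+ 2)) by rewrite !mulr2n; ring.
apply: lerD; apply: nuM.
- lra.
- by move=> x /=; rewrite !in_itv/= => /andP[? ?]; right; lra.
- lra.
- by move=> x /=; rewrite !in_itv/= => /andP[? ?]; left; lra.
Qed.

End density_near_threshold.

(** * The Bayes oracle *)

Section oracle.
Context (R : realType) (sigma : R) (nu : probability R R) (n : nat).
Hypotheses (sigma0 : 0 < sigma) (n0 : (0 < n)%N).

Let N0 : 0 < n%:R :> R. Proof. by rewrite ltr0n. Qed.

(** The likelihood ratio at the sample mean [a] of effect [x] against effect 0. Its integral
    [tilt_mass] is the mixture likelihood ratio, which the oracle equation sets equal to the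
    odds. *)
Definition tilt (a x : R) : R :=
  expR (n%:R * (a * (x / sigma ^+ 2) - x ^+ 2 / (2 * sigma ^+ 2))).

Lemma tiltE a x : tilt a x = expR (n%:R * a ^+ 2 / (2 * sigma ^+ 2)) *
  expR (- (n%:R * (x - a) ^+ 2 / (2 * sigma ^+ 2))).
Proof. by rewrite -expRD /tilt; congr expR; field; rewrite gt_eqF. Qed.

Lemma tilt_ge0 a x : 0 <= tilt a x. Proof. exact: expR_ge0. Qed.

Lemma tilt_le a x : tilt a x <= expR (n%:R * a ^+ 2 / (2 * sigma ^+ 2)).
Proof.
rewrite tiltE ler_piMr ?expR_ge0// -expR0 ler_expR oppr_le0.
by rewrite divr_ge0// mulr_ge0// ?sqr_ge0// exprn_ge0// ltW.
Qed.

Lemma measurable_tilt a : measurable_fun setT (tilt a).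
Proof.
apply: measurableT_comp => //; apply: measurable_funM => //; apply: measurable_funB.
  by apply: measurable_funM => //; apply: measurable_funM.
by apply: measurable_funM => //; exact: measurable_funX.
Qed.

Lemma continuous_tilt x : continuous (tilt ^~ x).
Proof.
move=> a; apply: (cvg_comp _ (@expR R)); last exact: continuous_expR.
apply: cvgM; first exact: cvg_cst.
apply: cvgB; last exact: cvg_cst.
by apply: cvgM; [exact: cvg_id|exact: cvg_cst].
Qed.

Definition tilt_mass (a : R) : R := fine (\int[nu]_x (tilt a x)%:E).

Lemma tilt_massE a : (tilt_mass a)%:E = (\int[nu]_x (tilt a x)%:E)%E.
Proof.
rewrite fineK// ge0_fin_numE; last by apply: integral_ge0 => x _; rewrite lee_fin tilt_ge0.
apply: le_lt_trans (ge0_le_integral_sup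
  (g := fun=> (expR (n%:R * a ^+ 2 / (2 * sigma ^+ 2)))%:E) _ _ _) _.
- by move=> x; rewrite lee_fin tilt_ge0.
- by move=> x; rewrite lee_fin tilt_le.
- by rewrite integral_cst//= (_ : nu setT = 1%E) ?mule1 ?ltry//; exact: probability_setT.
Qed.

Lemma tilt_mass_le a : tilt_mass a <= expR (n%:R * a ^+ 2 / (2 * sigma ^+ 2)).
Proof.
rewrite -lee_fin tilt_massE.
apply: le_trans (ge0_le_integral_sup
  (g := fun=> (expR (n%:R * a ^+ 2 / (2 * sigma ^+ 2)))%:E) _ _ _) _.
- by move=> x; rewrite lee_fin tilt_ge0.
- by move=> x; rewrite lee_fin tilt_le.
- by rewrite integral_cst//= (_ : nu setT = 1%E) ?mule1//; exact: probability_setT.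
Qed.

Lemma continuous_tilt_mass : continuous tilt_mass.
Proof.
move=> a.
have aI : a \in `]a - 1, a + 1[%classic by rewrite inE /= in_itv/=; lra.
pose c : R := expR (n%:R * (`|a| + 1) ^+ 2 / (2 * sigma ^+ 2)).
have tc x y : `]a - 1, a + 1[%classic x -> tilt x y <= c.
  rewrite /= in_itv/= => xa; apply: le_trans (tilt_le _ _) _; rewrite /c ler_expR.
  rewrite ler_pM2r ?invr_gt0 ?mulr_gt0 ?exprn_gt0// ler_pM2l//.
  rewrite -[leLHS]real_normK ?num_real// ler_sqr ?nnegrE ?addr_ge0//.
  rewrite -[X in `|X|](subrK a) addrC (le_trans (ler_normD _ _))// lerD2l.
  by rewrite ler_norml; lra.
have ic : nu.-integrable setT (EFin \o cst c).
  apply/integrableP; split; first exact/measurable_EFinP.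
  rewrite /= -[X in (X < _)%E]/(\int[nu]_x (cst `|c|%:E x))%E integral_cst//.
  by rewrite /= (_ : nu setT = 1%E) ?mule1 ?ltry//; exact: probability_setT.
apply: (continuity_under_integral measurableT _ _ ic _ aI).
- move=> x xI; apply: le_integrable ic => //.
    by apply/measurable_EFinP; exact: measurable_tilt.
  move=> y _ /=; rewrite lee_fin !ger0_norm ?tilt_ge0 ?expR_ge0//; exact: tc.
- by apply: aeW => y _ x _; exact: continuous_tilt.
- by move=> x xI; apply: aeW => y _; rewrite ger0_norm ?tilt_ge0//; exact: tc.
Qed.

Lemma oracle_equationE (p delta0 deltaA a : R) : 0 < p -> 0 < deltaA ->
  oracle_equation n sigma p delta0 deltaA nu a <->
  delta0 / deltaA * ((1 - p) / p) = tilt_mass a.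
Proof.
move=> p0 dA0; rewrite /oracle_equation -/(tilt a).
have -> : (\int[nu]_x (expR (n%:R * (a * (x / sigma ^+ 2) - x ^+ 2 / (2 * sigma ^+ 2))))%:E =
  (tilt_mass a)%:E)%E by rewrite tilt_massE.
rewrite -EFinM; split => [[eq1]|<-].
  have -> : delta0 / deltaA * ((1 - p) / p) = (1 - p) * delta0 / (p * deltaA).
    by field; rewrite !gt_eqF.
  by rewrite eq1 mulrC mulKf// gt_eqF// mulr_gt0.
by congr EFin; field; rewrite !gt_eqF.
Qed.

Variables (T eta : R).
Hypotheses (eta0 : 0 < eta) (etaT : eta < T / 2).

Let T0 : 0 < T. Proof. by move: eta0 etaT; lra. Qed.
Let eta_lt : eta < T. Proof. by move: eta0 etaT; lra. Qed.

Local Notation right_mass s := (fine (nu [set x | T <= s * x <= T + eta])).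

(* [s = 1] handles the right end point of the acceptance interval, [s = -1] the
   left one. *)
Lemma tilt_mass_ge (s b : R) : s = 1 \/ s = -1 -> T + eta <= b ->
  right_mass s * expR (n%:R * (T ^+ 2 / 2 + eta * T) / sigma ^+ 2) <= tilt_mass (s * b).
Proof.
move=> s1 bT; have mA : measurable [set x : R | T <= s * x <= T + eta].
  rewrite (_ : mkset _ = ( *%R s) @^-1` `[T, T + eta]%classic).
    have ms : measurable_fun setT (fun x : R => s * x) by exact: measurable_funM.
    exact: measurable_preimage.
  by apply/seteqP; split => x /=; rewrite in_itv.
rewrite -lee_fin tilt_massE mulrC EFinM nu_fineK//.
set E := expR _.
have -> : (E%:E * nu [set x : R | (T <= s * x <= T + eta)%R] =
    \int[nu]_(x in [set x : R | (T <= s * x <= T + eta)%R]) (cst E%:E x))%E.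
  by rewrite integral_cst.
rewrite integral_mkcond; apply: ge0_le_integral_sup => x.
  by rewrite /patch; case: ifP => // _; rewrite lee_fin expR_ge0.
rewrite /patch; case: ifPn => [|_]; last by rewrite lee_fin tilt_ge0.
rewrite inE /= => sx; rewrite lee_fin /E ler_expR -mulrA ler_pM2l//.
have ss : s ^+ 2 = 1 by case: s1 => ->; rewrite ?sqrrN expr1n.
have -> : s * b * (x / sigma ^+ 2) - x ^+ 2 / (2 * sigma ^+ 2) =
    (b * (s * x) - (s * x) ^+ 2 / 2) / sigma ^+ 2.
  by rewrite exprMn ss mul1r; field; rewrite gt_eqF.
rewrite ler_pM2r ?invr_gt0 ?exprn_gt0//.
move: (s * x) sx => y /andP[yT yeta].
(* The exponent b y - y^2 / 2 is smallest at b = T + eta and then, increasing in y on [T, T + eta],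
   at y = T. *)
have h1 : 0 <= (b - T - eta) * y.
  by apply: mulr_ge0; [lra|exact: le_trans (ltW T0) yT].
have h2 : 0 <= (y - T) * (T + eta - y) by apply: mulr_ge0; move: eta0; lra.
have h3 := sqr_ge0 (y - T); nra.
Qed.

Lemma measurable_dist_lt (a : R) : measurable [set x : R | `|x - a| < eta].
Proof.
rewrite (_ : mkset _ = (fun x => `|x - a|) @^-1` `]-oo, eta[%classic).
  have ms : measurable_fun setT (fun x : R => `|x - a|).
    apply: measurableT_comp; first exact: normr_measurable.
    exact: measurable_funB.
  exact: measurable_preimage.
by apply/seteqP; split => x /=; rewrite in_itv.
Qed.

(** The tail is at most expR (- n a^2 / (2 sigma^2)), which cancels the factor in front of [tiltE].
    What remains is a Gaussian in x - a, at most 1 within eta of [a] and exponentially small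
    elsewhere. At a solution of the oracle equation [tilt_mass a] is the odds. *)
Lemma odds_tail_le (a : R) :
  tilt_mass a * normal_tail (Num.sqrt n%:R * `|a| / sigma) <=
  fine (nu [set x | `|x - a| < eta]) + expR (- (n%:R * eta ^+ 2 / (2 * sigma ^+ 2))).
Proof.
have mA := measurable_dist_lt a.
have y0 : 0 <= Num.sqrt n%:R * `|a| / sigma.
  by rewrite divr_ge0 ?(ltW sigma0)// mulr_ge0.
have h1 := normal_tail_le y0.
set t := expR _.
have h2 : tilt_mass a <= expR (n%:R * a ^+ 2 / (2 * sigma ^+ 2)) *
    (fine (nu [set x | `|x - a| < eta]) + t).
  rewrite -lee_fin tilt_massE; set E := expR _; rewrite mulrDr.
  apply: (@le_trans _ _ (\int[nu]_x (E * \1_[set x | `|x - a| < eta] x + E * t)%:E)%E); last first.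
    apply: le_integral_add => //.
    - by apply: measurable_funM => //; exact: measurable_indic.
    - by move=> x; rewrite mulr_ge0 ?expR_ge0.
    - by move=> x; rewrite mulr_ge0 ?expR_ge0.
    - apply: le_integral_scale; rewrite ?expR_ge0//.
      by rewrite integral_indic// setIT nu_fineK.
    - by rewrite (integral_cst _ measurableT) [X in (_ * X)%E](@probability_setT _ _ R nu) mule1.
  apply: ge0_le_integral_sup => x; first by rewrite lee_fin tilt_ge0.
  rewrite lee_fin -mulrDr tiltE ler_pM2l ?expR_gt0//.
  have [xa|xa] := ltP `|x - a| eta.
    rewrite indic_mem//; apply: (@le_trans _ _ 1); last by rewrite lerDl expR_ge0.
    rewrite -expR0 ler_expR oppr_le0.
    by rewrite divr_ge0// mulr_ge0// ?sqr_ge0// exprn_ge0// ltW.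
  rewrite -[leLHS]add0r lerD// /t ler_expR lerN2.
  rewrite ler_pM2r ?invr_gt0 ?mulr_gt0 ?exprn_gt0// ler_pM2l//.
  by rewrite -[leRHS]real_normK ?num_real// ler_sqr ?nnegrE ?(ltW eta0).
have h3 : expR (- (Num.sqrt n%:R * `|a| / sigma) ^+ 2 / 2) =
    (expR (n%:R * a ^+ 2 / (2 * sigma ^+ 2)))^-1.
  rewrite -expRN; congr expR.
  rewrite !exprMn exprVn sqr_sqrtr// real_normK ?num_real//.
  by field; rewrite gt_eqF.
apply: (@le_trans _ _ (tilt_mass a * expR (- (Num.sqrt n%:R * `|a| / sigma) ^+ 2 / 2))).
  by rewrite ler_wpM2l// fine_ge0// integral_ge0// => x _; rewrite lee_fin tilt_ge0.
by rewrite h3 ler_pdivrMr ?expR_gt0// mulrC.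
Qed.

Variables (p delta0 deltaA : R).
Hypotheses (p01 : 0 < p < 1) (deltaA0 : 0 < deltaA).
Let odds := delta0 / deltaA * ((1 - p) / p).
Hypotheses (odds_lb : expR (n%:R * (T - eta) ^+ 2 / (2 * sigma ^+ 2)) < odds)
  (odds_ub : forall s : R, s = 1 \/ s = -1 ->
    odds < right_mass s * expR (n%:R * (T ^+ 2 / 2 + eta * T) / sigma ^+ 2)).

(** Up to T - eta the universal bound on the tilt mass stays below [odds_lb]; from T + eta on, the
    [nu]-mass just beyond T pushes it above [odds_ub]. *)
Lemma oracle_solution_bounds (s b : R) : s = 1 \/ s = -1 -> 0 < b ->
  odds = tilt_mass (s * b) -> T - eta < b < T + eta.
Proof.
move=> s1 b0 ob; apply/andP; split; rewrite ltNge; apply/negP => bT.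
  have := lt_le_trans odds_lb (_ : odds <= _); rewrite ob => /(_ _ (tilt_mass_le _)).
  have ss : s ^+ 2 = 1 by case: s1 => ->; rewrite ?sqrrN expr1n.
  rewrite exprMn ss mul1r ltr_expR ltr_pM2r ?invr_gt0 ?mulr_gt0 ?exprn_gt0// ltr_pM2l//.
  by rewrite ltNge ler_sqr ?nnegrE ?(ltW b0)// ?bT// subr_ge0 (ltW eta_lt).
by have := lt_le_trans (odds_ub s1) (tilt_mass_ge s1 bT); rewrite -ob ltxx.
Qed.

Lemma oracle_solution_exists (s : R) : s = 1 \/ s = -1 ->
  exists2 b, 0 < b & odds = tilt_mass (s * b).
Proof.
move=> s1.
have odds1 : 1 < odds.
  apply: le_lt_trans odds_lb; rewrite -expR0 ler_expR.
  by rewrite divr_ge0// mulr_ge0// ?sqr_ge0// exprn_ge0// ltW.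
have g0 : tilt_mass (s * 0) < odds.
  by apply: le_lt_trans (tilt_mass_le _) _; rewrite mulr0 expr0n/= mulr0 mul0r expR0.
have g1 : odds < tilt_mass (s * (T + eta)).
  exact: lt_le_trans (odds_ub s1) (tilt_mass_ge s1 (lexx _)).
have [|||b bI bE] := @IVT _ (fun b => tilt_mass (s * b)) 0 (T + eta) odds.
- by rewrite ltW// addr_gt0.
- apply: continuous_subspaceT => b; apply: (@continuous_comp _ _ _ ( *%R s) tilt_mass).
    exact: mulrl_continuous.
  exact: continuous_tilt_mass.
- by rewrite ge_min le_max (ltW g0) (ltW g1)/= orbT.
exists b => //; rewrite lt_neqAle; move: bI; rewrite in_itv/= => /andP[-> _]; rewrite andbT.
by apply/eqP => b0; move: g0; rewrite b0 bE ltxx.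
Qed.

Lemma oracle_solutions : exists a b : R, [/\ a < 0, 0 < b,
  oracle_equation n sigma p delta0 deltaA nu a &
  oracle_equation n sigma p delta0 deltaA nu b].
Proof.
have [p0 _] := andP p01.
have [|a a0 aE] := @oracle_solution_exists (-1); first by right.
have [|b b0 bE] := @oracle_solution_exists 1; first by left.
exists (- a), b; split; rewrite ?oppr_lt0//; apply/oracle_equationE => //.
  by rewrite -[- a]mulN1r -aE.
by rewrite -[b in RHS]mul1r -bE.
Qed.

Lemma oracle_equation_bounds a : oracle_equation n sigma p delta0 deltaA nu a ->
  [/\ 0 < a -> T - eta < a < T + eta, a < 0 -> T - eta < - a < T + eta &
    odds * normal_tail (Num.sqrt n%:R * `|a| / sigma) <=
    fine (nu (band T (eta *+ 2))) + expR (- (n%:R * eta ^+ 2 / (2 * sigma ^+ 2)))].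
Proof.
have [p0 _] := andP p01.
move=> /(oracle_equationE _ _ p0 deltaA0) aE.
have pos : 0 < a -> T - eta < a < T + eta.
  by move=> a0; apply: (@oracle_solution_bounds 1); rewrite ?mul1r//; left.
have neg : a < 0 -> T - eta < - a < T + eta.
  move=> a0; apply: (@oracle_solution_bounds (-1)); rewrite ?oppr_gt0 ?mulrNN ?mul1r//; by right.
split => //.
rewrite /odds aE; apply: le_trans (odds_tail_le _) _.
rewrite lerD2r; apply: le_fine_nu; [exact: measurable_dist_lt|exact: measurable_band|].
move=> x /=; rewrite ltr_distl /band /= mulr2n.
have [a0|a0|a0] := ltgtP a 0.
- by have /andP[? ?] := neg a0 => /andP[? ?]; rewrite ltr0_norm; move: eta0 etaT; lra.
- by have /andP[? ?] := pos a0 => /andP[? ?]; rewrite gtr0_norm; move: eta0 etaT; lra.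
(* The remaining case a = 0 is impossible: the tilt mass there is at most 1, while the odds exceed
   1. *)
have := odds_lb; rewrite /odds aE a0 => /lt_le_trans/(_ (tilt_mass_le _)).
rewrite expr0n/= mulr0 mul0r ltr_expR ltNge.
by rewrite divr_ge0// mulr_ge0// ?sqr_ge0// exprn_ge0// ltW.
Qed.

(** Every pair of solutions of opposite signs lies within eta of - T and T, so the bound holds for
    whichever pair witnesses the acceptance. *)
Lemma oracle_acceptance_lt x :
  oracle_acceptance n sigma p delta0 deltaA nu x -> `|x| < T + eta.
Proof.
move=> [a [b [a0 b0 /oracle_equation_bounds[_ aT _] /oracle_equation_bounds[bT _ _]]]].
by rewrite ltr_norml; have := aT a0; have := bT b0; move: eta0; lra.
Qed.

Lemma oracle_acceptance_ge x :
  ~ oracle_acceptance n sigma p delta0 deltaA nu x -> T - eta <= `|x|.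
Proof.
move=> xA; rewrite leNgt; apply/negP => xT; apply: xA.
have [a [b [a0 b0 aE bE]]] := oracle_solutions; exists a, b; split => //.
have [_ aT _] := oracle_equation_bounds aE; have [bT _ _] := oracle_equation_bounds bE.
by move: xT; rewrite ltr_norml; have := aT a0; have := bT b0; move: eta0; lra.
Qed.

End oracle.

(** * Limits *)

Section null_excess_bound.
Context (R : realType).

Lemma chernoff_rate (alpha h : R) : 0 < alpha -> alpha < h ->
  exists2 lam : R, 0 < lam & 0 < lam * h - alpha * (expR lam - 1).
Proof.
move=> a0 ah; have ha : 1 < h / alpha by rewrite ltr_pdivlMr// mul1r.
have ha0 : 0 < h / alpha by exact: lt_trans ha.
(* The rate has slope h - alpha > 0 at lam = 0. This explicit point works because expR lam - 1 <=
   lam expR lam and expR lam, the square root of h / alpha, is below h / alpha. *)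
pose lam := ln (h / alpha) / 2.
have lam0 : 0 < lam by rewrite divr_gt0// ln_gt0.
have e2 : expR lam * expR lam = h / alpha.
  by rewrite -expRD /lam -splitr lnK.
have e1 : 1 < expR lam by rewrite -expR0 ltr_expR.
have ealpha : alpha * expR lam < h.
  have : expR lam < h / alpha by rewrite -e2 ltr_pMr// expR_gt0.
  by rewrite ltr_pdivlMr// mulrC.
have elam : expR lam - 1 <= lam * expR lam.
  have := expR_ge1Dx (- lam); rewrite expRN => h1.
  have e0 := expR_gt0 lam.
  have : (1 - lam) * expR lam <= 1 by rewrite -ler_pdivlMr// mul1r.
  by rewrite mulrBl mul1r; lra.
exists lam => //; rewrite subr_gt0.
apply: (@le_lt_trans _ _ (lam * (alpha * expR lam))); last by rewrite ltr_pM2l.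
by rewrite mulrCA ler_pM2l.
Qed.

(** Half of the exponent absorbs the factor k, since k expR (- r k / 2) <= 2 / r; the other half
    sums as a geometric series, independently of [m]. *)
Lemma null_excess_bounded (alpha lam h : R) : 0 < lam * h - alpha * (expR lam - 1) ->
  exists2 K : R, 0 <= K & forall m, null_excess m alpha lam h <= K.
Proof.
rewrite /null_excess; set r := _ - _ => r0.
pose q := expR (- (r / 2)).
have q1 : q < 1 by rewrite /q -expR0 ltr_expR oppr_lt0 divr_gt0.
have q0 : 0 < q by exact: expR_gt0.
exists (2 / r * (1 - q)^-1) => [|m].
  by rewrite mulr_ge0// ?divr_ge0 ?(ltW r0)// invr_ge0 subr_ge0 ltW.
have geo : \sum_(k < m) q ^+ k.+1 <= (1 - q)^-1.
  have : \sum_(k < m) q ^+ k.+1 + q ^+ m * (1 - q)^-1 <= (1 - q)^-1.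
    have q1' : 0 < 1 - q by rewrite subr_gt0.
    elim: m => [|m IH]; first by rewrite big_ord0 add0r expr0 mul1r.
    rewrite big_ord_recr/= (le_trans _ IH)// -addrA lerD2l exprS.
    rewrite ler_pdivlMr// mulrDl divfK ?gt_eqF//.
    have : 0 <= q ^+ m * (1 - q) ^+ 2 by rewrite mulr_ge0 ?sqr_ge0// exprn_ge0// ltW.
    by move: (q ^+ m) => z; nra.
  by apply: le_trans; rewrite lerDl mulr_ge0 ?exprn_ge0 ?(ltW q0)// invr_ge0 subr_ge0 ltW.
apply: le_trans (ler_wpM2l _ geo); last by rewrite divr_ge0// ltW.
rewrite mulr_sumr; apply: ler_sum => k _.
have -> : expR (- r * k.+1%:R) = q ^+ k.+1 * q ^+ k.+1.
  by rewrite -exprMn -expRD -expRM_natr; congr expR; field.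
rewrite mulrA ler_wpM2r ?exprn_ge0 ?(ltW q0)//.
have -> : q ^+ k.+1 = (expR (r / 2 * k.+1%:R))^-1.
  by rewrite -expRN -mulNr expRM_natr.
rewrite ler_pdivrMr ?expR_gt0// -ler_pdivrMl ?divr_gt0// invf_div mulrC.
by apply: le_trans (expR_ge1Dx _); rewrite lerDr.
Qed.

End null_excess_bound.

Section limits.
Context (R : realType) (sigma : R) (nu : probability R R)
  (n : nat -> nat) (p delta : nat -> R) (C beta : R).
Hypotheses (sigma0 : 0 < sigma)
  (p01 : forall m, (2 <= m)%N -> 0 < p m < 1)
  (delta_gt0 : forall m, (2 <= m)%N -> 0 < delta m)
  (HA : assumption_A n p delta C) (HC : assumption_C sigma nu C)
  (beta01 : 0 < beta <= 1)
  (pE : forall m, (2 <= m)%N -> p m = m%:R `^ (- beta))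
  (nlog : propto (fun m => (n m)%:R) (fun m => ln m%:R : R))
  (ln_delta : (fun m => ln (delta m) : R^o) =o_\oo (fun m => ln m%:R : R^o)).

Local Notation odds m := (delta m * ((1 - p m) / p m)).
Local Notation N m := ((n m)%:R : R).
Let T : R := sigma * Num.sqrt C.

Lemma limit_constant_gt0 : 0 < C.
Proof.
have [k [k0 _ Ck]] := growth_constant p01 delta_gt0 beta01 pE ln_delta nlog HA.
have : 0 < C * k by rewrite Ck mulr_gt0//; case/andP: beta01.
by rewrite pmulr_lgt0.
Qed.

Let C0 := limit_constant_gt0.
Let T0 : 0 < T. Proof. exact: threshold_gt0. Qed.

Lemma sparsityE m : (2 <= m)%N -> p m = expR (- (beta * ln m%:R)).
Proof.
move=> m2; rewrite -mulNr -(ln_sparsity pE)// lnK// posrE.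
by case/andP: (p01 m2).
Qed.

(** Here [beta <= 1] enters, as m p = m^(1 - beta). Bounded additive terms thus become O(m p). *)
Lemma mp_ge1 m : (2 <= m)%N -> 1 <= m%:R * p m.
Proof.
move=> m2; have m0 : 0 < m%:R :> R by rewrite ltr0n (leq_trans _ m2).
rewrite sparsityE// -[X in X * _](@lnK R) ?posrE// -expRD -[leLHS]expR0 ler_expR.
rewrite -[X in X + _]mul1r -mulrBl mulr_ge0//.
  by rewrite subr_ge0; case/andP: beta01.
by rewrite ln_ge0// ler1n (leq_trans _ m2).
Qed.

(* The threshold T is where the Gaussian exponent [n T^2 / (2 sigma^2)] grows
   like [beta * ln m]. *)
Lemma threshold_exponent (x y z : R) (f : nat -> R) :
  (forall m, f m = x * (beta * ln m%:R) + y * (N m / (2 * sigma ^+ 2)) + z * ln (odds m)) ->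
  0 < (x + z) * T ^+ 2 + y ->
  f m @[m --> \oo] --> +oo.
Proof.
move=> fE pos.
have [k [k0 nk Ck]] := growth_constant p01 delta_gt0 beta01 pE ln_delta nlog HA.
have bE : beta = k * T ^+ 2 / (2 * sigma ^+ 2).
  rewrite /T exprMn sqr_sqrtr ?(ltW C0)//.
  have -> : beta = C * k / 2 by rewrite Ck mulrAC divff// mul1r.
  by field; rewrite gt_eqF.
have := @exponent_cvgy R n p delta beta p01 delta_gt0 beta01 pE ln_delta k
  (x * beta) (y / (2 * sigma ^+ 2)) z nk.
have -> : x * beta + y / (2 * sigma ^+ 2) * k + z * beta =
    ((x + z) * T ^+ 2 + y) * (k / (2 * sigma ^+ 2)).
  rewrite bE; field; by rewrite gt_eqF.
rewrite mulr_gt0 ?divr_gt0 ?mulr_gt0 ?exprn_gt0// => /(_ isT).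
apply: cvg_trans; apply: near_eq_cvg; apply: nearW => m.
by rewrite fE mulrA; congr (_ + _ + _); rewrite mulrAC mulrA.
Qed.

Variable eta : R.
Hypotheses (eta0 : 0 < eta) (etaT : eta < T).

Lemma gauss_eta_cvg0 :
  expR (- (N m * eta ^+ 2 / (2 * sigma ^+ 2))) @[m --> \oo] --> (0 : R).
Proof.
apply: expR_cvg0; apply: (@threshold_exponent 0 (eta ^+ 2) 0).
  by move=> m; rewrite !mul0r add0r addr0 mulrA (mulrC (eta ^+ 2)).
by rewrite addr0 mul0r add0r exprn_gt0.
Qed.

Lemma normal_tail_eta_cvg0 :
  normal_tail (Num.sqrt (N m) * eta / sigma) @[m --> \oo] --> (0 : R).
Proof.
apply: (squeeze_cvgr _ (@cvg_cst _ _ _ _ _) gauss_eta_cvg0); apply: nearW => m.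
rewrite normal_tail_ge0/=; apply: le_trans (normal_tail_le _) _.
  by rewrite divr_ge0 ?(ltW sigma0)// mulr_ge0// ltW.
rewrite le_eqVlt; apply/orP; left; apply/eqP; congr expR.
rewrite -[in RHS](@sqr_sqrtr _ (N m))//; field; by rewrite gt_eqF.
Qed.

Lemma sparsity_over_tail_cvg0 :
  p m / normal_tail (Num.sqrt (N m) * (T - eta) / sigma) @[m --> \oo] --> (0 : R).
Proof.
have Te : 0 < T - eta by rewrite subr_gt0.
have ecvg : (normal_peak (1 : R))^-1 * expR (T / (2 * eta)) *
   expR (- (beta * ln m%:R - N m * (T * (T - eta)) / (2 * sigma ^+ 2))) @[m --> \oo] --> (0 : R).
  rewrite -[X in _ --> X](mulr0 ((normal_peak (1 : R))^-1 * expR (T / (2 * eta)))).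
  apply: cvgM; first exact: cvg_cst.
  apply: expR_cvg0; apply: (@threshold_exponent 1 (- (T * (T - eta))) 0).
    by move=> m; rewrite mul1r mul0r addr0 mulNr (mulrC (T * (T - eta))) mulrAC.
  have -> : (1 + 0) * T ^+ 2 - T * (T - eta) = T * eta by ring.
  exact: mulr_gt0.
apply: (squeeze_cvgr _ (@cvg_cst _ _ _ _ _) ecvg).
near=> m; have m2 : (2 <= m)%N by near: m; exact: nbhs_infty_ge.
have [pm0 _] := andP (p01 m2).
set z := Num.sqrt (N m) * (T - eta) / sigma.
have z0 : 0 <= z by rewrite divr_ge0 ?(ltW sigma0)// mulr_ge0// ltW.
have peak0 : 0 < normal_peak (1 : R) by rewrite normal_peak_gt0// oner_eq0.
have peakV0 : 0 < (normal_peak (1 : R))^-1 by rewrite invr_gt0.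
have lb0 : 0 < normal_peak 1 * expR (- (z + 1) ^+ 2 / 2) by rewrite mulr_gt0// expR_gt0.
have tz := normal_tail_lb z0.
rewrite divr_ge0 ?normal_tail_ge0 ?(ltW pm0)//=.
apply: (@le_trans _ _ (p m / (normal_peak 1 * expR (- (z + 1) ^+ 2 / 2)))).
  by rewrite ler_wpM2l ?(ltW pm0)// lef_pV2 ?posrE// (lt_le_trans lb0).
rewrite invfM -expRN mulrCA -[leRHS]mulrA ler_pM2l//.
rewrite sparsityE// -!expRD ler_expR.
(* The cross term of (z + 1)^2 is split by completing a square, which inflates z^2 by T / (T - eta).
   The exponent becomes T (T - eta) instead of (T - eta)^2, still below the critical T^2. *)
have zz : (z + 1) ^+ 2 / 2 <= N m * (T * (T - eta)) / (2 * sigma ^+ 2) + T / (2 * eta).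
  have -> : N m * (T * (T - eta)) / (2 * sigma ^+ 2) = z ^+ 2 * T / (2 * (T - eta)).
    rewrite /z -[in LHS](@sqr_sqrtr _ (N m))//; field.
    by rewrite !gt_eqF.
  rewrite -subr_ge0.
  have -> : z ^+ 2 * T / (2 * (T - eta)) + T / (2 * eta) - (z + 1) ^+ 2 / 2 =
      (eta * z - (T - eta)) ^+ 2 / (2 * eta * (T - eta)).
    by field; rewrite !gt_eqF.
  by rewrite divr_ge0 ?sqr_ge0// mulr_ge0 ?mulr_ge0 ?(ltW eta0) ?(ltW Te).
by move: zz; rewrite mulNr opprK; lra.
Unshelve. all: by end_near. Qed.

(** In p expR (n (T^2 / 2 + eta T) / sigma^2) the sparsity cancels the T^2 part to leading order,
    and the surplus eta T n / sigma^2 diverges. So many signals just beyond T are expected below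
    each relevant level. *)
Lemma right_signal_cvg0 (c : R) : 0 < c ->
  2 * expR (- (p m * fine (nu `[T, (T + eta)%R]%classic) *
    expR (N m * (T ^+ 2 / 2 + eta * T) / sigma ^+ 2) * c)) @[m --> \oo] --> (0 : R).
Proof.
move=> c0; rewrite -[X in _ --> X](mulr0 2); apply: cvgM; first exact: cvg_cst.
apply: expR_cvg0; apply/cvgryPge => A.
have nu0 : 0 < fine (nu `[T, (T + eta)%R]%classic).
  have := nu_right_threshold_gt0 HC (or_introl (erefl 1)) eta0.
  rewrite (_ : mkset _ = `[T, T + eta]%classic)//.
  by apply/seteqP; split => x /=; rewrite in_itv/= mul1r.
set v := fine _ in nu0 *.
have ey : - (beta * ln m%:R) + N m * (T ^+ 2 / 2 + eta * T) / sigma ^+ 2 @[m --> \oo] --> +oo.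
  apply: (@threshold_exponent (- 1) (T ^+ 2 + 2 * eta * T) 0).
    by move=> m; rewrite mulN1r mul0r addr0; congr (_ + _); field; rewrite gt_eqF.
  have -> : (- 1 + 0) * T ^+ 2 + (T ^+ 2 + 2 * eta * T) = 2 * eta * T by ring.
  by apply: mulr_gt0 => //; exact: mulr_gt0.
move/cvgryPge: ey => /(_ (A / (v * c))) eA; near=> m.
have m2 : (2 <= m)%N by near: m; exact: nbhs_infty_ge.
have eAm : A / (v * c) <= - (beta * ln m%:R) + N m * (T ^+ 2 / 2 + eta * T) / sigma ^+ 2.
  by near: m.
rewrite sparsityE//; move: eAm; set a := - _; set b := N m * _ / _ => eAm.
have -> : expR a * v * expR b * c = expR (a + b) * (v * c) by rewrite expRD; ring.
rewrite -ler_pdivrMr ?mulr_gt0//; apply: le_trans eAm _.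
by have := expR_ge1Dx (a + b); lra.
Unshelve. all: by end_near. Qed.

(** After taking logarithms both gaps are positive multiples of ln m to leading order, and the
    second one absorbs the constant ln (v s). *)
Lemma oracle_odds_bounds : \forall m \near \oo,
  expR (N m * (T - eta) ^+ 2 / (2 * sigma ^+ 2)) < odds m /\
  forall s : R, s = 1 \/ s = -1 ->
    odds m < fine (nu [set x | T <= s * x <= T + eta]) *
      expR (N m * (T ^+ 2 / 2 + eta * T) / sigma ^+ 2).
Proof.
have odds0 m : (2 <= m)%N -> 0 < odds m.
  move=> m2; have [? ?] := andP (p01 m2).
  by rewrite mulr_gt0 ?delta_gt0// divr_gt0// subr_gt0.
have low : ln (odds m) - N m * (T - eta) ^+ 2 / (2 * sigma ^+ 2) @[m --> \oo] --> +oo.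
  apply: (@threshold_exponent 0 (- (T - eta) ^+ 2) 1).
    by move=> m; rewrite mul0r add0r mul1r addrC mulNr (mulrC (_ ^+ 2)) mulrAC.
  have -> : (0 + 1) * T ^+ 2 - (T - eta) ^+ 2 = eta * (T + (T - eta)) by ring.
  by rewrite mulr_gt0// addr_gt0// subr_gt0.
have upp : N m * (T ^+ 2 / 2 + eta * T) / sigma ^+ 2 - ln (odds m) @[m --> \oo] --> +oo.
  apply: (@threshold_exponent 0 (T ^+ 2 + 2 * eta * T) (- 1)).
    by move=> m; rewrite mul0r add0r mulN1r; congr (_ + _); field; rewrite gt_eqF.
  have -> : (0 - 1) * T ^+ 2 + (T ^+ 2 + 2 * eta * T) = 2 * eta * T by ring.
  by apply: mulr_gt0 => //; exact: mulr_gt0.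
pose v (s : R) := fine (nu [set x | T <= s * x <= T + eta]).
have v0 s : s = 1 \/ s = -1 -> 0 < v s.
  by move=> s1; exact: (nu_right_threshold_gt0 HC).
have uppv s : s = 1 \/ s = -1 -> \forall m \near \oo,
    odds m < v s * expR (N m * (T ^+ 2 / 2 + eta * T) / sigma ^+ 2).
  move=> s1; near=> m.
  have m2 : (2 <= m)%N by near: m; exact: nbhs_infty_ge.
  have : - ln (v s) < N m * (T ^+ 2 / 2 + eta * T) / sigma ^+ 2 - ln (odds m).
    by near: m; move/cvgryPgt : upp; exact.
  move=> h; rewrite -[X in X < _](@lnK R) ?posrE ?odds0//.
  rewrite -[v s](@lnK R) ?posrE ?v0// -expRD ltr_expR.
  by move: h; lra.
near=> m; have m2 : (2 <= m)%N by near: m; exact: nbhs_infty_ge.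
split.
  rewrite -[X in _ < X](@lnK R) ?posrE ?odds0// ltr_expR -subr_gt0.
  by near: m; move/cvgryPgt : low; exact.
move=> s [] ->.
  by near: m; apply: uppv; left.
by near: m; apply: uppv; right.
Unshelve. all: by end_near. Qed.

End limits.

(** * Normalized risks *)

Section risk_bounds.
Context (R : realType) (d : measure_display) (Omega : measurableType d)
  (P : probability Omega R) (m n : nat) (sigma p : R) (nu : probability R R)
  (mu : 'I_m -> {RV P >-> R}) (X : 'I_n -> 'I_m -> {RV P >-> R})
  (delta0 deltaA : R).
Hypotheses (sigma0 : 0 < sigma) (m2 : (2 <= m)%N) (n0 : (0 < n)%N) (p01 : 0 < p < 1)
  (nu0 : nu [set 0] = 0%E)
  (model : two_groups_model sigma p nu mu X)
  (delta00 : 0 < delta0) (deltaA0 : 0 < deltaA) (mp1 : 1 <= m%:R * p).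

Let mp0 : 0 < m%:R * p. Proof. exact: lt_le_trans mp1. Qed.
Let p0 : 0 < p. Proof. by case/andP: p01. Qed.
Let m0 : 0 < m%:R :> R. Proof. by rewrite ltr0n (leq_trans _ m2). Qed.

Local Notation rootn := (Num.sqrt n%:R : R).
Local Notation false_mean D := (fine (\int[P]_w (false_rejections mu D w)%:E)).
Local Notation missed_mean D := (fine (\int[P]_w (missed_signals mu D w)%:E)).

Definition normalized_risk (D : Omega -> {set 'I_m}) : R :=
  risk delta0 deltaA mu D / (m%:R * p * deltaA).

Lemma normalized_riskE D : normalized_risk D =
  delta0 / deltaA * (false_mean D / (m%:R * p)) + missed_mean D / (m%:R * p).
Proof.
rewrite /normalized_risk /risk unlock /false_rejections /missed_signals.
by field; rewrite !gt_eqF.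
Qed.

Lemma normalized_risk_bounds D (a b c : R) :
  m%:R * p * a <= missed_mean D -> missed_mean D <= m%:R * p * b ->
  delta0 / deltaA * false_mean D <= m%:R * p * c ->
  a <= normalized_risk D <= c + b.
Proof.
move=> ha hb hc; rewrite normalized_riskE; apply/andP; split.
  rewrite -[a]add0r lerD//; last by rewrite ler_pdivlMr// mulrC.
  rewrite !mulr_ge0 ?invr_ge0 ?(ltW mp0) ?(ltW delta00) ?(ltW deltaA0)//.
  by rewrite fine_ge0// integral_ge0// => w _; rewrite lee_fin ler0n.
apply: lerD; first by rewrite mulrA ler_pdivrMr// [leRHS]mulrC.
by rewrite ler_pdivrMr// [leRHS]mulrC.
Qed.

Lemma step_risk_bounds (alpha lam h K T eta : R) (D : Omega -> {set 'I_m}) :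
  0 < alpha < 1 -> 0 < lam -> 0 < h < 1 -> 0 <= K ->
  null_excess m alpha lam h <= K -> 0 < eta -> eta < T ->
  (forall w i, i \in D w ->
    p_value n sigma (sample_mean X w i) <= #|D w|%:R * alpha / m%:R) ->
  (forall w i, i \notin D w -> exists k : nat, [/\ (0 < k <= m)%N,
    k%:R * alpha / m%:R < p_value n sigma (sample_mean X w i) &
    (card_below (fun i => p_value n sigma (sample_mean X w i)) (k%:R * alpha / m%:R) < k)%N]) ->
  let x := 2 * expR (- (p * fine (nu `[T, (T + eta)%R]%classic) *
    expR (n%:R * (T ^+ 2 / 2 + eta * T) / sigma ^+ 2) * (alpha / 8))) in
  x <= 2^-1 ->
  fine (nu (window (T - eta *+ 2))) * (1 - 2 * normal_tail (rootn * eta / sigma)) -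
    (2 / (1 - h) + K) * (alpha / 2) * (p / normal_tail (rootn * (T - eta) / sigma))
  <= normalized_risk D <=
  delta0 / deltaA * ((1 - h)^-1 + K) +
    (fine (nu (window (T + eta *+ 2))) + 2 * normal_tail (rootn * eta / sigma) + 2 * x).
Proof.
move=> alpha01 lam0 h01 K0 excess eta0 etaT HD HA x x12.
have [alpha0 _] := andP alpha01; have [h0 h1] := andP h01.
have h10 : 0 < 1 - h by rewrite subr_gt0.
have T0 : 0 < T by exact: lt_trans etaT.
set z := rootn * (T - eta) / sigma.
have z0 : 0 <= z.
  by rewrite divr_ge0 ?(ltW sigma0)// mulr_ge0// subr_ge0 ltW.
have tz0 : 0 < normal_tail z.
  apply: lt_le_trans (normal_tail_lb z0).
  by rewrite mulr_gt0 ?expR_gt0// normal_peak_gt0// oner_eq0.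
apply: normalized_risk_bounds.
- have kap0 : 0 < m%:R * (2 * normal_tail z) / alpha by rewrite divr_gt0// mulr_gt0// mulr_gt0.
  apply: le_trans (missed_signals_self_consistent sigma0 n0 p01 nu0 model alpha01
    lam0 h01 HD (ltW eta0) (ltW etaT) kap0).
  rewrite ler_pM2l// lerD2l lerN2 ler_pdivrMr//.
  (* Uses 1 + m p <= 2 m p and K <= m p K, both from m p >= 1. *)
  have -> : (2 / (1 - h) + K) * (alpha / 2) * (p / normal_tail z) *
      (m%:R * (2 * normal_tail z) / alpha) = 2 * (m%:R * p) / (1 - h) + m%:R * p * K.
    by field; rewrite !gt_eqF.
  apply: lerD; first by rewrite ler_pM2r ?invr_gt0//; move: mp1; lra.
  by rewrite (le_trans excess)// ler_peMl.
- exact: (missed_signals_step sigma0 n0 p01 nu0 model alpha01 m2 T0 (ltW eta0) HA).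
- rewrite mulrCA ler_pM2l ?divr_gt0//.
  apply: le_trans (false_rejections_self_consistent sigma0 n0 p01 nu0 model alpha01 lam0 h01 HD) _.
  rewrite mulrDr lerD2l (le_trans excess)// ler_peMl//.
Qed.

Lemma oracle_risk_bounds (T eta : R) : 0 < eta -> eta < T / 2 ->
  expR (n%:R * (T - eta) ^+ 2 / (2 * sigma ^+ 2)) < delta0 / deltaA * ((1 - p) / p) ->
  (forall s : R, s = 1 \/ s = -1 -> delta0 / deltaA * ((1 - p) / p) <
    fine (nu [set x | T <= s * x <= T + eta]) *
      expR (n%:R * (T ^+ 2 / 2 + eta * T) / sigma ^+ 2)) ->
  fine (nu (window (T - eta *+ 2))) * (1 - 2 * normal_tail (rootn * eta / sigma))
  <= normalized_risk (fun w =>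
    oracle_rejections n sigma p delta0 deltaA nu (sample_mean X w)) <=
  2 * (fine (nu (band T (eta *+ 2))) + expR (- (n%:R * eta ^+ 2 / (2 * sigma ^+ 2)))) +
    (fine (nu (window (T + eta *+ 2))) + 2 * normal_tail (rootn * eta / sigma)).
Proof.
move=> eta0 etaT lb ub; set D := fun w => _.
(* The oracle interval is deterministic, with end points within eta of - T and T, so the exceptional
   events of the counting lemmas are empty and [bad] is 0. *)
have noint : (\int[P]_w (0 : R)%:E <= (p * 0)%:E)%E.
  by rewrite mulr0 integral0.
apply: normalized_risk_bounds.
- rewrite -[X in _ * X <= _]subr0.
  apply: (missed_signals_ge sigma0 n0 p01 model (ltW eta0) (bad := fun _ _ => 0)) => //.
  move=> w i; rewrite /D inE => /asboolPn wi _.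
  by rewrite ltNge (oracle_acceptance_ge sigma0 n0 eta0 etaT p01 deltaA0 lb ub wi).
- rewrite -[X in _ <= _ * X]addr0.
  apply: (missed_signals_le sigma0 n0 p01 nu0 model (ltW eta0) (bad := fun _ _ => 0)) => //.
  move=> w i; rewrite /D inE negbK => /asboolP/(oracle_acceptance_lt sigma0 n0 eta0 etaT p01 deltaA0 lb ub) + _.
  by rewrite ltNge => /negbTE ->.
have [a [b [a0 b0 aE bE]]] := oracle_solutions sigma0 n0 eta0 etaT p01 deltaA0 lb ub.
have [_ _ aT] := oracle_equation_bounds sigma0 n0 eta0 etaT p01 deltaA0 lb ub aE.
have [_ _ bT] := oracle_equation_bounds sigma0 n0 eta0 etaT p01 deltaA0 lb ub bE.
rewrite (ltr0_norm a0) in aT; rewrite (gtr0_norm b0) in bT.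
have HD w i : i \in D w -> sample_mean X w i <= a \/ b <= sample_mean X w i.
  rewrite /D inE => /asboolPn wi; have [|xa] := leP (sample_mean X w i) a; first by left.
  have [|xb] := leP b (sample_mean X w i); first by right.
  by case: wi; exists a, b; split => //; rewrite xa xb.
have fr := false_rejections_le_interval sigma0 n0 p01 nu0 model (ltW a0) (ltW b0) HD.
have dd : 0 < delta0 / deltaA by rewrite divr_gt0.
apply: le_trans (ler_wpM2l (ltW dd) fr) _.
have -> : delta0 / deltaA * (m%:R * (1 - p) * (normal_tail (rootn * b / sigma) +
    normal_tail (rootn * - a / sigma))) =
  m%:R * p * (delta0 / deltaA * ((1 - p) / p) * normal_tail (rootn * b / sigma) +
    delta0 / deltaA * ((1 - p) / p) * normal_tail (rootn * - a / sigma)).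
  by field; rewrite !gt_eqF.
by rewrite ler_pM2l// mulr_natl mulr2n lerD.
Qed.

End risk_bounds.

Section risk_limits.
Context (R : realType) (sigma : R) (nu : probability R R)
  (n : nat -> nat) (p delta0 deltaA : nat -> R)
  (d : nat -> measure_display) (Omega : forall m, measurableType (d m))
  (P : forall m, probability (Omega m) R)
  (mu : forall m, 'I_m -> {RV (P m) >-> R})
  (X : forall m, 'I_(n m) -> 'I_m -> {RV (P m) >-> R})
  (C beta alpha : R).

Arguments mu : clear implicits.
Arguments X : clear implicits.

Local Notation delta m := (delta0 m / deltaA m).
Local Notation xbar m w := (sample_mean (X m) w).

Hypotheses (sigma0 : 0 < sigma) (nu0 : nu [set 0] = 0%E)
  (model : forall m, (2 <= m)%N ->
    [/\ (0 < n m)%N, 0 < p m < 1, 0 < delta0 m, 0 < deltaA m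
      & two_groups_model sigma (p m) nu (mu m) (X m)])
  (HA : assumption_A n p (fun m => delta m) C) (HC : assumption_C sigma nu C)
  (beta01 : 0 < beta <= 1)
  (pE : forall m, (2 <= m)%N -> p m = m%:R `^ (- beta))
  (nlog : propto (fun m => (n m)%:R) (fun m => ln m%:R : R))
  (delta_cvg0 : delta m @[m --> \oo] --> (0 : R))
  (ln_delta : (fun m => ln (delta m) : R^o) =o_\oo (fun m => ln m%:R : R^o))
  (alpha01 : 0 < alpha < 1).

Let T : R := sigma * Num.sqrt C.
Let v : R := fine (nu (window T)).

Let p01 m : (2 <= m)%N -> 0 < p m < 1.
Proof. by move=> /model[]. Qed.

Let delta_gt0 m : (2 <= m)%N -> 0 < delta m.
Proof. by move=> /model[_ _ ? ? _]; rewrite divr_gt0. Qed.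

Let C0 : 0 < C.
Proof. exact: (limit_constant_gt0 p01 delta_gt0 HA beta01 pE nlog ln_delta). Qed.

Let T0 : 0 < T. Proof. exact: threshold_gt0. Qed.

Local Notation tail_eta eta := (fun m => normal_tail (Num.sqrt (n m)%:R * eta / sigma)).

Let tail_cvg0 eta : 0 < eta -> tail_eta eta m @[m --> \oo] --> (0 : R).
Proof.
exact: (normal_tail_eta_cvg0 sigma0 p01 delta_gt0 HA beta01 pE nlog ln_delta).
Qed.

Lemma step_risk_cvg (D : forall m, Omega m -> {set 'I_m}) :
  (forall m w i, i \in D m w ->
    p_value (n m) sigma (xbar m w i) <= #|D m w|%:R * alpha / m%:R) ->
  (forall m w i, i \notin D m w -> exists k : nat, [/\ (0 < k <= m)%N,
    k%:R * alpha / m%:R < p_value (n m) sigma (xbar m w i) &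
    (card_below (fun i => p_value (n m) sigma (xbar m w i)) (k%:R * alpha / m%:R) < k)%N]) ->
  normalized_risk (p m) (mu m) (delta0 m) (deltaA m) (D m) @[m --> \oo] --> v.
Proof.
move=> HD HDc; have [alpha0 alpha1] := andP alpha01.
(* A proportion strictly between [alpha] and 1: above [alpha] for a positive Chernoff rate, below 1
   so that signals remain a fixed fraction of the rejections. *)
pose h := (1 + alpha) / 2.
have h01 : 0 < h < 1 by rewrite /h; lra.
have [lam lam0 /null_excess_bounded[K K0 excess]] : exists2 lam : R, 0 < lam &
    0 < lam * h - alpha * (expR lam - 1).
  by apply: chernoff_rate => //; rewrite /h; lra.
apply: cvg_approx => e e0.
have [eta /andP[eta0 etaT2] bande] := nu_band_small sigma0 C0 HC e0.
have etaT : eta < T by move: T0 eta0 etaT2; rewrite -/T; lra.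
have tail0 := tail_cvg0 eta0.
have ratio0 := sparsity_over_tail_cvg0 sigma0 p01 delta_gt0 HA beta01 pE nlog ln_delta eta0 etaT.
have a80 : 0 < alpha / 8 by rewrite divr_gt0.
have x0 := right_signal_cvg0 sigma0 p01 delta_gt0 HA HC beta01 pE nlog ln_delta eta0 a80.
have mp m : (2 <= m)%N -> 1 <= m%:R * p m.
  exact: (mp_ge1 p01 beta01 pE).
(* Only the limits are given here; the two bounding sequences are read off from [step_risk_bounds]
   in the first goal treated. *)
eexists; eexists; exists (fine (nu (window (T - eta *+ 2))) * (1 - 2 * 0) -
    (2 / (1 - h) + K) * (alpha / 2) * 0), (0 * ((1 - h)^-1 + K) +
    (fine (nu (window (T + eta *+ 2))) + 2 * 0 + 2 * 0)); split; last 3 first.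
- near=> m.
  have m2 : (2 <= m)%N by near: m; exact: nbhs_infty_ge.
  have [n0 pm d0 dA md] := model m2.
  apply: (step_risk_bounds sigma0 m2 n0 pm nu0 md d0 dA (mp _ m2) alpha01 lam0 h01 K0
    (excess m) eta0 etaT (HD m) (HDc m)).
  by near: m; apply: (cvgr_le _ x0); rewrite invr_gt0.
- rewrite !mulr0 !subr0 mulr1.
  by apply: le_trans (nu_window_lower nu T (eta *+ 2)); rewrite lerD2l lerN2.
- rewrite mul0r mulr0 !addr0 add0r.
  by apply: le_trans (nu_window_upper nu T (eta *+ 2)) _; rewrite lerD2l.
- apply: cvgB; last by apply: cvgM; [exact: cvg_cst|exact: ratio0].
  apply: cvgM; first exact: cvg_cst.
  apply: cvgB; first exact: cvg_cst.
  by apply: cvgM; [exact: cvg_cst|exact: tail0].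
(* Here delta -> 0 enters: the false rejections per expected signal are merely bounded, and delta is
   what makes their cost vanish. *)
- apply: cvgD; first by apply: cvgM; [exact: delta_cvg0|exact: cvg_cst].
  apply: cvgD; last by apply: cvgM; [exact: cvg_cst|exact: x0].
  apply: cvgD; first exact: cvg_cst.
  by apply: cvgM; [exact: cvg_cst|exact: tail0].
Unshelve. all: by end_near. Qed.

Lemma oracle_risk_cvg :
  normalized_risk (p m) (mu m) (delta0 m) (deltaA m) (fun w =>
    oracle_rejections (n m) sigma (p m) (delta0 m) (deltaA m) nu (xbar m w))
  @[m --> \oo] --> v.
Proof.
apply: cvg_approx => e e0.
(* The band mass is spent three times: once for each end point of the oracle interval, and once for
   widening the window. *)
have e30 : 0 < e / 3 by rewrite divr_gt0.
have [eta /andP[eta0 etaT2] bande] := nu_band_small sigma0 C0 HC e30.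
have etaT : eta < T by move: T0 eta0 etaT2; rewrite -/T; lra.
have tail0 := tail_cvg0 eta0.
have gauss0 := gauss_eta_cvg0 sigma0 p01 delta_gt0 HA beta01 pE nlog ln_delta eta0.
have odds := oracle_odds_bounds sigma0 p01 delta_gt0 HA HC beta01 pE nlog ln_delta eta0 etaT.
exists (fun m => fine (nu (window (T - eta *+ 2))) * (1 - 2 * tail_eta eta m)).
exists (fun m => 2 * (fine (nu (band T (eta *+ 2))) +
    expR (- ((n m)%:R * eta ^+ 2 / (2 * sigma ^+ 2)))) +
  (fine (nu (window (T + eta *+ 2))) + 2 * tail_eta eta m)).
exists (fine (nu (window (T - eta *+ 2))) * (1 - 2 * 0)),
  (2 * (fine (nu (band T (eta *+ 2))) + 0) +
    (fine (nu (window (T + eta *+ 2))) + 2 * 0)); split; last 3 first.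
- near=> m.
  have m2 : (2 <= m)%N by near: m; exact: nbhs_infty_ge.
  have [n0 pm d0 dA md] := model m2.
  have [lb ub] : expR ((n m)%:R * (T - eta) ^+ 2 / (2 * sigma ^+ 2)) <
      delta m * ((1 - p m) / p m) /\
    forall s : R, s = 1 \/ s = -1 -> delta m * ((1 - p m) / p m) <
      fine (nu [set x | T <= s * x <= T + eta]) *
      expR ((n m)%:R * (T ^+ 2 / 2 + eta * T) / sigma ^+ 2).
    by near: m.
  exact: (oracle_risk_bounds sigma0 m2 n0 pm nu0 md d0 dA (mp_ge1 p01 beta01 pE m2)
    eta0 etaT2 lb ub).
- rewrite mulr0 subr0 mulr1.
  apply: le_trans (nu_window_lower nu T (eta *+ 2)); rewrite lerD2l lerN2.
  by apply: (le_trans bande); rewrite ler_pdivrMr//; move: e0; lra.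
- rewrite mulr0 !addr0.
  by have := nu_window_upper nu T (eta *+ 2); move: bande; rewrite /v -/T; lra.
- apply: cvgM; first exact: cvg_cst.
  apply: cvgB; first exact: cvg_cst.
  by apply: cvgM; [exact: cvg_cst|exact: tail0].
- apply: cvgD.
    apply: cvgM; first exact: cvg_cst.
    by apply: cvgD; [exact: cvg_cst|exact: gauss0].
  apply: cvgD; first exact: cvg_cst.
  by apply: cvgM; [exact: cvg_cst|exact: tail0].
Unshelve. all: by end_near. Qed.

(** The normalization cancels in the ratio of the two risks, and their common limit [v] is
    positive. *)
Lemma abos_of_cvg (D : forall m, Omega m -> {set 'I_m}) :
  normalized_risk (p m) (mu m) (delta0 m) (deltaA m) (D m) @[m --> \oo] --> v ->
  abos (fun m => risk (delta0 m) (deltaA m) (mu m) (D m))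
    (fun m => risk (delta0 m) (deltaA m) (mu m) (fun w =>
      oracle_rejections (n m) sigma (p m) (delta0 m) (deltaA m) nu (xbar m w))).
Proof.
have v0 : 0 < v by exact: (nu_window_gt0 sigma0 C0 HC).
move=> Dv; rewrite /abos.
have : normalized_risk (p m) (mu m) (delta0 m) (deltaA m) (D m) /
    normalized_risk (p m) (mu m) (delta0 m) (deltaA m) (fun w =>
      oracle_rejections (n m) sigma (p m) (delta0 m) (deltaA m) nu (xbar m w))
    @[m --> \oo] --> v / v.
  by apply: cvgM => //; apply: cvgV; [rewrite gt_eqF|exact: oracle_risk_cvg].
rewrite divff ?gt_eqF//; apply: cvg_near_eq; near=> m.
have m2 : (2 <= m)%N by near: m; exact: nbhs_infty_ge.
have [n0 /andP[pm _] d0 dA md] := model m2.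
have c0 : m%:R * p m * deltaA m != 0.
  by rewrite gt_eqF// mulr_gt0// (lt_le_trans _ (mp_ge1 p01 beta01 pE m2)).
rewrite /normalized_risk invf_div mulrA divfK//.
Unshelve. all: by end_near. Qed.

End risk_limits.

Theorem corollary2p5 (R : realType) (sigma : R) (nu : probability R R)
    (n : nat -> nat) (p delta0 deltaA : nat -> R)
    (d : nat -> measure_display) (Omega : forall m, measurableType (d m))
    (P : forall m, probability (Omega m) R)
    (mu : forall m, 'I_m -> {RV (P m) >-> R})
    (X : forall m, 'I_(n m) -> 'I_m -> {RV (P m) >-> R})
    (C beta alpha : R) :
  let delta m := delta0 m / deltaA m in
  let xbar m (w : Omega m) := sample_mean (X m) w in
  let pval m (w : Omega m) i := p_value (n m) sigma (xbar m w i) in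
  let risk_of m (D : Omega m -> {set 'I_m}) :=
    risk (delta0 m) (deltaA m) (mu m) D in
  let RB m := risk_of m (fun w =>
    oracle_rejections (n m) sigma (p m) (delta0 m) (deltaA m) nu (xbar m w)) in
  0 < sigma ->
  nu [set 0] = 0%E -> (0 < nu `]-oo, 0%R[%classic)%E -> (0 < nu `]0%R, +oo[%classic)%E ->
  (forall m, (2 <= m)%N ->
    [/\ (0 < n m)%N, 0 < p m < 1, 0 < delta0 m, 0 < deltaA m
      & two_groups_model sigma (p m) nu (mu m) (X m)]) ->
  assumption_A n p delta C ->
  assumption_C sigma nu C ->
  0 < beta <= 1 ->
  (forall m, (2 <= m)%N -> p m = m%:R `^ (- beta)) ->
  propto (fun m => (n m)%:R) (fun m => ln m%:R : R) ->
  delta m @[m --> \oo] --> (0 : R) ->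
  (fun m => ln (delta m) : R^o) =o_\oo (fun m => ln m%:R : R^o) ->
  0 < alpha < 1 ->
  abos (fun m => risk_of m (fun w => bh_rejections alpha (pval m w))) RB /\
  abos (fun m => risk_of m (fun w => sd_rejections alpha (pval m w))) RB.
Proof.
move=> delta xbar pval risk_of RB sigma0 nu0 _ _ model HA HC beta01 pE nlog dcvg lnd alpha01.
have [alpha0 _] := andP alpha01.
have cvg := abos_of_cvg sigma0 nu0 model HA HC beta01 pE nlog lnd.
split; apply: cvg.
- apply: (step_risk_cvg sigma0 nu0 model HA HC beta01 pE nlog dcvg lnd alpha01) => m w i.
    exact: bh_self_consistent.
  exact: bh_accepted.
- apply: (step_risk_cvg sigma0 nu0 model HA HC beta01 pE nlog dcvg lnd alpha01) => m w i.
    exact: sd_self_consistent.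
  exact: sd_accepted.
Qed.
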